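(* Let $k \ge 0$ and $n \ge 1$ be integers, and let $K$ be a ball of dimension $2^{k+1}n$ which is $\left(2^{(3/2)^k}\cdot 4\right)$-semiround. Then $K$ has a $256$-round subquotient of dimension $n$.
   Context: Let $V$ be a finite-dimensional real vector space. A ball (also called a symmetric convex body or Banach ball) in $V$ is a compact convex set $K \subset V$ with nonempty interior that is invariant under $x \mapsto -x$; its dimension is $\dim V$. It is the unit ball of a unique norm $\|\cdot\|_K$ on $V$, given by $\|v\|_K = \min\{t \ge 0 : v \in tK\}$. A ball $K$ is an ellipsoid if $\|\cdot\|_K$ is an inner-product norm (so ellipsoids are centered at the origin). A ball $K$ of dimension $m$ is $r$-semiround if it contains an ellipsoid $E \subset V$ (of the same dimension $m$) such that $(\mathrm{Vol}\, K)/(\mathrm{Vol}\, E) \le r^m$; this ratio does not depend on the choice of volume form (Lebesgue measure) on $V$. A ball $K$ is $r$-round if it contains an ellipsoid $E$ such that $K \subseteq rE$. If $K$ is a ball in $V$ and $W \subseteq V$ is a linear subspace, then $W \cap K$ (a ball in $W$) is called a slice of $K$, and the image of $K$ in $V/W$ (a ball in $V/W$) is called a projection of $K$. A subquotient of $K$ is a slice of a projection of $K$. *)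

(* Defs.v *)
From HB Require Import structures.
From mathcomp Require Import all_boot all_order all_algebra.
From mathcomp Require Import all_classical all_reals all_analysis.

Set Implicit Arguments.
Unset Strict Implicit.
Unset Printing Implicit Defensive.

Import Order.TTheory GRing.Theory Num.Theory.
Import numFieldNormedType.Exports.

Local Open Scope classical_set_scope.
Local Open Scope ring_scope.

(** The quotient space V/W: the quotient group [Quotient.quot] of the library,
    made into a finite-dimensional vector space. *)
Section QuotientSpace.
Variables (F : fieldType) (V : vectType F) (W : {vspace V}).

Definition quotv : Type := @Quotient.quot V (pred_of_vspace W).

HB.instance Definition _ := GRing.Zmodule.on quotv.
HB.instance Definition _ := EqQuotient.on quotv.

Definition quotv_pi (x : V) : quotv := (\pi_quotv x)%qT.

Lemma quotv_piP (x y : V) : quotv_pi x = quotv_pi y <-> x - y \in W.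
Proof. by rewrite (@Quotient.idealrBE V (pred_of_vspace W)); split=> /eqP. Qed.

Lemma quotv_reprK (q : quotv) : quotv_pi (repr q) = q.
Proof. exact: reprK. Qed.

Fact quotv_pi_is_zmod_morphism : zmod_morphism quotv_pi.
Proof.
move=> x y; rewrite /quotv_pi (@Quotient.pi_add V (pred_of_vspace W)).
by rewrite (@Quotient.pi_opp V (pred_of_vspace W)).
Qed.

HB.instance Definition _ :=
  GRing.isZmodMorphism.Build V quotv quotv_pi quotv_pi_is_zmod_morphism.

Definition quotv_scale (a : F) (q : quotv) : quotv := quotv_pi (a *: repr q).

Lemma quotv_piZ a (x : V) : quotv_pi (a *: x) = quotv_scale a (quotv_pi x).
Proof.
apply/quotv_piP; rewrite -scalerBr; apply: memvZ.
by apply: (proj1 (quotv_piP _ _)); rewrite quotv_reprK.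
Qed.

Fact quotv_scaleA a b q :
  quotv_scale a (quotv_scale b q) = quotv_scale (a * b) q.
Proof. by rewrite -(quotv_reprK q) -!quotv_piZ scalerA. Qed.

Fact quotv_scale1 : left_id 1 quotv_scale.
Proof. by move=> q; rewrite -(quotv_reprK q) -!quotv_piZ scale1r. Qed.

Fact quotv_scaleDr : right_distributive quotv_scale +%R.
Proof.
move=> a p q; rewrite -(quotv_reprK p) -(quotv_reprK q) -raddfD -!quotv_piZ.
by rewrite scalerDr raddfD.
Qed.

Fact quotv_scaleDl q : {morph quotv_scale^~ q : a b / a + b}.
Proof.
by move=> a b; rewrite -(quotv_reprK q) -!quotv_piZ scalerDl raddfD.
Qed.

HB.instance Definition _ := GRing.Zmodule_isLmodule.Build F quotv
  quotv_scaleA quotv_scale1 quotv_scaleDr quotv_scaleDl.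

HB.instance Definition _ :=
  GRing.isScalable.Build F V quotv *:%R quotv_pi quotv_piZ.

(* Coordinates on V/W: those, in a basis of a complement W^C, of the component
   along W^C of a representative. *)
Let co (x : V) : 'rV[F]_(\dim W^C) :=
  \row_i coord (vbasis W^C) i (daddv_pi W^C W x).

Let co_linear : linear co.
Proof. by move=> a x y; apply/rowP => i; rewrite !mxE !linearP. Qed.

Let dW : (W^C :&: W = 0)%VS. Proof. by rewrite capvC capv_compl. Qed.

Let xE x : daddv_pi W^C W x + daddv_pi W W^C x = x.
Proof. by apply: daddv_pi_add => //; rewrite addvC addv_complf memvf. Qed.

Let coW x : (co x == 0) = (x \in W).
Proof.
apply/eqP/idP => [co0|xW].
- suff p0 : daddv_pi W^C W x = 0 by rewrite -(xE x) p0 add0r memv_pi.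
  rewrite (coord_vbasis (memv_pi W^C W x)) big1// => i _.
  by have /rowP/(_ i) := co0; rewrite !mxE => ->; rewrite scale0r.
- have := xE x; rewrite [X in _ + X]daddv_pi_id ?capv_compl// => xx.
  have p0 : daddv_pi W^C W x = 0 by apply: (addIr x); rewrite add0r.
  by apply/rowP => i; rewrite !mxE p0 linear0.
Qed.

Let lift (r : 'rV[F]_(\dim W^C)) : V := \sum_i r 0 i *: (vbasis W^C)`_i.

Let lift_in r : lift r \in (W^C)%VS.
Proof.
apply: memv_suml => j _; rewrite memvZ// vbasis_mem//.
by rewrite mem_nth// size_tuple.
Qed.

Fact quotv_vect_iso : Vector.axiom (\dim W^C) quotv.
Proof.
pose L : {linear V -> 'rV[F]_(\dim W^C)} :=
  HB.pack co (GRing.isLinear.Build _ _ _ _ co co_linear).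
have LE (x y : V) : quotv_pi x = quotv_pi y <-> co x = co y.
  rewrite quotv_piP -coW (linearB L x y : co (x - y) = co x - co y) subr_eq0.
  by split=> [/eqP|/eqP].
have coK x : co (repr (quotv_pi x)) = co x by apply/LE; rewrite quotv_reprK.
exists (fun q => co (repr q)).
- move=> a p q; rewrite -{1}(quotv_reprK p) -{1}(quotv_reprK q).
  by rewrite -linearP coK; exact: (linearP L).
- exists (fun r => quotv_pi (lift r)).
  + move=> q; rewrite -[RHS]quotv_reprK; apply/LE.
    have -> : lift (co (repr q)) = daddv_pi W^C W (repr q).
      rewrite [RHS](coord_vbasis (memv_pi W^C W _)).
      by apply: eq_bigr => j _; rewrite mxE.
    by apply/rowP => i; rewrite !mxE daddv_pi_id// memv_pi.
  + move=> r; rewrite coK; apply/rowP => i; rewrite mxE daddv_pi_id//.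
    by rewrite coord_sum_free// (basis_free (vbasisP _)).
Qed.

HB.instance Definition _ := Lmodule_hasFinDim.Build F quotv quotv_vect_iso.

End QuotientSpace.

(** m-dimensional Lebesgue measure on the m-tuples of reals, as an iterated
    product of the one-dimensional one. *)
Section LebesgueTuple.
Variable R : realType.
Local Notation T := (measurableTypeR R).
Local Open Scope ereal_scope.

Definition tuple_cons m (p : T * m.-tuple T) : m.+1.-tuple T :=
  [tuple of p.1 :: p.2].

Lemma measurable_tuple_cons m : measurable_fun [set: _] (@tuple_cons m).
Proof. exact: measurable_cons. Qed.

HB.instance Definition _ m :=
  isMeasurableFun.Build _ _ _ _ (@tuple_cons m) (@measurable_tuple_cons m).

Section Step.
Variables (m : nat) (mu : {sigma_finite_measure set (m.-tuple T) -> \bar R}).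

Definition lebesgue_tuple_step : set (m.+1.-tuple T) -> \bar R :=
  pushforward (lebesgue_measure \x mu) (@tuple_cons m).

Let step0 : lebesgue_tuple_step set0 = 0.
Proof. exact: measure0. Qed.

Let step_ge0 A : 0 <= lebesgue_tuple_step A.
Proof. exact: measure_ge0. Qed.

Let step_sigma_additive : semi_sigma_additive lebesgue_tuple_step.
Proof. exact: measure_semi_sigma_additive. Qed.

HB.instance Definition _ := isMeasure.Build _ _ _
  lebesgue_tuple_step step0 step_ge0 step_sigma_additive.

Fact lebesgue_tuple_step_sigma_finite : sigma_finite setT lebesgue_tuple_step.
Proof.
have [G GT Goo] : sigma_finite setT (lebesgue_measure \x mu).
  have /sigma_finiteP[A [AT ndA Aoo]] := sigma_finiteT (@lebesgue_measure R).
  have /sigma_finiteP[B [BT ndB Boo]] := sigma_finiteT mu.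
  exists (fun i => A i `*` B i).
    apply/seteqP; split=> // -[x y] _.
    have [i _ Ax] : (\bigcup_i A i) x by rewrite -AT.
    have [j _ By] : (\bigcup_i B i) y by rewrite -BT.
    exists (maxn i j) => //; split.
    - by move: x Ax; exact/subsetPset/ndA/leq_maxl.
    - by move: y By; exact/subsetPset/ndB/leq_maxr.
  move=> i; have [mA Afin] := Aoo i; have [mB Bfin] := Boo i.
  split; first exact: measurableX.
  by rewrite product_measure1E// lte_mul_pinfty// ge0_fin_numE.
pose uncons (t : m.+1.-tuple T) : T * m.-tuple T := (thead t, [tuple of behead t]).
have unconsK : cancel uncons (@tuple_cons m).
  by move=> t; apply/val_inj; rewrite /= [in RHS](tuple_eta t).
have consK : cancel (@tuple_cons m) uncons.
  by move=> [x t]; rewrite /uncons theadE; congr pair; apply/val_inj.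
have muncons : measurable_fun [set: _] uncons.
  by apply: measurable_fun_pair; [exact: measurable_tnth|exact: measurable_behead].
exists (fun i => uncons @^-1` G i).
  apply/seteqP; split=> // t _.
  have : [set: T * m.-tuple T] (uncons t) by [].
  by rewrite GT => -[i _ Gi]; exists i.
move=> i; have [mG Gfin] := Goo i; split.
  by rewrite -[X in measurable X]setTI; exact: muncons.
rewrite /lebesgue_tuple_step /pushforward -comp_preimage.
by have /funext -> : uncons \o @tuple_cons m =1 id by [].
Qed.

HB.instance Definition _ := Measure_isSigmaFinite.Build _ _ _
  lebesgue_tuple_step lebesgue_tuple_step_sigma_finite.

End Step.

Fixpoint lebesgue_tuple (m : nat) :
    {sigma_finite_measure set (m.-tuple T) -> \bar R} :=
  if m is m'.+1 then lebesgue_tuple_step (lebesgue_tuple m')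
  else \d_([tuple] : 0.-tuple T).

End LebesgueTuple.

Section Balls.
Variables (R : realType) (V : vectType R).
Implicit Types (K E A : set V) (r : R).

(* The linear isomorphism R^m -> V given by a fixed basis of V. Neither the
   topology it induces on V nor ratios of volumes depend on the basis. *)
Definition of_coords : 'rV[R]_(\dim {:V}) -> V := passmx.vecof (vbasis {:V}).

(* Symmetric convex bodies, called balls in the asymptotic-geometry literature;
   the name [ball] is taken by metric balls. *)
Definition ball_body K : Prop :=
  [/\ compact (of_coords @^-1` K), (of_coords @^-1` K)° !=set0,
      convex_set (K : set (convex_lmodType V)) & forall x, K x -> K (- x)].

(* The norm whose unit ball is K; the infimum is a minimum when K is a ball. *)
Definition gauge K (v : V) : R :=
  inf [set t : R | 0 <= t /\ exists2 x, K x & v = t *: x].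

Definition ellipsoid E : Prop :=
  ball_body E /\
  exists dot : {dot V for idfun}, forall v, gauge E v = Num.sqrt (dot v v).

Definition vol A : \bar R :=
  lebesgue_tuple R (\dim {:V}) [set t | A (of_coords (\row_i tnth t i))].

(* [semiround] and [round] are meant for sets that satisfy [ball_body]. The
   ellipsoid E has nonempty interior, so 0 < vol E < +oo. *)
Definition semiround r K : Prop :=
  exists E, [/\ ellipsoid E, E `<=` K &
    (vol K / vol E <= (r ^+ \dim {:V})%:E)%E].

Definition round r K : Prop :=
  exists E, [/\ ellipsoid E, E `<=` K & K `<=` [set r *: x | x in E]].

Definition slice K (W : {vspace V}) : set (subvs_of W) := vsval @^-1` K.

Definition projection K (W : {vspace V}) : set (quotv W) :=
  quotv_pi W @` K.

End Balls.

Arguments slice {R V} K W _.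
Arguments projection {R V} K W _.

(* A slice of a projection: W is the kernel of the projection of V and U is the
   subspace of V/W cutting out the slice, so its dimension is \dim U. *)
Definition subquotient (R : realType) (V : vectType R) (K : set V)
    (W : {vspace V}) (U : {vspace quotv W}) : set (subvs_of U) :=
  slice (projection K W) U.

Arguments subquotient {R V} K W U _.

(* Main.v *)
Require Import Defs.
From HB Require Import structures.
From mathcomp Require Import all_boot all_order all_algebra.
From mathcomp Require Import all_classical all_reals all_analysis.
From mathcomp Require Import measurable_realfun.
From mathcomp Require Import ring lra.

(**
Choose coordinates in which the ellipsoid E is the Euclidean unit ball B of
[R^N], N = 2 m with m = 2^k n, so that the body K contains B and
vol K <= r^N vol B with r = 2^((3/2)^k) 4 ([lebesgue_rV_normal_form]).

Choosing a hyperplane at random, m times in succession, turns the bound on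
vol K into one on a slice: some m-dimensional slice L of K satisfies
[\int_L |z|^m dz <= r^N \int_(B_m) |z|^m dz] ([average_subspace]).  The power of
|z| is the Jacobian of polar coordinates: it compensates for the fact that
random subspaces of dimension m crowd near the origin.  Since L is convex and
symmetric, a single point p of L far from the origin makes the left-hand side
large: L contains the image of a half of itself under the homothety of ratio 1/2
centred at p ([far_point_moment]).  The outcome is a trade-off between the volume
and the diameter of L ([slice_tradeoff]):
|p|^m vol L <= (4 r^2)^m vol B_m for every p in L.

Put s^3 = 4 r^2; this is the recursion satisfied by the radii
2^((3/2)^k) 4 ([radiusS]).  If vol L <= s^m vol B_m, then L satisfies the
hypothesis of the theorem with k - 1 in place of k.  Otherwise the trade-off
puts L inside s^2 B_m, so the polar M of L, dilated by s^2, contains B_m, and by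
the Blaschke-Santalo inequality ([santalo])
vol M <= (s^m vol B_m)^2 / vol L <= s^m vol B_m, so that M satisfies the
hypothesis instead.  A round subquotient of M dualises to a round subquotient of
L ([has_round_polar]), hence of K.  At k = 0 one has r = 8 and
vol B_m <= vol L, so the trade-off reads L <= 256 B_m: this slice is the
subquotient sought.  This is the induction of [has_round_of_lebesgue_rV].

The inequalities behind this are built from the line up: the one-dimensional
Brunn-Minkowski inequality gives the Prekopa-Leindler inequality through level
sets, and that one yields both the Brunn-Minkowski inequality in [R^m] and,
after an exponential substitution, the multiplicative form that drives the
symmetrization proof of Blaschke-Santalo.
*)

Set Implicit Arguments.
Unset Strict Implicit.
Unset Printing Implicit Defensive.

Import Order.TTheory GRing.Theory Num.Theory.
Import numFieldNormedType.Exports.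

Local Open Scope classical_set_scope.
Local Open Scope ring_scope.

(** * Lebesgue measure on row vectors *)

Section RowSpace.
Variable R : realType.
Local Notation T := (measurableTypeR R).

Definition rv m (t : m.-tuple T) : 'rV[R]_m := \row_i tnth t i.
Definition tv m (x : 'rV[R]_m) : m.-tuple T := [tuple x 0 i | i < m].

Lemma rvK m : cancel (@rv m) (@tv m).
Proof. by move=> t; apply: eq_from_tnth => i; rewrite tnth_mktuple mxE. Qed.

Lemma tvK m : cancel (@tv m) (@rv m).
Proof. by move=> x; apply/rowP => i; rewrite mxE tnth_mktuple. Qed.

(** Measurability of sets of row vectors is transported from tuples, on which the
Lebesgue measure is defined; [open_rV_measurable] shows that this is the Borel
structure of the normed space of row vectors. *)
Definition rV_measurable m : set_system 'rV[R]_m :=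
  [set A | measurable (@rv m @^-1` A)].

Lemma rV_measurable0 m : @rV_measurable m set0.
Proof. by rewrite /rV_measurable/= preimage_set0. Qed.

Lemma rV_measurableC m A : @rV_measurable m A -> @rV_measurable m (~` A).
Proof. by rewrite /rV_measurable/= preimage_setC; exact: measurableC. Qed.

Lemma rV_measurable_bigcup m (F : _^nat) :
  (forall i, @rV_measurable m (F i)) -> @rV_measurable m (\bigcup_i F i).
Proof.
move=> mF; rewrite /rV_measurable/= preimage_bigcup; apply: bigcup_measurable => i _; exact: mF.
Qed.

Definition rV_display : measure_display := default_measure_display.

HB.instance Definition _ m := @isMeasurable.Build rV_display
  'rV[R]_m (@rV_measurable m) (@rV_measurable0 m) (@rV_measurableC m)
  (@rV_measurable_bigcup m).

Lemma measurable_rv m : measurable_fun setT (@rv m).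
Proof. by move=> _ A mA; rewrite setTI. Qed.

Lemma measurable_coord m (i : 'I_m) :
  measurable_fun setT (fun x : 'rV[R]_m => x 0 i : T).
Proof.
move=> _ A mA; rewrite setTI /measurable/= /rV_measurable/= -comp_preimage.
have -> : (fun x : 'rV[R]_m => x 0 i) \o @rv m = (@tnth m T ^~ i).
  by apply/funext => t/=; rewrite mxE.
by rewrite -[X in measurable X]setTI; exact: measurable_tnth.
Qed.

Lemma measurable_tv m : measurable_fun setT (@tv m).
Proof.
apply/measurable_fun_tnthP => i.
rewrite (_ : _ \o _ = fun x : 'rV[R]_m => x 0 i); first exact: measurable_coord.
by apply/funext => x /=; rewrite tnth_mktuple.
Qed.

Lemma measurable_fun_rV d (S : measurableType d) m (f : S -> 'rV[R]_m) :
  (forall i, measurable_fun setT (fun s => f s 0 i : T)) -> measurable_fun setT f.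
Proof.
move=> mf; rewrite (_ : f = @rv m \o (@tv m \o f)); last first.
  by apply/funext => s /=; rewrite tvK.
apply: measurableT_comp; first exact: measurable_rv.
apply/measurable_fun_tnthP => i; rewrite (_ : _ \o _ = fun s => f s 0 i) //.
by apply/funext => x /=; rewrite tnth_mktuple.
Qed.

Definition lebesgue_rV m : set 'rV[R]_m -> \bar R := pushforward (lebesgue_tuple R m) (@rv m).

Section LebesgueMeasure.
Variable m : nat.
HB.instance Definition _ := isMeasurableFun.Build _ _ _ _ (@rv m) (@measurable_rv m).
Let lebesgue_rV_measure0 : @lebesgue_rV m set0 = 0%E. Proof. exact: measure0. Qed.
Let lebesgue_rV_ge0 A : (0 <= @lebesgue_rV m A)%E. Proof. exact: measure_ge0. Qed.
Let lebesgue_rV_sigma_additive : semi_sigma_additive (@lebesgue_rV m).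
Proof. exact: measure_semi_sigma_additive. Qed.
HB.instance Definition _ := isMeasure.Build _ _ _ (@lebesgue_rV m) lebesgue_rV_measure0 lebesgue_rV_ge0 lebesgue_rV_sigma_additive.

Let lebesgue_rV_sigma_finite : sigma_finite setT (@lebesgue_rV m).
Proof.
have [G GT Goo] := sigma_finiteT (lebesgue_tuple R m).
exists (fun i => @tv m @^-1` G i).
  apply/seteqP; split=> // x _; have : [set: m.-tuple T] (tv x) by [].
  by rewrite GT => -[i _ Gi]; exists i.
move=> i; have [mG Gfin] := Goo i; split.
  by rewrite -[X in measurable X]setTI; exact: measurable_tv.
rewrite /lebesgue_rV /pushforward -comp_preimage.
by have /funext -> : @tv m \o @rv m =1 id by exact: rvK.
Qed.
HB.instance Definition _ := Measure_isSigmaFinite.Build _ _ _ (@lebesgue_rV m) lebesgue_rV_sigma_finite.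
End LebesgueMeasure.

(** Locked, so that conversion never looks into the block structure of a row. *)
Definition consr m (s : R) (x : 'rV[R]_m) : 'rV[R]_m.+1 := locked (row_mx s%:M x).
Definition headr m (x : 'rV[R]_m.+1) : R := x 0 0.
Definition tailr m (x : 'rV[R]_m.+1) : 'rV[R]_m := \row_i x 0 (lift ord0 i).

Lemma consr0 m s (x : 'rV[R]_m) : consr s x 0 0 = s.
Proof.
by rewrite /consr -lock mxE; case: splitP => j //= _; rewrite ord1 mxE eqxx mulr1n.
Qed.

Lemma consrS m s (x : 'rV[R]_m) (i : 'I_m) : consr s x 0 (lift ord0 i) = x 0 i.
Proof.
rewrite /consr -lock mxE; case: splitP => [j|j /= /eqP].
  by rewrite ord1 /= /bump.
by rewrite /bump/= !add1n eqSS => /eqP ij; congr (x _ _); apply/val_inj.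
Qed.

Lemma headr_consr m s (x : 'rV[R]_m) : headr (consr s x) = s.
Proof. exact: consr0. Qed.

Lemma tailr_consr m s (x : 'rV[R]_m) : tailr (consr s x) = x.
Proof. by apply/rowP => i; rewrite mxE consrS. Qed.

Lemma consr_eta m (x : 'rV[R]_m.+1) : consr (headr x) (tailr x) = x.
Proof.
apply/rowP => i; case: (unliftP ord0 i) => [j|] ->; last exact: consr0.
by rewrite consrS mxE.
Qed.

Lemma consrD m s t (x y : 'rV[R]_m) : consr s x + consr t y = consr (s + t) (x + y).
Proof.
rewrite -[LHS]consr_eta; congr consr; first by rewrite /headr mxE !consr0.
by apply/rowP => i; rewrite !mxE !consrS ?mxE.
Qed.

Lemma consrZ m c s (x : 'rV[R]_m) : c *: consr s x = consr (c * s) (c *: x).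
Proof.
rewrite -[LHS]consr_eta; congr consr; first by rewrite /headr mxE !consr0.
by apply/rowP => i; rewrite !mxE !consrS ?mxE.
Qed.

Lemma measurable_consr m :
  measurable_fun setT (fun p : T * 'rV[R]_m => consr p.1 p.2).
Proof.
apply: measurable_fun_rV => i; case: (unliftP ord0 i) => [j|] ->.
  rewrite (_ : (fun _ => _) = (fun x : 'rV[R]_m => x 0 j) \o snd); last first.
    by apply/funext => p /=; rewrite consrS.
  by apply: measurableT_comp => //; exact: measurable_coord.
rewrite (_ : (fun _ => _) = fst)//.
by apply/funext => p /=; rewrite consr0.
Qed.

Local Open Scope ereal_scope.

(** Holds by construction of the measure on tuples as an iterated product; only the
transport from tuples to rows has to be undone. *)
Lemma lebesgue_rV_prod m (f : 'rV[R]_m.+1 -> \bar R) : measurable_fun setT f ->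
  (forall x, 0 <= f x) ->
  \int[@lebesgue_rV m.+1]_x f x =
  \int[lebesgue_measure \x @lebesgue_rV m]_p f (consr p.1 p.2).
Proof.
move=> mf f0.
have mF : measurable_fun setT (fun p : T * 'rV[R]_m => f (consr p.1 p.2)).
  by apply: measurableT_comp => //; exact: measurable_consr.
rewrite (fubini_tonelli1 _ mF)//=.
rewrite (ge0_integral_pushforward (@measurable_rv _))//= preimage_setT.
have mfr : measurable_fun setT (f \o @rv m.+1).
  by apply: measurableT_comp => //; exact: measurable_rv.
rewrite (ge0_integral_pushforward (@measurable_tuple_cons _ _))//= preimage_setT.
rewrite (fubini_tonelli1 (fun p => f (rv (tuple_cons p))))//=; last first.
  by apply: (measurableT_comp mfr); exact: measurable_tuple_cons.
apply: eq_integral => s _; rewrite /fubini_F/=.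
rewrite [RHS](ge0_integral_pushforward (@measurable_rv _))//=.
  rewrite preimage_setT.
  apply: eq_integral => t _ /=; congr f; apply/rowP => i; rewrite mxE.
  by case: (unliftP ord0 i) => [j|] ->; rewrite ?consrS ?consr0 ?tnthS ?mxE.
exact: (measurableT_comp mF (pair1_measurable s)).
Qed.

Lemma lebesgue_rV_head m (f : 'rV[R]_m.+1 -> \bar R) : measurable_fun setT f ->
  (forall x, 0 <= f x) ->
  \int[@lebesgue_rV m.+1]_x f x =
  \int[lebesgue_measure]_s \int[@lebesgue_rV m]_x f (consr s x).
Proof.
move=> mf f0; rewrite lebesgue_rV_prod// fubini_tonelli1//.
by apply: measurableT_comp => //; exact: measurable_consr.
Qed.

Lemma lebesgue_rV_tail m (f : 'rV[R]_m.+1 -> \bar R) : measurable_fun setT f ->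
  (forall x, 0 <= f x) ->
  \int[@lebesgue_rV m.+1]_x f x =
  \int[@lebesgue_rV m]_x \int[lebesgue_measure]_s f (consr s x).
Proof.
move=> mf f0; rewrite lebesgue_rV_prod// fubini_tonelli2//.
by apply: measurableT_comp => //; exact: measurable_consr.
Qed.

Lemma lebesgue_rV_dim0 : @lebesgue_rV 0 setT = 1.
Proof. by rewrite /lebesgue_rV/= /pushforward preimage_setT diracT. Qed.

End RowSpace.

(** * Euclidean norm, topology and Borel sets *)

Section Euclidean.
Variable R : realType.
Local Notation T := (measurableTypeR R).

Definition dotr m (x y : 'rV[R]_m) : R := \sum_i x 0 i * y 0 i.
Definition sqn m (x : 'rV[R]_m) : R := dotr x x.
Definition eball m : set 'rV[R]_m := [set x | sqn x <= 1].

Lemma continuous_rV (S : topologicalType) m (f : S -> 'rV[R]_m) :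
  (forall i, continuous (fun s => f s 0 i)) -> continuous f.
Proof.
move=> cf s A [P Ps PA]; rewrite nbhs_filterE.
apply: (@filterS _ (nbhs s) _ [set t | forall i, P 0 i (f t 0 i)]).
  by move=> t Pt; apply: PA => i j; rewrite (ord1 i).
by apply: filter_forall => i; exact: (cf i s _ (Ps 0 i)).
Qed.

Lemma continuous_sum (S : topologicalType) (I : finType) (f : I -> S -> R) :
  (forall i, continuous (f i)) -> continuous (fun s => \sum_i f i s).
Proof.
move=> cf.
suff : forall r : seq I, continuous (fun s => \sum_(i <- r) f i s) by exact.
elim=> [|i r IH].
  rewrite (_ : (fun _ => _) = cst 0); first by move=> x; exact: cvg_cst.
  by apply/funext => s; rewrite big_nil.
rewrite (_ : (fun _ => _) = (f i \+ (fun s => \sum_(i <- r) f i s))).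
  by move=> x; apply: continuousD; [exact: cf|exact: IH].
by apply/funext => s; rewrite big_cons.
Qed.

Lemma mulmx_continuous m n (M : 'M[R]_(m, n)) :
  continuous (fun x : 'rV[R]_m => x *m M).
Proof.
apply: continuous_rV => i; under eq_fun do rewrite mxE.
apply: continuous_sum => j x.
apply: (@continuousM _ _ (fun y : 'rV[R]_m => y 0 j) (cst (M j i))).
  exact: coord_continuous.
exact: cst_continuous.
Qed.

Lemma sqn_continuous m : continuous (@sqn m).
Proof.
by apply: continuous_sum => j x; apply: continuousM; exact: coord_continuous.
Qed.

Lemma rV_box_measurable m (a : 'rV[R]_m) (e : R) :
  measurable [set x : 'rV[R]_m | forall i, `|a 0 i - x 0 i| < e].
Proof.
rewrite (_ : mkset _ =
  \bigcap_(i in [set: 'I_m]) [set x : 'rV[R]_m | `|a 0 i - x 0 i| < e]).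
  apply: fin_bigcap_measurable => // i _.
  rewrite (_ : mkset _ = (fun x : 'rV[R]_m => x 0 i : T) @^-1` (ball (a 0 i) e)).
    rewrite -[X in measurable X]setTI; apply: measurable_coord => //.
    exact: measurable_ball.
  by [].
by apply/seteqP; split=> x /= h i; [move=> _; exact: h|exact: h].
Qed.

(** An open set is the union of the cubes with rational centre and radius 1/(p+1)
that it contains, and there are countably many of these. *)
Lemma open_rV_measurable m (U : set 'rV[R]_m) : open U -> measurable U.
Proof.
move=> oU.
pose box (p : 'rV[rat]_m * nat) : set 'rV[R]_m :=
  [set x | forall i, `|ratr (p.1 0 i) - x 0 i| < p.2.+1%:R^-1].
pose F p := if `[< box p `<=` U >] then box p else set0.
rewrite (_ : U = \bigcup_p F p); last first.
  apply/seteqP; split=> [x Ux|x [p _]]; last first.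
    by rewrite /F; case: asboolP => // h /h.
  have /nbhs_ballP[e /= e0 xeU] : nbhs x U by exact: open_nbhs_nbhs.
  have e20 : 0 < e / 2 by rewrite divr_gt0.
  have [N _ /(_ _ (leqnn N)) Ne] := near_infty_natSinv_lt (PosNum e20).
  have N0 : 0 < N.+1%:R^-1 :> R by rewrite invr_gt0.
  have qP i : exists q : rat, `|ratr q - x 0 i| < N.+1%:R^-1.
    have [|q] := @rat_in_itvoo R (x 0 i) (x 0 i + N.+1%:R^-1); first by rewrite ltrDl.
    by rewrite in_itv/= => /andP[q1 q2]; exists q; rewrite ger0_norm; last (by rewrite subr_ge0 ltW); rewrite ltrBlDl.
  exists (\row_i projT1 (cid (qP i)), N) => //.
  have xb : box (\row_i projT1 (cid (qP i)), N) x.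
    by move=> i /=; rewrite mxE; case: cid.
  rewrite /F; case: asboolP => // -[] y yb; apply: xeU; split=> // i j.
  rewrite (ord1 i) /ball/=; move: (xb j) (yb j); set u := ratr _ => /= h1 h2.
  rewrite (_ : x 0 j - y 0 j = (u - y 0 j) - (u - x 0 j)); last by ring.
  apply: le_lt_trans (ler_normB _ _) _; move: Ne => /=; set w := N.+1%:R^-1 in h1 h2 * => Ne; lra.
apply: (@countable_bigcupT_measurable _ _ ('rV[rat]_m * nat)%type F); first exact: countableP.
move=> p; rewrite /F; case: asboolP => // _.
have := rV_box_measurable (\row_i (ratr (p.1 0 i) : R)) p.2.+1%:R^-1.
by congr measurable; apply/seteqP; split=> x /= h i; have := h i; rewrite mxE.
Qed.

Lemma closed_rV_measurable m (A : set 'rV[R]_m) : closed A -> measurable A.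
Proof. by move/closed_openC/open_rV_measurable/measurableC; rewrite setCK. Qed.

Lemma rV_closed_of_compact m (A : set 'rV[R]_m) : compact A -> closed A.
Proof. by apply: compact_closed; exact: norm_hausdorff. Qed.

Lemma compact_rV_measurable m (A : set 'rV[R]_m) : compact A -> measurable A.
Proof. by move/rV_closed_of_compact; exact: closed_rV_measurable. Qed.

Lemma continuous_rV_measurable m (f : 'rV[R]_m -> T) :
  continuous (f : 'rV[R]_m -> R) -> measurable_fun setT f.
Proof.
move=> /continuousP cf; apply: (measurability _ (RGenOpens.measurableE R)).
move=> _ [_ [a [b ->] <-]]; rewrite setTI; apply: open_rV_measurable.
exact/cf/interval_open.
Qed.

Lemma mulmx_measurable m n (M : 'M[R]_(m, n)) :
  measurable_fun setT (fun x : 'rV[R]_m => x *m M).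
Proof.
apply: measurable_fun_rV => i; apply: continuous_rV_measurable => x.
apply: (@continuous_comp _ _ _ (fun x : 'rV[R]_m => x *m M) (fun y : 'rV[R]_n => y 0 i)).
  exact: mulmx_continuous.
exact: coord_continuous.
Qed.

Lemma sqn_ge0 m (x : 'rV[R]_m) : 0 <= sqn x.
Proof. by apply: sumr_ge0 => i _; rewrite -expr2 sqr_ge0. Qed.

Lemma sqn_coord_le m (x : 'rV[R]_m) i : x 0 i ^+ 2 <= sqn x.
Proof.
rewrite /sqn /dotr (bigD1 i)//= -expr2 lerDl sumr_ge0// => j _.
by rewrite -expr2 sqr_ge0.
Qed.

Lemma closed_sqn_le m (c : R) : closed [set x : 'rV[R]_m | sqn x <= c].
Proof.
apply: (@preimage_closed _ _ (@sqn m) [set x | x <= c]).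
  by move=> x _; exact: sqn_continuous.
exact: closed_le.
Qed.

Lemma compact_sqn_le m (c : R) : compact [set x : 'rV[R]_m | sqn x <= c].
Proof.
apply: bounded_closed_compact; last exact: closed_sqn_le.
exists (1 + c); split; first exact: num_real.
move=> M cM x /= xc.
rewrite [leLHS]mx_normrE; apply/bigmax_leP; split=> [|i _].
  by have := sqn_ge0 x; lra.
have := sqn_coord_le x i.2; rewrite (ord1 i.1); set t := x 0 _ => t2.
by rewrite ler_norml; apply/andP; split; nra.
Qed.

Lemma compact_sqn_bounded m (A : set 'rV[R]_m) : compact A ->
  exists2 c : R, 0 <= c & A `<=` [set x | sqn x <= c].
Proof.
move=> cA; have [->|A0] := eqVneq A set0; first by exists 0.
have /set0P A1 := A0.
have [|c _ ch] := @EVT_max_rV R m (@sqn m) A A1 cA.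
  by apply: continuous_subspaceT => x; exact: sqn_continuous.
by exists (sqn c); [exact: sqn_ge0|move=> x Ax; apply: ch; exact: mem_set].
Qed.

End Euclidean.

(** * Orthonormal frames *)

Section LinearAlgebra.
Variable R : realType.

Lemma dotrE m (x y : 'rV[R]_m) : dotr x y = (x *m y^T) 0 0.
Proof. by rewrite mxE; apply: eq_bigr => i _; rewrite mxE. Qed.

Lemma dotrC m (x y : 'rV[R]_m) : dotr x y = dotr y x.
Proof. by apply: eq_bigr => i _; rewrite mulrC. Qed.

Lemma dotrDl m (x y z : 'rV[R]_m) : dotr (x + y) z = dotr x z + dotr y z.
Proof. by rewrite /dotr -big_split; apply: eq_bigr => i _; rewrite mxE mulrDl. Qed.

Lemma dotrZl m c (x z : 'rV[R]_m) : dotr (c *: x) z = c * dotr x z.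
Proof. by rewrite /dotr mulr_sumr; apply: eq_bigr => i _; rewrite mxE mulrA. Qed.

Lemma dotrDr m (x y z : 'rV[R]_m) : dotr z (x + y) = dotr z x + dotr z y.
Proof. by rewrite dotrC dotrDl !(dotrC z). Qed.

Lemma dotrZr m c (x z : 'rV[R]_m) : dotr z (c *: x) = c * dotr z x.
Proof. by rewrite dotrC dotrZl (dotrC z). Qed.

Lemma dotrNl m (x z : 'rV[R]_m) : dotr (- x) z = - dotr x z.
Proof. by rewrite -scaleN1r dotrZl mulN1r. Qed.

Lemma dotrNr m (x z : 'rV[R]_m) : dotr z (- x) = - dotr z x.
Proof. by rewrite dotrC dotrNl dotrC. Qed.

Lemma dotr_mulmx m n (x : 'rV[R]_m) (M : 'M[R]_(m, n)) (y : 'rV[R]_n) :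
  dotr (x *m M) y = dotr x (y *m M^T).
Proof. by rewrite !dotrE trmx_mul trmxK mulmxA. Qed.

Lemma sqn_eq0 m (x : 'rV[R]_m) : (sqn x == 0) = (x == 0).
Proof.
apply/eqP/eqP => [x0|->]; last by rewrite /sqn /dotr big1// => i _; rewrite mxE mul0r.
apply/rowP => i; rewrite mxE; apply/eqP; rewrite -sqrf_eq0 eq_le sqr_ge0 andbT.
by rewrite -x0 sqn_coord_le.
Qed.

Lemma sqn_gt0 m (x : 'rV[R]_m) : x != 0 -> 0 < sqn x.
Proof. by move=> x0; rewrite lt_neqAle sqn_ge0 eq_sym sqn_eq0 x0. Qed.

Lemma sqnD m (x y : 'rV[R]_m) : sqn (x + y) = sqn x + 2 * dotr x y + sqn y.
Proof. by rewrite /sqn dotrDl !dotrDr (dotrC y x); ring. Qed.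

Lemma sqnZ m c (x : 'rV[R]_m) : sqn (c *: x) = c ^+ 2 * sqn x.
Proof. by rewrite /sqn dotrZl dotrZr; ring. Qed.

Lemma dotr_delta m (x : 'rV[R]_m) i : dotr x (delta_mx 0 i) = x 0 i.
Proof.
rewrite /dotr (bigD1 i)//= mxE !eqxx mulr1 big1 ?addr0// => j ji.
by rewrite mxE (negbTE ji) andbF mulr0.
Qed.

(** Gram-Schmidt for the scalar product with matrix G, one row of T at a time: as long
as T has fewer than n rows some nonzero x is G-orthogonal to all of them, and x
normalized is the next row. *)
Lemma posdef_orthonormal n (G : 'M[R]_n) : G^T = G ->
  (forall x : 'rV[R]_n, x != 0 -> 0 < (x *m G *m x^T) 0 0) ->
  exists2 T : 'M[R]_n, T \in unitmx & T *m G *m T^T = 1%:M.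
Proof.
move=> Gs Gpos.
suff [T TG] : exists T : 'M[R]_n, T *m G *m T^T = 1%:M.
  by exists T => //; move: TG; rewrite -mulmxA => /mulmx1_unit[].
suff H k : (k <= n)%N -> exists T : 'M[R]_(k, n), T *m G *m T^T = 1%:M by exact: H.
elim: k => [|k IH] kn; first by exists 0; apply/matrixP => -[].
have [T TG] := IH (ltnW kn).
have [x x0 xT] : exists2 x : 'rV[R]_n, x != 0 & x *m (G *m T^T) = 0.
  have : kermx (G *m T^T) != 0.
    rewrite -mxrank_eq0 mxrank_ker subn_eq0 -ltnNge.
    exact: leq_ltn_trans (rank_leq_col _) kn.
  by case/rowV0Pn => x /sub_kermxP xT x0; exists x.
set q := (x *m G *m x^T) 0 0; have q0 : 0 < q by exact: Gpos.
pose y := (Num.sqrt q)^-1 *: x.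
have yT : y *m G *m T^T = 0 by rewrite -mulmxA -scalemxAl xT scaler0.
suff : exists T : 'M[R]_(1 + k, n), T *m G *m T^T = 1%:M by [].
exists (col_mx y T).
rewrite tr_col_mx mul_col_mx mul_col_row yT TG.
have -> : T *m G *m y^T = 0.
  by apply: trmx_inj; rewrite !trmx_mul trmxK Gs mulmxA yT trmx0.
have qE : x *m G *m x^T = q%:M.
  by apply/matrixP => i j; rewrite !ord1 [RHS]mxE eqxx mulr1n.
rewrite (_ : y *m G *m y^T = 1%:M) ?scalar_mx_block//.
rewrite /y linearZ/= -!scalemxAl -scalemxAr qE scalerA -invfM -expr2 sqr_sqrtr ?ltW//.
by rewrite scale_scalar_mx mulVf// gt_eqF.
Qed.

(** U is the reflection exchanging x and the first basis vector scaled to the length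
of x, that is, the reflection along their difference v. *)
Lemma householder m (x : 'rV[R]_m.+1) : exists2 U : 'M[R]_m.+1,
  U *m U^T = 1%:M & x *m U = Num.sqrt (sqn x) *: delta_mx 0 0.
Proof.
set r := Num.sqrt (sqn x); pose e : 'rV[R]_m.+1 := delta_mx 0 0; pose v := x - r *: e.
have r2 : r ^+ 2 = sqn x by rewrite sqr_sqrtr// sqn_ge0.
have [v0|v0] := eqVneq v 0.
  by exists 1%:M; rewrite ?trmx1 ?mulmx1//; apply/eqP; rewrite -subr_eq0 -/v v0.
have vv0 := sqn_gt0 v0; set w := sqn v in vv0.
have sc (y z : 'rV[R]_m.+1) : y *m z^T = (dotr y z)%:M.
  by apply/matrixP => i j; rewrite !ord1 -dotrE mxE eqxx mulr1n.
pose P := v^T *m v; have PP : P *m P = w *: P.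
  by rewrite /P mulmxA -(mulmxA v^T) sc mul_mx_scalar -scalemxAl.
pose U := 1%:M - (2 / w) *: P.
have UT : U^T = U by rewrite /U linearB linearZ/= trmx1 trmx_mul trmxK.
exists U.
  rewrite UT /U mulmxBl mul1mx mulmxBr mulmx1 -scalemxAl -scalemxAr PP !scalerA.
  rewrite -scalerBl (_ : _ - _ = - (2 / w)); last by field; rewrite gt_eqF.
  by rewrite scaleNr opprK subrK.
have dxe : dotr x e = x 0 0 by exact: dotr_delta.
have ee : dotr e e = 1 by rewrite dotr_delta mxE !eqxx.
have xv : dotr x v = w / 2.
  rewrite /w /v sqnD -scaleNr sqnZ !dotrDr !dotrZr /sqn ee dxe -/(sqn x) -r2.
  by field.
rewrite /U mulmxBr mulmx1 -scalemxAr /P mulmxA sc xv mul_scalar_mx scalerA.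
rewrite (_ : 2 / w * (w / 2) = 1); last by field; rewrite gt_eqF.
by rewrite scale1r /v opprB addrC subrK.
Qed.

(** The rows span the graph of the linear form [a]; almost every hyperplane is such a
graph, so [a] serves as a coordinate on the space of hyperplanes. *)
Definition graph_mx m (a : 'rV[R]_m) : 'M[R]_(m, m.+1) :=
  \matrix_(i, j) consr (a 0 i) (delta_mx 0 i) 0 j.

Lemma mul_graph_mx m (a x : 'rV[R]_m) : x *m graph_mx a = consr (dotr a x) x.
Proof.
rewrite -[LHS]consr_eta; congr consr.
  rewrite /headr mxE; apply: eq_bigr => i _; rewrite [graph_mx _ _ _]mxE consr0 mulrC//.
apply/rowP => i; rewrite mxE mxE (bigD1 i)//= [graph_mx _ _ _]mxE consrS mxE !eqxx mulr1.
rewrite big1 ?addr0// => j ji; rewrite [graph_mx _ _ _]mxE consrS mxE eq_sym (negbTE ji).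
by rewrite mulr0.
Qed.

(** An orthonormal basis of the graph of [a], from Gram-Schmidt applied to the basis
given by the rows of [graph_mx a]. *)
Lemma graph_orthonormal m (a : 'rV[R]_m) : exists2 T : 'M[R]_m, T \in unitmx &
  (T *m graph_mx a) *m (T *m graph_mx a)^T = 1%:M.
Proof.
have [|x x0|T uT TT] := @posdef_orthonormal m (graph_mx a *m (graph_mx a)^T).
- by rewrite trmx_mul trmxK.
- rewrite mulmxA -mulmxA -trmx_mul mul_graph_mx -dotrE; apply: sqn_gt0.
  by apply: contra x0 => /eqP E; rewrite -(tailr_consr (dotr a x) x) E; apply/eqP/rowP => i; rewrite !mxE.
- by exists T => //; rewrite trmx_mul !mulmxA -!mulmxA in TT *.
Qed.

End LinearAlgebra.

(** * Affine changes of variables *)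

Section Affine1.
Variable R : realType.
Local Notation T := (measurableTypeR R).
Local Notation mu1 := (@lebesgue_measure R).
Local Open Scope ereal_scope.

Lemma affine_measurable (c a : R) : measurable_fun setT (fun s : T => (c * s + a)%R : T).
Proof.
apply: continuous_measurable_fun => x; apply: cvgD; last exact: cvg_cst.
exact: mulrl_continuous.
Qed.

(** Both sides are measures in A that agree on half-open intervals. *)
Lemma lebesgue_affine (c a : R) (A : set T) : (0 < c)%R -> measurable A ->
  mu1 A = c%:E * mu1 [set s | A (c * s + a)%R].
Proof.
move=> c0 mA.
pose f (s : T) : T := (c * s + a)%R.
have mf : measurable_fun setT f := affine_measurable c a.
pose fm : {mfun T >-> T} := HB.pack f (isMeasurableFun.Build _ _ _ _ _ mf).
have -> : c%:E * mu1 [set s | A (c * s + a)%R]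
  = mscale (NngNum (ltW c0)) (pushforward mu1 fm) A by [].
apply: (lebesgue_measure_unique (mu := mscale (NngNum (ltW c0)) (pushforward mu1 fm))) => //.
move=> _ [[x y] _ <-]; rewrite /mscale/= /pushforward/=.
rewrite [X in _ = _ * X](_ : _ = mu1 `](x - a) / c, (y - a) / c]%classic%R); last first.
  congr (mu1 _); apply/seteqP; split=> s /=; rewrite !in_itv/= /f;
  by rewrite ltr_pdivrMr// ler_pdivlMr// ltrBlDr lerBrDr mulrC.
rewrite !lebesgue_measure_itv/= !lte_fin ltr_pM2r ?invr_gt0// ltrD2r.
case: ifPn => _; last by rewrite mule0.
by rewrite -!EFinD -EFinM; congr EFin; field; lra.
Qed.

Lemma ge0_integral_affine (c a : R) (f : R -> \bar R) : (0 < c)%R ->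
  measurable_fun (setT : set T) f -> (forall s, 0 <= f s) ->
  \int[mu1]_s f s = c%:E * \int[mu1]_s f (c * s + a)%R.
Proof.
move=> c0 mf f0.
pose g (s : T) : T := (c * s + a)%R.
have mg : measurable_fun setT g := affine_measurable c a.
pose gm : {mfun T >-> T} := HB.pack g (isMeasurableFun.Build _ _ _ _ _ mg).
have := @ge0_integral_pushforward _ _ _ _ R g mg mu1 setT f measurableT mf (fun y _ => f0 y).
rewrite preimage_setT => <-.
pose m2 : {measure set T -> \bar R} := mscale (NngNum (ltW c0)) (pushforward mu1 gm).
transitivity (\int[m2 mg]_s f s).
  apply: eq_measure_integral => A mA _.
  by rewrite [LHS](lebesgue_affine a c0 mA).
by rewrite ge0_integral_mscale.
Qed.

End Affine1.

Lemma integral_indicT d (X : measurableType d) (R : realType)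
    (mu : {measure set X -> \bar R}) (A : set X) : measurable A ->
  (\int[mu]_x (\1_A x)%:E = mu A)%E.
Proof. by move=> mA; rewrite integral_indic// setIT. Qed.

Section LebesgueInvariance.
Variable R : realType.
Local Notation T := (measurableTypeR R).
Local Notation mu1 := (@lebesgue_measure R).
Local Notation lam := (@lebesgue_rV R _).
Local Open Scope ereal_scope.

Lemma measurable_addr m :
  measurable_fun setT (fun p : 'rV[R]_m * 'rV[R]_m => (p.1 + p.2)%R).
Proof.
apply: measurable_fun_rV => i; under eq_fun do rewrite mxE.
by apply: measurable_funD; apply: (@measurableT_comp _ _ _ _ _ _ (fun x : 'rV[R]_m => x 0%R i : T)) => //; exact: measurable_coord.
Qed.

Lemma measurable_affine_rV m (c : R) (a : 'rV[R]_m) :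
  measurable_fun setT (fun x : 'rV[R]_m => (c *: x + a)%R).
Proof.
apply: measurable_fun_rV => i; under eq_fun do rewrite !mxE.
exact: (measurableT_comp (affine_measurable c (a 0%R i)) (measurable_coord i)).
Qed.

Lemma consr_affine m (c : R) (a x : 'rV[R]_m.+1) :
  (c *: x + a = consr (c * headr x + headr a) (c *: tailr x + tailr a))%R.
Proof.
rewrite -[LHS]consr_eta; congr consr; first by rewrite /headr !mxE.
by apply/rowP => i; rewrite !mxE.
Qed.

Lemma ge0_integral_lebesgue_rV_affine m (c : R) (a : 'rV[R]_m) (f : 'rV[R]_m -> \bar R) :
  (0 < c)%R -> measurable_fun setT f -> (forall x, 0 <= f x) ->
  \int[lam]_x f x = (c ^+ m)%:E * \int[lam]_x f (c *: x + a)%R.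
Proof.
move=> c0; elim: m a f => [|m IH] a f mf f0.
  rewrite expr0 mul1e; apply: eq_integral => x _; congr f.
  by apply/rowP => -[].
have mfa : measurable_fun setT (fun x : 'rV[R]_m.+1 => f (c *: x + a)%R).
  by apply: measurableT_comp => //; exact: measurable_affine_rV.
have mfc s : measurable_fun setT (fun x => f (consr s x)).
  apply: measurableT_comp => //.
  exact: (measurableT_comp (@measurable_consr R m) (pair1_measurable s)).
have mF : measurable_fun (setT : set T) (fun s => \int[lam]_x f (consr s x)).
  apply: (measurable_fun_fubini_tonelli_F (fun p => f (consr p.1 p.2))) => //.
  by apply: measurableT_comp => //; exact: measurable_consr.
rewrite lebesgue_rV_head// lebesgue_rV_head//.
rewrite (ge0_integral_affine (headr a) c0 mF); last first.
  by move=> s; apply: integral_ge0 => x _; exact: f0.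
rewrite exprS EFinM -muleA; congr (_ * _).
rewrite -ge0_integralZl//.
- apply: eq_integral => s _; rewrite (IH (tailr a))//; congr (_ * _).
  by apply: eq_integral => x _; rewrite consr_affine headr_consr tailr_consr.
- apply: (measurable_fun_fubini_tonelli_F (fun p => f (c *: consr p.1 p.2 + a)%R)) => //.
  exact: (measurableT_comp mfa (@measurable_consr R m)).
- by move=> s _; exact: integral_ge0.
- by rewrite lee_fin exprn_ge0// ltW.
Qed.

Lemma lebesgue_rV_affine m (c : R) (a : 'rV[R]_m) A : (0 < c)%R -> measurable A ->
  lam A = (c ^+ m)%:E * lam [set x | A (c *: x + a)%R].
Proof.
move=> c0 mA; have mB : measurable [set x | A (c *: x + a)%R].
  by rewrite -[X in measurable X]setTI; exact: measurable_affine_rV.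
rewrite -(integral_indicT lam mA) -(integral_indicT lam mB).
rewrite (ge0_integral_lebesgue_rV_affine a c0)//.
exact/measurable_EFinP/measurable_indic.
Qed.

Section Uniqueness.
Variables (m : nat) (mu : {sigma_finite_measure set 'rV[R]_m -> \bar R}).
Hypothesis muT : forall (a : 'rV[R]_m) A, measurable A ->
  mu [set x | A (x + a)%R] = mu A.

Lemma lebesgue_rV_translation (a : 'rV[R]_m) A : measurable A ->
  lam [set x | A (x + a)%R] = lam A.
Proof.
move=> mA; rewrite [RHS](lebesgue_rV_affine a ltr01 mA) expr1n mul1e.
by congr (lam _); apply/seteqP; split=> x /=; rewrite scale1r.
Qed.

(** The uniqueness of translation-invariant measures in a form free of divisions:
integrate the indicator of x in A, x + y in B against mu x lam in both orders, and
translate the inner integral each time. *)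
Lemma translation_invariant_mulC A B : measurable A -> measurable B ->
  mu A * lam B = mu B * lam [set x | A (- x)%R].
Proof.
move=> mA mB.
pose f (p : 'rV[R]_m * 'rV[R]_m) : \bar R := (\1_A p.1 * \1_B (p.1 + p.2))%:E.
have mf : measurable_fun setT f.
  apply/measurable_EFinP; apply: measurable_funM.
    by apply: measurableT_comp => //; exact: measurable_indic.
  by apply: measurableT_comp; [exact: measurable_indic|exact: measurable_addr].
have f0 p : 0 <= f p by rewrite lee_fin mulr_ge0.
have indM d (X : measurableType d) (nu : {measure set X -> \bar R}) (P : set X) (k : R) :
    (0 <= k)%R -> measurable P -> \int[nu]_x (k * \1_P x)%:E = k%:E * nu P.
  move=> k0 mP; under eq_integral do rewrite EFinM.
  rewrite ge0_integralZl_EFin//; first by rewrite integral_indicT.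
  exact/measurable_EFinP/measurable_indic.
have mtr C (h : 'rV[R]_m -> 'rV[R]_m) : measurable C -> measurable_fun setT h ->
    measurable [set x | C (h x)].
  by move=> mC mh; rewrite -[X in measurable X]setTI; exact: mh.
have madd x : measurable_fun setT (fun y : 'rV[R]_m => (x + y)%R).
  exact: (measurableT_comp (@measurable_addr m) (pair1_measurable x)).
have mneg : measurable_fun setT (fun y : 'rV[R]_m => (- y)%R).
  apply: measurable_fun_rV => i; under eq_fun do rewrite mxE.
  by apply: measurableT_comp => //; exact: measurable_coord.
have -> : mu A * lam B = \int[mu]_x \int[lam]_y f (x, y).
  have inner x : \int[lam]_y f (x, y) = lam B * (\1_A x)%:E.
    rewrite /f/= (indM _ _ lam [set y | B (x + y)%R])//; last exact: mtr.
    rewrite muleC -(lebesgue_rV_translation x mB); congr (lam _ * _).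
    by apply/seteqP; split=> y /=; rewrite addrC.
  under eq_integral do rewrite inner.
  rewrite ge0_integralZl//; first by rewrite integral_indicT// muleC.
  exact/measurable_EFinP/measurable_indic.
rewrite fubini_tonelli//.
pose g (p : 'rV[R]_m * 'rV[R]_m) : \bar R := (\1_B p.1 * \1_A (p.1 - p.2))%:E.
have mg : measurable_fun setT g.
  apply/measurable_EFinP; apply: measurable_funM.
    by apply: measurableT_comp => //; exact: measurable_indic.
  apply: measurableT_comp; first exact: measurable_indic.
  have hp : measurable_fun setT (fun p : 'rV[R]_m * 'rV[R]_m => (p.1, (- p.2)%R)).
    by apply: measurable_fun_pair => //; exact: measurableT_comp.
  exact: (measurableT_comp (@measurable_addr m) hp).
transitivity (\int[lam]_y \int[mu]_x g (x, y)).
  apply: eq_integral => y _; rewrite /f /g/=.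
  under eq_integral do rewrite -[(_ * _)%R]/((\1_A \* \1_(fun x => B (x + y)%R)) _)%R -indicI.
  under [RHS]eq_integral do rewrite -[(_ * _)%R]/((\1_B \* \1_(fun x => A (x - y)%R)) _)%R -indicI.
  have mBy : measurable [set x | B (x + y)%R].
    by apply: mtr => //; rewrite (_ : +%R^~ y = +%R y)//; apply/funext => x; rewrite addrC.
  have mAy : measurable [set x | A (x - y)%R].
    apply: mtr => //; rewrite (_ : (fun x => x - y)%R = +%R (- y)%R)//.
    by apply/funext => x; rewrite addrC.
  rewrite !integral_indicT; [|exact: measurableI..].
  apply: etrans (esym (muT (- y)%R _)) _; first exact: measurableI.
  congr (mu _); apply/seteqP; split=> x /= [h1 h2]; split=> //;
    by move: h1 h2; rewrite subrK.
rewrite -fubini_tonelli//; last by move=> p; rewrite lee_fin mulr_ge0.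
have inner x : \int[lam]_y g (x, y) = lam [set x | A (- x)%R] * (\1_B x)%:E.
  rewrite /g/= (indM _ _ lam [set y | A (x - y)%R])//; last first.
    by apply: mtr => //; exact: measurableT_comp.
  rewrite muleC -(lebesgue_rV_translation (- x)%R); last exact: mtr.
  congr (lam _ * _).
  by apply/seteqP; split=> y /=; rewrite opprD opprK addrC.
under eq_integral do rewrite inner.
rewrite ge0_integralZl//; first by rewrite integral_indicT// muleC.
exact/measurable_EFinP/measurable_indic.
Qed.

End Uniqueness.

End LebesgueInvariance.

(** * Sections, boxes and balls *)

Section Volume.
Variable R : realType.
Local Notation T := (measurableTypeR R).
Local Notation mu1 := (@lebesgue_measure R).
Local Notation lam := (@lebesgue_rV R _).
Local Open Scope ereal_scope.

Lemma lebesgue_rV_sections m (A : set 'rV[R]_m.+1) : measurable A ->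
  lam A = \int[mu1]_s lam [set x | A (consr s x)].
Proof.
move=> mA; rewrite -(integral_indicT lam mA) lebesgue_rV_head//; last first.
  exact/measurable_EFinP/measurable_indic.
apply: eq_integral => s _.
have mB : measurable [set x | A (consr s x)].
  rewrite -[X in measurable X]setTI.
  exact: (measurableT_comp (@measurable_consr R m) (pair1_measurable s)).
by rewrite -(integral_indicT lam mB).
Qed.

Lemma lebesgue_rV_sections_tail m (A : set 'rV[R]_m.+1) : measurable A ->
  lam A = \int[lam]_x mu1 [set s | A (consr s x)].
Proof.
move=> mA; rewrite -(integral_indicT lam mA) lebesgue_rV_tail//; last first.
  exact/measurable_EFinP/measurable_indic.
apply: eq_integral => x _.
have mB : measurable ([set s | A (consr s x)] : set T).
  rewrite -[X in measurable X]setTI.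
  exact: (measurableT_comp (@measurable_consr R m) (pair2_measurable x)).
by rewrite -(integral_indicT mu1 mB).
Qed.

Lemma measurable_lebesgue_rV_section m (A : set 'rV[R]_m.+1) : measurable A ->
  measurable_fun (setT : set T) (fun s => lam [set x | A (consr s x)]).
Proof.
move=> mA.
rewrite (_ : (fun _ => _) = fun s => \int[lam]_x (\1_A (consr s x))%:E).
  apply: (measurable_fun_fubini_tonelli_F (fun p => (\1_A (consr p.1 p.2))%:E)).
    apply/measurable_EFinP; apply: measurableT_comp; first exact: measurable_indic.
    exact: measurable_consr.
  by move=> p; rewrite lee_fin.
apply/funext => s; rewrite -(integral_indicT lam)//.
rewrite -[X in measurable X]setTI.
exact: (measurableT_comp (@measurable_consr R m) (pair1_measurable s)).
Qed.

Definition box m (c : R) : set 'rV[R]_m := [set x | forall i, `|x 0%R i| <= c]%R.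

Lemma box_compact m c : compact (@box m c).
Proof.
rewrite (_ : box c = [set v : 'rV[R]_m | forall i, `[- c, c]%classic%R (v ord0 i)]).
  by apply: (@rV_compact R m (fun=> `[- c, c]%classic%R)) => _; exact: segment_compact.
by apply/seteqP; split=> x /= h i; have := h i; rewrite /= in_itv/= ler_norml.
Qed.

Lemma lebesgue_rV_box m (c : R) : (0 <= c)%R -> lam (@box m c) = ((2 * c) ^+ m)%:E.
Proof.
move=> c0; elim: m => [|m IH].
  rewrite expr0 -(@lebesgue_rV_dim0 R); congr (lam _); apply/seteqP; split=> // x _; case=> k k0; have := k0; by rewrite ltn0.
rewrite lebesgue_rV_sections; last (by apply: compact_rV_measurable; exact: box_compact).
have eqs s : lam [set x : 'rV[R]_m | box c (consr s x)] =
    ((2 * c) ^+ m)%:E * (\1_(`[- c, c]%classic%R) s)%:E.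
  rewrite -IH indicE mem_setE in_itv/= -ler_norml; case: (leP `|s|%R c) => sc.
    rewrite mulr1n mule1; congr (lam _); apply/seteqP; split=> x /= h i.
      by have := h (lift ord0 i); rewrite consrS.
    by case: (unliftP ord0 i) => [j|] ->; rewrite ?consrS// consr0.
  rewrite mulr0n mule0 (_ : mkset _ = set0) ?measure0//; apply/seteqP; split=> x //= h.
  by move: h => /(_ ord0); rewrite consr0 leNgt sc.
under eq_integral do rewrite eqs.
rewrite ge0_integralZl//.
- rewrite (integral_indicT mu1 (measurable_itv _))/= lebesgue_measure_itv/= lte_fin exprSr.
  case: ltP => [cc|cc]; first by rewrite -EFinD -EFinM; congr (_ * _)%:E; ring.
  by rewrite mule0 (_ : c = 0%R) ?mulr0//; lra.
- exact/measurable_EFinP/measurable_indic.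
- by rewrite lee_fin exprn_ge0// mulr_ge0.
Qed.

Lemma lebesgue_rV_compact_lty m (A : set 'rV[R]_m) : compact A -> lam A < +oo.
Proof.
move=> cA; have [c c0 Ac] := compact_sqn_bounded cA.
apply: (@le_lt_trans _ _ (lam (box (1 + c)))).
  apply: le_measure; rewrite ?inE; [exact: compact_rV_measurable|
    exact: (compact_rV_measurable (@box_compact _ _))|].
  move=> x /Ac /= xc i; have := sqn_coord_le x i; set t := x _ _ => t2.
  by rewrite ler_norml; apply/andP; split; nra.
by rewrite lebesgue_rV_box ?ltry// addr_ge0.
Qed.

Lemma compact_eball m : compact (@eball R m).
Proof. exact: compact_sqn_le. Qed.

Lemma measurable_eball m : measurable (@eball R m).
Proof. exact: (compact_rV_measurable (@compact_eball _)). Qed.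

(** A dilate of the ball contains a cube, whose volume is explicit. *)
Lemma lebesgue_rV_eball_gt0 m : 0 < lam (@eball R m).
Proof.
rewrite lt0e measure_ge0 andbT; apply/eqP => e0.
have mm : (0 < m%:R + 1 :> R)%R by rewrite ltr_wpDl.
have := @lebesgue_rV_box m 1 ler01; rewrite mulr1 => b1.
have : lam (@box m 1) <= lam [set x : 'rV[R]_m | eball ((m%:R + 1)^-1 *: x + 0)]%R.
  apply: le_measure; rewrite ?inE; first exact: (compact_rV_measurable (@box_compact _ _)).
    rewrite -[X in measurable X]setTI; apply: measurable_affine_rV => //.
    exact: measurable_eball.
  move=> x /= bx; rewrite /eball/= addr0 sqnZ.
  have : (sqn x <= m%:R)%R.
    rewrite /sqn /dotr -[m in leRHS]card_ord -sum1_card natr_sum.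
    apply: ler_sum => i _; rewrite -expr2 -real_normK ?num_real// expr_le1//.
  move=> xm; rewrite exprVn ler_pdivrMl ?exprn_gt0// mulr1.
  by apply: le_trans xm _; have : (0 <= m%:R :> R)%R by []; nra.
rewrite b1; have : (0 < (m%:R + 1)^-1 :> R)%R by rewrite invr_gt0.
move=> m0; have := lebesgue_rV_affine (0%R : 'rV[R]_m) m0 (@measurable_eball m); rewrite e0 => /esym/eqP.
rewrite mule_eq0 => /orP[|/eqP ->].
  by rewrite eqe expf_eq0 invr_eq0 (gt_eqF mm) andbF.
by rewrite lee_fin leNgt exprn_gt0.
Qed.

Lemma lebesgue_rV_eball_fin m : lam (@eball R m) \is a fin_num.
Proof. by rewrite ge0_fin_numE//; exact: (lebesgue_rV_compact_lty (@compact_eball _)). Qed.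

End Volume.

(** * Linear changes of variables *)

Lemma pmuleI_fin (R : realType) (b : R) (x y : \bar R) : 0 < b ->
  (b%:E * x = b%:E * y -> x = y)%E.
Proof.
move=> b0 /(congr1 (fun z => b^-1%:E * z)%E).
by rewrite !muleA -!EFinM mulVf ?gt_eqF// !mul1e.
Qed.

Section LinearMaps.
Variable R : realType.
Local Notation lam := (@lebesgue_rV R _).
Local Open Scope ereal_scope.

(** [translation_invariant_mulC] for the Lebesgue measure itself and the ball. *)
Lemma lebesgue_rV_opp m (A : set 'rV[R]_m) : measurable A -> lam [set x | A (- x)%R] = lam A.
Proof.
move=> mA; have mE := @measurable_eball R m.
have := translation_invariant_mulC (@lebesgue_rV_translation R m) mA mE.
have e0 := @lebesgue_rV_eball_gt0 R m; move: e0; rewrite -(fineK (@lebesgue_rV_eball_fin R m)) lte_fin => e0.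
by rewrite muleC /= -(fineK (@lebesgue_rV_eball_fin R m)) => /(pmuleI_fin e0).
Qed.

Section LinearImage.
Variables (m : nat) (M : 'M[R]_m).
Hypothesis uM : M \in unitmx.

Let phi (x : 'rV[R]_m) : 'rV[R]_m := (x *m M)%R.
Let mphi : measurable_fun setT phi. Proof. exact: mulmx_measurable. Qed.
HB.instance Definition _ := isMeasurableFun.Build _ _ _ _ phi mphi.

Let nu : set 'rV[R]_m -> \bar R := pushforward lam phi.
Let nu0 : nu set0 = 0. Proof. exact: measure0. Qed.
Let nu_ge0 A : 0 <= nu A. Proof. exact: measure_ge0. Qed.
Let nu_sigma_additive : semi_sigma_additive nu.
Proof. exact: measure_semi_sigma_additive. Qed.
HB.instance Definition _ := isMeasure.Build _ _ _ nu nu0 nu_ge0 nu_sigma_additive.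

Let nu_sigma_finite : sigma_finite setT nu.
Proof.
have [G GT Goo] := sigma_finiteT (@lebesgue_rV R m).
have mM := @mulmx_measurable R m m (invmx M).
exists (fun i => (fun x : 'rV[R]_m => x *m invmx M)%R @^-1` G i).
  apply/seteqP; split=> // x _; have : [set: 'rV[R]_m] (x *m invmx M)%R by [].
  by rewrite GT => -[i _ Gi]; exists i.
move=> i; have [mG Gfin] := Goo i; split.
  by rewrite -[X in measurable X]setTI; exact: mM.
rewrite /nu /pushforward -comp_preimage.
suff -> : (fun x : 'rV[R]_m => x *m invmx M)%R \o phi = id by [].
by apply/funext => x /=; rewrite /phi mulmxK.
Qed.
HB.instance Definition _ := Measure_isSigmaFinite.Build _ _ _ nu nu_sigma_finite.

(** The image measure under M is translation invariant, hence a multiple of Lebesgue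
measure; the factor is |det M|^-1. *)
Lemma lebesgue_rV_linear : exists2 c : R, (0 < c)%R &
  forall A, measurable A -> lam [set x | A (x *m M)%R] = c%:E * lam A.
Proof.
have nuT (a : 'rV[R]_m) A : measurable A -> nu [set x | A (x + a)%R] = nu A.
  move=> mA; have mB : measurable [set x : 'rV[R]_m | A (x *m M)%R].
    by rewrite -[X in measurable X]setTI; exact: mphi.
  rewrite /nu /pushforward -[RHS](lebesgue_rV_translation (a *m invmx M)%R mB).
  congr (lam _); apply/seteqP; split=> x /=; by rewrite /phi mulmxDl mulmxKV.
pose B := @eball R m; have mB : measurable B := @measurable_eball R m.
have B0 := @lebesgue_rV_eball_gt0 R m; have Bfin := @lebesgue_rV_eball_fin R m.
have cB : compact (phi @^-1` B).
  rewrite (_ : _ @^-1` _ = (fun x : 'rV[R]_m => x *m invmx M)%R @` B).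
    apply: continuous_compact; last exact: compact_eball.
    by apply: continuous_subspaceT => x; exact: mulmx_continuous.
  apply/seteqP; split=> [x /= Bx|_ /= [x Bx <-]].
    by exists (phi x) => //; rewrite /phi mulmxK.
  by rewrite /phi /= mulmxKV.
have nBfin : nu B \is a fin_num.
  by rewrite ge0_fin_numE; [exact: lebesgue_rV_compact_lty|exact: measure_ge0].
pose b := fine (lam B); have bE : lam B = b%:E by rewrite fineK.
have b0 : (0 < b)%R by rewrite -lte_fin -bE.
pose c := (fine (nu B) / b)%R.
have nuE A : measurable A -> nu A = c%:E * lam A.
  move=> mA; have := translation_invariant_mulC nuT mA mB.
  rewrite lebesgue_rV_opp// /= bE muleC => E; apply: (pmuleI_fin b0); rewrite E -[nu B]fineK//.
  by rewrite muleA -EFinM /c mulrCA divff ?mulr1// gt_eqF.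
exists c => [|A mA]; last exact: nuE.
have : nu (setT : set 'rV[R]_m) != 0.
  have -> : nu (setT : set 'rV[R]_m) = lam (setT : set 'rV[R]_m) by [].
  by rewrite gt_eqF//; apply: (lt_le_trans B0); apply: le_measure; rewrite ?inE.
rewrite nuE// lt_neqAle divr_ge0 ?andbT ?(ltW b0)//; last by rewrite fine_ge0.
by apply: contra => /eqP <-; rewrite mul0e.
Qed.

Lemma ge0_integral_linear : exists2 c : R, (0 < c)%R &
  forall f : 'rV[R]_m -> \bar R, measurable_fun setT f -> (forall x, 0 <= f x) ->
    \int[lam]_x f (x *m M)%R = c%:E * \int[lam]_x f x.
Proof.
have [c c0 cE] := lebesgue_rV_linear; exists c => // f mf f0.
have := @ge0_integral_pushforward _ _ _ _ R phi mphi lam setT f measurableT mf (fun y _ => f0 y).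
rewrite preimage_setT => <-.
pose m2 : {measure set ('rV[R]_m) -> \bar R} := mscale (NngNum (ltW c0)) (@lebesgue_rV R m).
transitivity (\int[m2]_s f s); last by rewrite ge0_integral_mscale.
by apply: eq_measure_integral => A mA _; exact: cE.
Qed.

End LinearImage.

Lemma sqn_orth m n (Q : 'M[R]_(m, n)) (x : 'rV[R]_m) :
  (Q *m Q^T = 1%:M -> sqn (x *m Q) = sqn x)%R.
Proof.
move=> QQ; have sqnE k (y : 'rV[R]_k) : (sqn y)%:M = (y *m y^T)%R.
  apply/matrixP => i j; rewrite !ord1 !mxE mulr1n.
  by apply: eq_bigr => l _; rewrite mxE.
have := sqnE _ (x *m Q)%R; rewrite trmx_mul mulmxA -(mulmxA x) QQ mulmx1 -sqnE.
by move=> /matrixP/(_ 0%R 0%R); rewrite !mxE !mulr1n.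
Qed.

(** The constant of [ge0_integral_linear] is 1, as one sees by integrating the indicator
of the unit ball, which Q preserves. *)
Lemma ge0_integral_orth m (Q : 'M[R]_m) (f : 'rV[R]_m -> \bar R) :
  (Q *m Q^T = 1%:M)%R -> measurable_fun setT f -> (forall x, 0 <= f x) ->
  \int[lam]_x f (x *m Q)%R = \int[lam]_x f x.
Proof.
move=> QQ mf f0; have [uQ _] := mulmx1_unit QQ.
have [c c0 cE] := ge0_integral_linear uQ; rewrite cE//.
suff -> : c = 1%R by rewrite mul1e.
have mE := @measurable_eball R m.
have := cE (fun x => (\1_(@eball R m) x)%:E).
rewrite (_ : \int[_]_x _ = lam (@eball R m)); last first.
  rewrite -(integral_indicT lam mE)/=.
  apply: eq_integral => x _; rewrite !indicE; congr ((nat_of_bool _)%:R%:E).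
  by apply/idP/idP; rewrite !inE /eball/= sqn_orth.
rewrite (integral_indicT lam mE)/=.
have := @lebesgue_rV_eball_gt0 R m; rewrite -(fineK (@lebesgue_rV_eball_fin R m)) lte_fin => e0.
have mI : measurable_fun setT (fun x => (\1_(@eball R m) x : R)%:E).
  exact/measurable_EFinP/measurable_indic.
have I0 x : 0 <= (\1_(@eball R m) x : R)%:E by rewrite lee_fin.
move=> cEm; have := cEm mI I0; rewrite -EFinM => -[].
by rewrite -{1}(mul1r (fine _)) => /mulIf -> //; rewrite gt_eqF.
Qed.

End LinearMaps.

(** * One-dimensional Brunn-Minkowski and Prekopa-Leindler inequalities *)

Lemma measurable_ltr_set d (X : measurableType d) (R : realType)
    (f g : X -> measurableTypeR R) :
  measurable_fun setT f -> measurable_fun setT g -> measurable [set x | (f x : R) < g x].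
Proof.
move=> mf mg.
rewrite (_ : [set x | _] = setT `&` (fun x => g x - f x) @^-1` `]0, +oo[%classic).
  by apply: (measurable_funB mg mf) => //; exact: measurable_itv.
by rewrite setTI; apply/seteqP; split=> x /=; rewrite in_itv/= andbT subr_gt0.
Qed.

Section PrekopaLeindler.
Variable R : realType.
Local Notation T := (measurableTypeR R).
Local Notation mu1 := (@lebesgue_measure R).
Local Open Scope ereal_scope.

Lemma lebesgue_compact_lty (K : set R) : compact K -> mu1 K < +oo.
Proof.
move=> cK; have [c [_ Kc]] := compact_bounded cK.
have {}Kc : K `<=` `[- (c + 1), c + 1]%classic%R.
  by move=> x Kx; rewrite /= in_itv/= -ler_norml; apply: (Kc (c + 1)%R); rewrite ?ltrDl.
apply: (@le_lt_trans _ _ (mu1 `[- (c + 1), c + 1]%classic%R)).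
  by apply: le_measure => //; rewrite inE; [exact: compact_measurable|exact: measurable_itv].
by rewrite lebesgue_measure_itv/=; case: ifP => _; rewrite ?ltry.
Qed.

(** Twice C contains A + min B and max A + B, which meet in one point only. *)
Let brunn_minkowski1_compact (A B C : set R) : A !=set0 -> B !=set0 ->
  compact A -> compact B -> measurable (C : set T) ->
  (forall a b, A a -> B b -> C ((a + b) / 2)%R) ->
  mu1 A + mu1 B <= 2%:E * mu1 C.
Proof.
move=> A0 B0 cA cB mC ABC.
have idc (K : set R) : {within K, continuous (id : R -> R)}.
  by apply: continuous_subspaceT => x; exact: cvg_id.
have [p] := compact_EVT_max A0 cA (idc A); rewrite inE => Ap pmax.
have [q] := compact_EVT_min B0 cB (idc B); rewrite inE => Bq qmin.
have mA : measurable (A : set T) by exact: compact_measurable.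
have mB : measurable (B : set T) by exact: compact_measurable.
rewrite (lebesgue_affine (- q) (ltr0Sn R 1) mA) (lebesgue_affine (- p) (ltr0Sn R 1) mB).
rewrite -ge0_muleDr ?measure_ge0// lee_pmul2l//.
set C1 := [set s : R | A (2 * s + - q)%R]; set C2 := [set s : R | B (2 * s + - p)%R].
have mC1 : measurable (C1 : set T).
  by rewrite -[X in measurable X]setTI; exact: affine_measurable.
have mC2 : measurable (C2 : set T).
  by rewrite -[X in measurable X]setTI; exact: affine_measurable.
set r := ((p + q) / 2)%R.
have mr : measurable ([set r] : set T) by exact: measurable_set1.
have mD : measurable (C2 `\ r : set T) by exact: measurableD.
have mU : measurable (C2 `\ r `|` [set r] : set T) by exact: (measurableU (C2 `\ r)).
have C2D : mu1 C2 <= mu1 (C2 `\ r).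
  apply: (@le_trans _ _ (mu1 ((C2 `\ r) `|` [set r]))).
    apply: le_measure; rewrite ?inE//.
    by move=> x Cx; have [->|/eqP xr] := eqVneq x r; [right|left].
  apply: (le_trans (measureU2 mu1 mD mr)).
  by rewrite /= lebesgue_measure_set1 adde0.
apply: (le_trans (leeD2l _ C2D)); rewrite -measureU//; last first.
  apply/seteqP; split=> // s [sA [sB sr]].
  by apply: sr => /=; have := pmax _ (mem_set sA); have := qmin _ (mem_set sB); rewrite /r; lra.
apply: le_measure; rewrite ?inE//; first exact: measurableU.
move=> s [sA|[sB _]].
- by rewrite (_ : s = ((2 * s - q) + q) / 2)%R; [exact: ABC|field].
- by rewrite (_ : s = (p + (2 * s - p)) / 2)%R; [exact: ABC|field].
Qed.

(** Reduction to compact sets by inner regularity. *)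
Lemma brunn_minkowski1 (A B C : set T) : A !=set0 -> B !=set0 ->
  measurable A -> measurable B -> measurable C ->
  (forall a b : R, A a -> B b -> C ((a + b) / 2)%R) ->
  mu1 A + mu1 B <= 2%:E * mu1 C.
Proof.
move=> [a0 Aa0] [b0 Bb0] mA mB mC ABC.
have [->|Cfin] := eqVneq (mu1 C) +oo; first by rewrite mulry gtr0_sg// mul1e leey.
have key (K L : set R) : compact K -> K `<=` A -> compact L -> L `<=` B ->
    mu1 K + mu1 L <= 2%:E * mu1 C.
  move=> cK KA cL LB.
  have nonempty (P Q : set T) q0 : compact (P : set R) -> P `<=` Q -> Q q0 ->
      exists P' : set T, [/\ compact (P' : set R), P' `<=` Q, P' !=set0 & mu1 P <= mu1 P'].
    move=> cP PQ Qq0; have [->|/set0P P0] := eqVneq P set0; last by exists P.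
    exists [set q0]; split; [exact: compact_set1|by move=> _ ->|by exists q0|].
    by rewrite measure0 measure_ge0.
  have [K' [cK' K'A K'0 KK']] := nonempty K A a0 cK KA Aa0.
  have [L' [cL' L'B L'0 LL']] := nonempty L B b0 cL LB Bb0.
  apply: (le_trans (leeD KK' LL')).
  apply: (@brunn_minkowski1_compact K' L') => // a b K'a L'b.
  by apply: ABC; [exact: K'A|exact: L'B].
have C2fin : 2%:E * mu1 C \is a fin_num.
  by rewrite fin_numM// ge0_fin_numE ?measure_ge0// lt_neqAle Cfin leey.
have fincomp (L : set R) : compact L -> mu1 L \is a fin_num.
  by move=> cL; rewrite ge0_fin_numE ?measure_ge0//; exact: lebesgue_compact_lty.
have keyA L : compact L -> L `<=` B -> mu1 A + mu1 L <= 2%:E * mu1 C.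
  move=> cL LB; rewrite -leeBrDr; last exact: fincomp.
  rewrite (lebesgue_regularity_inner_sup mA); apply: ge_ereal_sup => _ [K [cK KA] <-].
  by rewrite leeBrDr; [exact: key|exact: fincomp].
have Afin : mu1 A \is a fin_num.
  rewrite ge0_fin_numE ?measure_ge0//.
  have := keyA set0 (@compact0 _) (@sub0set _ _); rewrite measure0 adde0 => /le_lt_trans; apply.
  by rewrite -ge0_fin_numE// mule_ge0 ?measure_ge0.
rewrite addeC -leeBrDr//.
rewrite (lebesgue_regularity_inner_sup mB); apply: ge_ereal_sup => _ [L [cL LB] <-].
by rewrite leeBrDr// addeC; exact: keyA.
Qed.

(** Fubini for the region under the graph of f. *)
Lemma layer_cake (f : T -> R) : measurable_fun setT f -> (forall s, 0 <= f s)%R ->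
  \int[mu1]_s (f s)%:E =
  \int[mu1]_(l in `[0%R, +oo[) mu1 [set s | l < f s]%R.
Proof.
move=> mf f0.
pose D : set (T * T) := [set p | (0 <= p.2)%R /\ (p.2 < f p.1)%R].
have mD : measurable D.
  have -> : D = (setT `*` `[0%R, +oo[%classic) `&` [set p | p.2 < f p.1]%R.
    by apply/seteqP; split=> -[x y] /=; rewrite in_itv/= andbT; [case|do 2 case].
  apply: measurableI; first by apply: measurableX => //; exact: measurable_itv.
  apply: measurable_ltr_set; last exact: measurableT_comp.
  exact: measurable_snd.
pose g (p : T * T) := (\1_D p : R)%:E.
have mg : measurable_fun setT g by exact/measurable_EFinP/measurable_indic.
have g0 p : 0 <= g p by rewrite lee_fin.
transitivity (\int[mu1]_s \int[mu1]_l g (s, l)).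
  apply: eq_integral => s _.
  have mDs : measurable [set l | D (s, l)].
    by rewrite -[X in measurable X]setTI; exact: (pair1_measurable s).
  transitivity (mu1 [set l | D (s, l)]); last by rewrite -(integral_indicT mu1 mDs).
  rewrite (_ : [set l | D (s, l)] = `[0%R, f s[%classic).
    rewrite lebesgue_measure_itv/= lte_fin; case: ltP => [_|fs]; first by rewrite -EFinD subr0.
    by congr EFin; apply/eqP; rewrite eq_le fs f0.
  by apply/seteqP; split=> l /=; rewrite in_itv/= => /andP.
rewrite (fubini_tonelli g mg g0) [RHS]integral_mkcond.
apply: eq_integral => l _; rewrite patchE mem_setE in_itv/= andbT.
have mDl : measurable [set s | D (s, l)].
  by rewrite -[X in measurable X]setTI; exact: (pair2_measurable l).
transitivity (mu1 [set s | D (s, l)]); first by rewrite -(integral_indicT mu1 mDl).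
case: ifPn => l0; first by congr (mu1 _); apply/seteqP; split=> s [].
rewrite -[RHS](measure0 mu1); congr (mu1 _); apply/seteqP; split=> s //= [] /= l0'.
by rewrite l0' in l0.
Qed.

(** When f and g both have supremum 1, every level set of f with level below 1
and the corresponding one of g are nonempty, so that the one-dimensional
Brunn-Minkowski inequality applies to each level; integrating over the levels
bounds the sum of the integrals of f and g by twice that of h, and the arithmetic mean
dominates the geometric one. *)
Lemma prekopa_leindler_normalized (f g h : T -> R) :
  measurable_fun setT f -> measurable_fun setT g -> measurable_fun setT h ->
  (forall s, 0 <= f s <= 1)%R -> (forall s, 0 <= g s <= 1)%R -> (forall s, 0 <= h s)%R ->
  (forall l, l < 1 -> exists s, l < f s)%R -> (forall l, l < 1 -> exists s, l < g s)%R ->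
  (forall s t : R, f s * g t <= h ((s + t) / 2) ^+ 2)%R ->
  (\int[mu1]_s (f s)%:E) * (\int[mu1]_s (g s)%:E) <= (\int[mu1]_s (h s)%:E) * (\int[mu1]_s (h s)%:E).
Proof.
move=> mf mg mh f01 g01 h0 fsup gsup fgh.
have mlevel (k : T -> R) l : measurable_fun setT k -> measurable [set s | (l < k s)%R].
  by move=> mk; exact: measurable_ltr_set.
have mlev (k : T -> R) : measurable_fun setT k -> (forall s, 0 <= k s)%R ->
    measurable_fun (`[0%R, +oo[%classic : set T) (fun l => mu1 [set s | (l < k s)%R]).
  move=> mk k0; apply: measurable_funTS.
  pose D : set (T * T) := [set p | (p.2 < k p.1)%R].
  have mD : measurable D.
    apply: measurable_ltr_set; last exact: measurableT_comp.
    exact: measurable_snd.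
  pose g' (p : T * T) := (\1_D p : R)%:E.
  have mg' : measurable_fun setT g' by exact/measurable_EFinP/measurable_indic.
  have := measurable_fun_fubini_tonelli_G (m1 := mu1) g' mg' (fun p => _).
  move=> /(_ ltac:(by move=> p; rewrite lee_fin)).
  congr measurable_fun; apply/funext => l; rewrite /fubini_G.
  have mDl : measurable [set s | D (s, l)] by exact: mlevel.
  by rewrite -(integral_indicT mu1 mDl).
have f0 s : (0 <= f s)%R by have /andP[] := f01 s.
have g0 s : (0 <= g s)%R by have /andP[] := g01 s.
have : \int[mu1]_s (f s)%:E + \int[mu1]_s (g s)%:E <= 2%:E * \int[mu1]_s (h s)%:E.
  rewrite !layer_cake// -ge0_integralD//; [|exact: mlev..].
  rewrite -ge0_integralZl//; [|exact: mlev].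
  apply: ge0_le_integral => //.
  - by move=> l _; rewrite adde_ge0.
  - by apply: emeasurable_funD; exact: mlev.
  - by apply: emeasurable_funM => //; exact: mlev.
  move=> l; rewrite /= in_itv/= andbT => l0; have [l1|l1] := ltP l 1%R.
    have [s ls] := fsup l l1; have [t lt] := gsup l l1.
    apply: brunn_minkowski1; [by exists s|by exists t|exact: mlevel..|].
    move=> a b /= la lb; have := fgh a b; have := h0 ((a + b) / 2)%R.
    set c := h _ => c0 fgc; rewrite /= -(ltr_pXn2r (isT : (0 < 2)%N)) ?nnegrE//.
    apply: lt_le_trans fgc; rewrite expr2.
    by apply: ltr_pM.
  have empty (k : T -> R) : (forall s, 0 <= k s <= 1)%R -> [set s | l < k s]%R = set0.
    move=> k01; apply/seteqP; split=> s //= lk.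
    by have /andP[_ ks] := k01 s; have := lt_le_trans lk ks; rewrite ltNge l1.
  by rewrite (empty f f01) (empty g g01) measure0 adde0 mule_ge0.
have i0 (k : T -> R) : (forall s, 0 <= k s)%R -> 0 <= \int[mu1]_s (k s)%:E.
  by move=> k0; apply: integral_ge0 => s _; rewrite lee_fin.
move: (i0 _ f0) (i0 _ g0) (i0 _ h0).
move: (\int[mu1]_s (f s)%:E) (\int[mu1]_s (g s)%:E) (\int[mu1]_s (h s)%:E) => x y z.
move=> x0 y0; case: z => [z| |]; [|by move=> _ _; rewrite mulyy leey|by []].
move=> z0; rewrite -EFinM => xyz.
have xyfin : x + y \is a fin_num.
  by rewrite ge0_fin_numE ?adde_ge0//; exact: le_lt_trans xyz (ltry _).
move: xyfin x0 y0 z0 xyz; rewrite fin_numD => /andP[].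
case: x => [x| |]//; case: y => [y| |]// _ _.
rewrite -!EFinD -!EFinM !lee_fin => x0 y0 z0 xyz.
suff : (4 * (x * y) <= (2 * z) * (2 * z))%R by lra.
apply: (@le_trans _ _ ((x + y) * (x + y))%R); last by apply: ler_pM => //; rewrite addr_ge0.
have := sqr_ge0 (x - y)%R; rewrite expr2; lra.
Qed.

End PrekopaLeindler.

(** * Brunn-Minkowski inequality in product form *)

Section BrunnMinkowski.
Variable R : realType.
Local Notation T := (measurableTypeR R).
Local Notation mu1 := (@lebesgue_measure R).
Local Notation lam := (@lebesgue_rV R _).
Local Open Scope ereal_scope.

(** Reduction to functions of supremum 1: divide f and g by their suprema a and b,
and h by the square root of a b. *)
Lemma prekopa_leindler1 (c : R) (f g h : T -> R) :
  measurable_fun setT f -> measurable_fun setT g -> measurable_fun setT h ->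
  (forall s, 0 <= f s <= c)%R -> (forall s, 0 <= g s <= c)%R -> (forall s, 0 <= h s)%R ->
  (forall s t : R, f s * g t <= h ((s + t) / 2) ^+ 2)%R ->
  (\int[mu1]_s (f s)%:E) * (\int[mu1]_s (g s)%:E) <=
  (\int[mu1]_s (h s)%:E) * (\int[mu1]_s (h s)%:E).
Proof.
move=> mf mg mh fc gc h0 fgh.
have H0 : 0 <= (\int[mu1]_s (h s)%:E) * (\int[mu1]_s (h s)%:E).
  by rewrite mule_ge0//; apply: integral_ge0 => s _; rewrite lee_fin.
have triv (k : T -> R) : (forall s, 0 <= k s <= c)%R ->
    \int[mu1]_s (k s)%:E = 0 \/ exists2 a : R, (0 < a)%R & (forall s, k s <= a)%R /\
      (forall l, l < 1 -> exists s, l < a^-1 * k s)%R.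
  move=> kc; have [k0|] := pselect (forall s, k s = 0%R).
    by left; apply: integral0_eq => s _; rewrite k0.
  move=> /existsNP[s0 /eqP ks0]; right.
  have hub : has_ubound (range k).
    by exists c => _ [s _ <-]; have /andP[] := kc s.
  have le_sup s : (k s <= sup (range k))%R by apply: ub_le_sup => //; exists s.
  have sup0 : (0 < sup (range k))%R.
    by apply: lt_le_trans (le_sup s0); rewrite lt_neqAle eq_sym ks0; have /andP[] := kc s0.
  exists (sup (range k)) => //; split=> // l l1.
  have : (l * sup (range k) < sup (range k))%R by rewrite gtr_pMl.
  move=> /sup_gt[|_ [s _ <-] ls]; first by exists (k s0), s0.
  by exists s; rewrite ltr_pdivlMl// mulrC.
have [->|[a a0 [fa fsup]]] := triv f fc; first by rewrite mul0e.
have [->|[b b0 [gb gsup]]] := triv g gc; first by rewrite mule0.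
have sc (k : T -> R) (d : R) : (0 < d)%R -> measurable_fun setT k -> (forall s, 0 <= k s)%R ->
    \int[mu1]_s (k s)%:E = d%:E * \int[mu1]_s (d^-1 * k s)%:E.
  move=> d0 mk k0; rewrite -ge0_integralZl//.
  - by apply: eq_integral => s _; rewrite -EFinM mulrA divff ?mul1r// gt_eqF.
  - by apply/measurable_EFinP; exact: measurable_funM.
  - by move=> s _; rewrite lee_fin mulr_ge0// invr_ge0 ltW.
  - by rewrite lee_fin ltW.
have f0 s : (0 <= f s)%R by have /andP[] := fc s.
have g0 s : (0 <= g s)%R by have /andP[] := gc s.
have d0 : (0 < Num.sqrt (a * b))%R by rewrite sqrtr_gt0 mulr_gt0.
have dd : (Num.sqrt (a * b) * Num.sqrt (a * b) = a * b)%R.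
  by rewrite -expr2 sqr_sqrtr// mulr_ge0 ?ltW.
rewrite (sc f a)// (sc g b)// (sc h _ d0)// muleACA [leRHS]muleACA -!EFinM dd.
rewrite lee_pmul2l//; last by rewrite lte_fin mulr_gt0.
apply: prekopa_leindler_normalized => //; [exact: measurable_funM..| | | |].
- by move=> s; rewrite mulr_ge0 ?invr_ge0 ?(ltW a0)//= ler_pdivrMl// mulr1.
- by move=> s; rewrite mulr_ge0 ?invr_ge0 ?(ltW b0)//= ler_pdivrMl// mulr1.
- by move=> s; rewrite mulr_ge0 ?invr_ge0 ?(ltW d0).
move=> s t; rewrite exprMn exprVn expr2 dd invfM mulrACA.
by apply: ler_wpM2l (fgh s t); rewrite mulr_ge0// invr_ge0 ltW.
Qed.

Lemma sqn_consr m s (x : 'rV[R]_m) : (sqn (consr s x) = s ^+ 2 + sqn x)%R.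
Proof.
rewrite /sqn /dotr big_ord_recl consr0 -expr2; congr (_ + _)%R.
by apply: eq_bigr => i _; rewrite consrS.
Qed.

Lemma consr_continuous m s : continuous (@consr R m s).
Proof.
apply: continuous_rV => i; case: (unliftP ord0 i) => [j|] ->.
  rewrite (_ : (fun _ => _) = (fun x : 'rV[R]_m => x 0%R j)); last first.
    by apply/funext => x; rewrite consrS.
  exact: coord_continuous.
rewrite (_ : (fun _ => _) = cst s); first by move=> x; exact: cst_continuous.
by apply/funext => x; rewrite consr0.
Qed.

Lemma compact_section m (A : set 'rV[R]_m.+1) s : compact A ->
  compact [set x | A (consr s x)].
Proof.
move=> cA; have [c c0 Ac] := compact_sqn_bounded cA.
apply: (@subclosed_compact _ _ [set x | sqn x <= c]%R).
- apply: (@preimage_closed _ _ (@consr R m s) A); last exact: rV_closed_of_compact.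
  by move=> x _; exact: consr_continuous.
- exact: compact_sqn_le.
- move=> x /Ac /=; rewrite sqn_consr => sx.
  by apply: le_trans sx; rewrite lerDr sqr_ge0.
Qed.

Lemma lebesgue_rV_section_bounded m (A : set 'rV[R]_m.+1) : compact A ->
  exists c : R, forall s, (0 <= fine (lam [set x | A (consr s x)]) <= c)%R.
Proof.
move=> cA; have [c c0 Ac] := compact_sqn_bounded cA.
exists (fine (lam [set x : 'rV[R]_m | sqn x <= c]%R)) => s.
rewrite fine_ge0//= fine_le// ?ge0_fin_numE//.
- by apply: lebesgue_rV_compact_lty; exact: compact_section.
- by apply: lebesgue_rV_compact_lty; exact: compact_sqn_le.
apply: le_measure; rewrite ?inE.
- by apply: compact_rV_measurable; exact: compact_section.
- by apply: compact_rV_measurable; exact: compact_sqn_le.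
- move=> x /Ac /=; rewrite sqn_consr => sx.
  by apply: le_trans sx; rewrite lerDr sqr_ge0.
Qed.

Lemma lebesgue_rV_sections_fine m (A : set 'rV[R]_m.+1) : compact A ->
  lam A = \int[mu1]_s (fine (lam [set x | A (consr s x)]))%:E.
Proof.
move=> cA; rewrite lebesgue_rV_sections; last exact: compact_rV_measurable.
apply: eq_integral => s _; rewrite fineK// ge0_fin_numE//.
by apply: lebesgue_rV_compact_lty; exact: compact_section.
Qed.

Lemma measurable_fine_section m (A : set 'rV[R]_m.+1) : compact A ->
  measurable_fun (setT : set T) (fun s => fine (lam [set x | A (consr s x)]) : T).
Proof.
move=> cA; apply: (measurableT_comp (fine_measurable _)) => //.
by apply: measurable_lebesgue_rV_section; exact: compact_rV_measurable.
Qed.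

(** Induction on the dimension: the section volumes of A, B and C satisfy the
hypothesis of the Prekopa-Leindler inequality by the induction hypothesis.  The
product form, unlike the one with roots of volumes, passes to sections as it stands. *)
Lemma brunn_minkowski m (A B C : set 'rV[R]_m) :
  compact A -> compact B -> compact C ->
  (forall x y, A x -> B y -> C (2^-1 *: (x + y))%R) ->
  lam A * lam B <= lam C * lam C.
Proof.
elim: m A B C => [|m IH] A B C cA cB cC ABC.
  have [->|/set0P[x Ax]] := eqVneq A set0; first by rewrite measure0 mul0e mule_ge0.
  have [->|/set0P[y By]] := eqVneq B set0; first by rewrite measure0 mule0 mule_ge0.
  have full (P : set 'rV[R]_0) z : P z -> lam P = 1.
    move=> Pz; rewrite -(@lebesgue_rV_dim0 R); congr (lam _); apply/seteqP; split=> // t _.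
    by rewrite (_ : t = z)//; apply/rowP => -[].
  by rewrite (full _ _ Ax) (full _ _ By) (full _ _ (ABC _ _ Ax By)).
have [a fa] := lebesgue_rV_section_bounded cA.
have [b gb] := lebesgue_rV_section_bounded cB.
have [c hc] := lebesgue_rV_section_bounded cC.
rewrite (lebesgue_rV_sections_fine cA) (lebesgue_rV_sections_fine cB) (lebesgue_rV_sections_fine cC).
apply: (@prekopa_leindler1 (Num.max a b)); [exact: measurable_fine_section..| | | |].
- by move=> s; have /andP[-> h] := fa s; rewrite le_max h.
- by move=> s; have /andP[-> h] := gb s; rewrite le_max h orbT.
- by move=> s; have /andP[] := hc s.
move=> s t; rewrite -lee_fin expr2 !EFinM.
have fin P (u : R) : compact P -> lam [set x : 'rV[R]_m | P (consr u x)] \is a fin_num.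
  by move=> cP; rewrite ge0_fin_numE//; by apply: lebesgue_rV_compact_lty; exact: compact_section.
rewrite !fineK; [|exact: fin..].
apply: IH; [exact: compact_section..|].
move=> x y /= Ax By; have := ABC _ _ Ax By; congr C.
by rewrite consrD consrZ [in LHS]mulrC.
Qed.

End BrunnMinkowski.

(** * Exponential substitution *)

Section ExpSubst.
Variable R : realType.
Local Notation T := (measurableTypeR R).
Local Notation mu1 := (@lebesgue_measure R).
Local Open Scope ereal_scope.

Let e (u : T) : T := expR (- u)%R.

Let ce : continuous (e : R -> R).
Proof.
move=> x; apply: (@continuous_comp _ _ _ (-%R : R -> R) (@expR R)).
  exact: oppr_continuous.
exact: continuous_expR.
Qed.

Let me : measurable_fun setT e.
Proof. exact: continuous_measurable_fun. Qed.

Let e0 u : (0 < e u)%R. Proof. exact: expR_gt0. Qed.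

Let nu (A : set T) : \bar R := \int[mu1]_(u in e @^-1` A) (e u)%:E.

Let nu0 : nu set0 = 0. Proof. by rewrite /nu preimage_set0 integral_set0. Qed.
Let nu_ge0 A : 0 <= nu A.
Proof. by apply: integral_ge0 => u _; rewrite lee_fin ltW. Qed.

Let mpre A : measurable A -> measurable (e @^-1` A).
Proof. by move=> mA; rewrite -[X in measurable X]setTI; exact: me. Qed.

Let nu_sigma_additive : semi_sigma_additive nu.
Proof.
move=> /= F mF tF mUF; rewrite /nu; apply: cvg_toP.
  apply: ereal_nondecreasing_is_cvgn => m n mn.
  by apply: lee_sum_nneg_natr => // k _ _; exact: nu_ge0.
rewrite preimage_bigcup ge0_integral_bigcup//=.
- by move=> k; exact: mpre.
- exact/measurable_funTS/measurable_EFinP.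
- by move=> x _; rewrite lee_fin ltW.
- apply/trivIsetP => i j _ _ ij; rewrite -preimage_setI.
  by move/trivIsetP : tF => ->//; rewrite preimage_set0.
Qed.

HB.instance Definition _ := isMeasure.Build _ _ _ nu nu0 nu_ge0 nu_sigma_additive.

Let integral_tail c : \int[mu1]_(u in `[c, +oo[) (e u)%:E = (e c)%:E.
Proof.
have de (x : R) : is_derive (x : R) (1%R : R) (fun u : R => - expR (- u))%R (expR (- x)).
  apply: is_derive_eq; by rewrite /GRing.scale/= mulrN1 opprK.
rewrite (@ge0_continuous_FTC2y _ _ (fun u => - expR (- u))%R _ 0)//.
- by rewrite -EFinB sub0r opprK.
- by move=> x _; rewrite ltW.
- by apply: continuous_subspaceT => x; exact: ce.
- by rewrite -oppr0; apply: cvgN; exact: cvgr_expR.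
- by apply: cvg_at_right_filter; apply: cvgN; exact: ce.
- by move=> x _; rewrite derive1E; case: (de x).
Qed.

Let neg : set T := `]-oo, 0%R]%classic.
Let mneg : measurable neg. Proof. exact: measurable_itv. Qed.

Let e_ge (x u : R) : (0 < x)%R -> (x < e u)%R = (u < - ln x)%R.
Proof. by move=> x0; rewrite /e -{1}(lnK x0) ltr_expR ltrNr. Qed.

Let e_le (x u : R) : (0 < x)%R -> (e u <= x)%R = (- ln x <= u)%R.
Proof. by move=> x0; rewrite leNgt e_ge// -leNgt. Qed.

Let nu_itv a b : mu1 `]a, b]%classic%R = nu `]a, b]%classic%R + mu1 (`]a, b]%classic%R `&` neg).
Proof.
have [ab|ba] := ltP a b; last first.
  rewrite (_ : `]a, b]%classic = set0) ?set0I ?measure0 ?adde0//.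
  by apply/seteqP; split=> x //=; rewrite in_itv/= => /andP[]; lra.
have [b0|b0] := leP b 0%R.
  rewrite (_ : nu _ = 0) ?add0e.
    congr (mu1 _); apply/seteqP; split=> x /=; rewrite in_itv/=; last by case.
    by move=> /andP[ax xb]; split; rewrite /neg/= ?in_itv/= ?ax//; exact: le_trans xb b0.
  rewrite /nu (_ : _ @^-1` _ = set0) ?integral_set0//.
  apply/seteqP; split=> x //=; rewrite in_itv/= => /andP[_ xb].
  by have := e0 x; rewrite ltNge (le_trans xb b0).
have bE : (expR (ln b) = b)%R by rewrite lnK.
have [a0|a0] := leP a 0%R.
  have -> : nu `]a, b]%classic = b%:E.
    rewrite -[in RHS]bE -[ln b]opprK -/(e _) -integral_tail /nu; congr (\int[mu1]_(x in _) _).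
    apply/seteqP; split=> x /=; rewrite !in_itv/= andbT e_le//; first by case/andP.
    by move=> ->; rewrite (le_lt_trans a0).
  rewrite (_ : _ `&` neg = `]a, 0%R]%classic).
    rewrite !lebesgue_measure_itv/= !lte_fin ab; case: ltP => a0'; first by rewrite -!EFinD; congr EFin; ring.
    have -> : a = 0%R by lra.
    by rewrite adde0 -EFinB subr0.
  by apply/seteqP; split=> x /=; rewrite /neg /= !in_itv/=; [case=> /andP[-> _ ->]|
    move=> /andP[-> x0]; split=> //; rewrite (le_trans x0)// ltW].
rewrite (_ : _ `&` neg = set0) ?measure0 ?adde0; last first.
  by apply/seteqP; split=> x //=; rewrite /neg /= !in_itv/= => -[/andP[ax _]]; rewrite leNgt (lt_trans a0).
have aE : (expR (ln a) = a)%R by rewrite lnK.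
rewrite lebesgue_measure_itv/= lte_fin ab.
have : (b%:E = nu `]a, b]%classic + a%:E).
  rewrite -[in LHS]bE -[ln b]opprK -/(e _) -integral_tail.
  rewrite -[in X in _ = _ + X]aE -[ln a]opprK -/(e _) -integral_tail /nu.
  rewrite -ge0_integral_setU//=.
  - congr (\int[mu1]_(x in _) _); apply/seteqP; split=> x /=; rewrite !in_itv/= ?andbT e_ge// e_le//.
      by move=> ->; case: (ltP x (- ln a)%R) => _; [left|right].
    by case=> [/andP[]//|]; apply: le_trans; rewrite lerN2 ler_ln// ltW.
  - exact: mpre.
  - exact/measurable_funTS/measurable_EFinP.
  - by move=> x _; rewrite lee_fin ltW.
  - apply/disj_set2P; apply/seteqP; split=> x //=; rewrite !in_itv/= andbT e_ge// => -[/andP[xa _]].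
    by rewrite leNgt xa.
by move=> ->; rewrite addeK.
Qed.

Let nuE A : measurable A -> mu1 A = nu A + mu1 (A `&` neg).
Proof.
move=> mA; rewrite -[RHS](measure_addE nu (mrestr mu1 mneg)).
apply: lebesgue_measure_unique => // _ [[a b] _ <-].
by rewrite [LHS]nu_itv [RHS]measure_addE.
Qed.

(** The substitution x = exp (- u), obtained without differentiating: the measure of
density exp (- u) pushed to the positive half-line is Lebesgue measure, since both
give the same mass to intervals, and the layer-cake formula transfers this to f. *)
Lemma ge0_integral_expRN (f : T -> R) : measurable_fun setT f -> (forall x, 0 <= f x)%R ->
  \int[mu1]_(x in `]0%R, +oo[) (f x)%:E = \int[mu1]_u (f (expR (- u)) * expR (- u))%:E.
Proof.
move=> mf f0.
pose g (x : T) : R := (f x * \1_(`]0, +oo[%classic : set T) x)%R.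
have mg : measurable_fun setT g.
  by apply: measurable_funM => //; exact: measurable_indic.
have g0 x : (0 <= g x)%R by rewrite mulr_ge0.
have ge u : g (e u) = f (e u) by rewrite /g indicE mem_set ?mulr1//= in_itv/= e0.
transitivity (\int[mu1]_x (g x)%:E).
  rewrite integral_mkcond; apply: eq_integral => x _.
  by rewrite patchE /g indicE; case: ifPn => xpos; rewrite ?mulr1 ?mulr0.
rewrite layer_cake//.
pose D : set (T * T) := [set p | (p.2 < g (e p.1))%R] `&` (setT `*` `[0%R, +oo[%classic).
have mD : measurable D.
  apply: measurableI; last by apply: measurableX => //; exact: measurable_itv.
  apply: measurable_ltr_set; first exact: measurable_snd.
  by apply: (measurableT_comp mg); apply: measurableT_comp.
pose h (p : T * T) := (\1_D p * e p.1)%:E.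
have mh : measurable_fun setT h.
  apply/measurable_EFinP; apply: measurable_funM; first exact: measurable_indic.
  exact: measurableT_comp.
have h0 p : 0 <= h p by rewrite lee_fin mulr_ge0// ltW.
transitivity (\int[mu1]_l \int[mu1]_u h (u, l)).
  rewrite integral_mkcond; apply: eq_integral => l _; rewrite patchE mem_setE in_itv/= andbT.
  have mDl : measurable ([set x | l < g x]%R : set T).
    by apply: measurable_ltr_set.
  case: ifPn => l0; last first.
    rewrite integral0_eq// => u _; rewrite /h indicE memNset ?mul0r// => -[_ [_]] /=.
    by rewrite in_itv/= andbT (negbTE l0).
  rewrite (nuE mDl) (_ : _ `&` neg = set0) ?measure0 ?adde0; last first.
    apply/seteqP; split=> x //=; rewrite /g /neg indicE/= in_itv/= => -[lg x0].
    by move: lg; rewrite memNset/= ?mulr0 ?in_itv/= ?ltNge ?l0// x0.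
  rewrite /nu integral_mkcond; apply: eq_integral => u _; rewrite patchE /h indicE.
  have -> : ((u, l) \in D) = (u \in e @^-1` [set x | l < g x]%R).
    apply/idP/idP; rewrite !inE /D/=; first by case.
    by move=> lg; split=> //; split=> //=; rewrite in_itv/= l0.
  by case: ifPn => _; rewrite ?mul1r ?mul0r.
rewrite -(fubini_tonelli h mh h0); apply: eq_integral => u _.
have mDu : measurable [set l | D (u, l)].
  by rewrite -[X in measurable X]setTI; exact: (pair1_measurable u).
rewrite /h/=; under eq_integral do rewrite mulrC EFinM.
rewrite ge0_integralZl_EFin//; last 2 first.
- apply/measurable_EFinP.
  have mI : measurable_fun setT (\1_D : T * T -> R) by exact: measurable_indic.
  exact: (measurableT_comp mI (pair1_measurable u)).
- exact: ltW.
rewrite -/(e u) mulrC EFinM; congr (_ * _).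
transitivity (mu1 [set l | D (u, l)]); first by rewrite -(integral_indicT mu1 mDu).
rewrite (_ : [set l | _] = `[0%R, f (e u)[%classic).
  rewrite lebesgue_measure_itv/= lte_fin; case: ltP => [_|fs]; first by rewrite -EFinD subr0.
  by congr EFin; apply/eqP; rewrite eq_le fs f0.
by apply/seteqP; split=> l /=; rewrite /D/= !in_itv/= andbT ge; [case=> ? [_ ->]|case/andP].
Qed.

End ExpSubst.

(** * Multiplicative Prekopa-Leindler inequality *)

Section Multiplicative.
Variable R : realType.
Local Notation T := (measurableTypeR R).
Local Notation mu1 := (@lebesgue_measure R).
Local Notation lam := (@lebesgue_rV R _).
Local Open Scope ereal_scope.

Lemma integral_even (f : T -> \bar R) : measurable_fun setT f -> (forall x, 0 <= f x) ->
  (forall x, f (- x)%R = f x) -> \int[mu1]_x f x = 2%:E * \int[mu1]_(x in `]0%R, +oo[) f x.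
Proof.
move=> mf f0 fN.
rewrite (_ : [set: T] = `]-oo, 0%R]%classic `|` `]0%R, +oo[%classic); last first.
  apply/esym/seteqP; split=> // x _; rewrite /= !in_itv/= andbT.
  by case: (leP x 0%R); [left|right].
rewrite ge0_integral_setU//=; first last.
- apply/disj_set2P; apply/seteqP; split=> x //=; rewrite !in_itv/= andbT => -[].
  by rewrite leNgt => /negP.
- exact: measurable_funTS.
have -> : \int[mu1]_(x in `]-oo, 0%R]) f x = \int[mu1]_(x in `]0%R, +oo[) f x.
  transitivity (\int[mu1]_(x in `]-oo, 0%R]) f (- x)%R).
    by apply: eq_integral => x _; rewrite fN.
  rewrite -ge0_integration_by_substitution0// integral_itv_obnd_cbnd//.
  exact: measurable_funTS.
rewrite (_ : 2%:E = 1 + 1)%E; last by rewrite -EFinD.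
by rewrite ge0_muleDl ?mul1e.
Qed.

(** The substitution s = exp (- u) turns the geometric mean of the arguments into an
arithmetic one.  The vanishing of f and g beyond M keeps the transformed functions
bounded. *)
Lemma prekopa_leindler_mul (c M : R) (f g h : T -> R) :
  measurable_fun setT f -> measurable_fun setT g -> measurable_fun setT h ->
  (forall s, 0 <= f s <= c)%R -> (forall s, 0 <= g s <= c)%R -> (forall s, 0 <= h s)%R ->
  (forall s, M < s -> f s = 0)%R -> (forall s, M < s -> g s = 0)%R ->
  (forall s t : R, 0 < s -> 0 < t -> f s * g t <= h (Num.sqrt (s * t)) ^+ 2)%R ->
  (\int[mu1]_(s in `]0%R, +oo[) (f s)%:E) * (\int[mu1]_(s in `]0%R, +oo[) (g s)%:E) <=
  (\int[mu1]_(s in `]0%R, +oo[) (h s)%:E) * (\int[mu1]_(s in `]0%R, +oo[) (h s)%:E).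
Proof.
move=> mf mg mh fc gc h0 fM gM fgh.
have f0 s : (0 <= f s)%R by have /andP[] := fc s.
have g0 s : (0 <= g s)%R by have /andP[] := gc s.
have c0 : (0 <= c)%R by have /andP[f00 ] := fc 0%R; exact: le_trans.
rewrite !ge0_integral_expRN//.
have me : measurable_fun (setT : set T) (fun u => expR (- u) : T).
  by apply: continuous_measurable_fun => x; apply: (@continuous_comp _ _ _ (-%R : R -> R) (@expR R));
    [exact: oppr_continuous|exact: continuous_expR].
have mk (k : T -> R) : measurable_fun setT k ->
    measurable_fun (setT : set T) (fun u => (k (expR (- u)) * expR (- u))%R : T).
  by move=> mk; apply: measurable_funM => //; exact: (measurableT_comp mk me).
have bnd (k : T -> R) : (forall s, 0 <= k s <= c)%R -> (forall s, M < s -> k s = 0)%R ->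
    forall u, (0 <= k (expR (- u)) * expR (- u) <= c * Num.max M 0)%R.
  move=> kc kM u; have /andP[k0 k1] := kc (expR (- u)).
  rewrite mulr_ge0 ?expR_ge0//=; have [Mu|uM] := ltP M (expR (- u)).
    by rewrite kM// mul0r mulr_ge0// le_max lexx orbT.
  by apply: ler_pM; rewrite ?expR_ge0// le_max uM.
apply: (@prekopa_leindler1 _ (c * Num.max M 0)%R); [exact: mk|exact: mk|exact: mk|exact: bnd|exact: bnd| |].
  by move=> s; rewrite mulr_ge0 ?expR_ge0.
move=> s t; rewrite exprMn mulrACA.
have ee : (expR (- s) * expR (- t) = expR (- ((s + t) / 2)) ^+ 2)%R.
  by rewrite expr2 -!expRD; congr expR; field.
rewrite ee ler_wpM2r ?sqr_ge0//; apply: le_trans (fgh _ _ (expR_gt0 _) (expR_gt0 _)) _.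
by rewrite ee sqrtr_sqr ger0_norm ?expR_ge0.
Qed.

End Multiplicative.

(** * Blaschke-Santalo inequality *)

Section Santalo.
Variable R : realType.
Local Notation T := (measurableTypeR R).
Local Notation mu1 := (@lebesgue_measure R).
Local Notation lam := (@lebesgue_rV R _).
Local Open Scope ereal_scope.

Lemma dotr_consr m s t (x y : 'rV[R]_m) :
  (dotr (consr s x) (consr t y) = s * t + dotr x y)%R.
Proof.
rewrite /dotr big_ord_recl !consr0; congr (_ + _)%R.
by apply: eq_bigr => i _; rewrite !consrS.
Qed.

Lemma headr_continuous m : continuous (@headr R m).
Proof. exact: coord_continuous. Qed.

Lemma tailr_continuous m : continuous (@tailr R m).
Proof.
apply: continuous_rV => i; rewrite (_ : (fun _ => _) = fun x : 'rV[R]_m.+1 => x 0%R (lift ord0 i)).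
  exact: coord_continuous.
by apply/funext => x; rewrite mxE.
Qed.

Lemma continuous_consr (S : topologicalType) m (f : S -> R) (g : S -> 'rV[R]_m) :
  continuous f -> continuous g -> continuous (fun s => consr (f s) (g s)).
Proof.
move=> cf cg; apply: continuous_rV => i; case: (unliftP ord0 i) => [j|] ->.
  rewrite (_ : (fun _ => _) = (fun x : 'rV[R]_m => x 0%R j) \o g); last first.
    by apply/funext => x /=; rewrite consrS.
  by move=> x; apply: continuous_comp; [exact: cg|exact: coord_continuous].
by rewrite (_ : (fun _ => _) = f)//; apply/funext => x; rewrite consr0.
Qed.

(** The Steiner symmetral of A in the direction of the first coordinate when A is
convex; in general its fibres are the half-differences of the fibres of A, which is
what duality with [costeiner] needs. *)
Definition steiner m (A : set 'rV[R]_m.+1) : set 'rV[R]_m.+1 :=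
  (fun p : 'rV[R]_m.+1 * 'rV[R]_m.+1 => consr ((headr p.1 - headr p.2) / 2) (tailr p.1)) @`
    ((A `*` A) `&` [set p | tailr p.1 - tailr p.2 = 0])%R.

(** The operation dual to [steiner]: it acts on the slices at constant first
coordinate, replacing each by its half-difference body. *)
Definition costeiner m (B : set 'rV[R]_m.+1) : set 'rV[R]_m.+1 :=
  (fun p : 'rV[R]_m.+1 * 'rV[R]_m.+1 => consr (headr p.1) (2^-1 *: (tailr p.1 - tailr p.2))) @`
    ((B `*` B) `&` [set p | headr p.1 - headr p.2 = 0])%R.

Lemma steinerP m (A : set 'rV[R]_m.+1) s x :
  steiner A (consr s x) <-> exists a b, [/\ A (consr a x), A (consr b x) & (a - b = 2 * s)%R].
Proof.
split=> [[[p q] [[/= Ap Aq] /eqP]]|[a [b [Aa Ab ab]]]].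
  rewrite subr_eq0 => /eqP pq E; have := congr1 (@headr R m) E; have := congr1 (@tailr R m) E.
  rewrite !headr_consr !tailr_consr => tE hE.
  exists (headr p), (headr q); rewrite -{1}tE consr_eta -tE pq consr_eta -hE; split=> //.
  by field.
exists (consr a x, consr b x) => /=; first by rewrite !tailr_consr subrr.
by rewrite !headr_consr tailr_consr ab; congr consr; field.
Qed.

Lemma costeinerP m (B : set 'rV[R]_m.+1) t x :
  costeiner B (consr t x) <->
  exists u w, [/\ B (consr t u), B (consr t w) & (x = 2^-1 *: (u - w))%R].
Proof.
split=> [[[p q] [[/= Bp Bq] /eqP]]|[u [w [Bu Bw ->]]]].
  rewrite subr_eq0 => /eqP pq E; have := congr1 (@headr R m) E; have := congr1 (@tailr R m) E.
  rewrite !headr_consr !tailr_consr => tE hE.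
  by exists (tailr p), (tailr q); rewrite -{1}hE consr_eta -hE pq consr_eta tE.
exists (consr t u, consr t w) => /=; first by rewrite !headr_consr subrr.
by rewrite !tailr_consr headr_consr.
Qed.

Let cfst (X Y : topologicalType) : continuous (@fst X Y).
Proof. by move=> x; exact: cvg_fst. Qed.
Let csnd (X Y : topologicalType) : continuous (@snd X Y).
Proof. by move=> x; exact: cvg_snd. Qed.
Let ccomp (X Y Z : topologicalType) (f : X -> Y) (g : Y -> Z) :
  continuous f -> continuous g -> continuous (g \o f).
Proof. by move=> cf cg x; apply: continuous_comp; [exact: cf|exact: cg]. Qed.

Let cheadB m : continuous (fun p : 'rV[R]_m.+1 * 'rV[R]_m.+1 => headr p.1 - headr p.2)%R.
Proof.
move=> x; apply: (@continuousB _ _ _ (@headr R m \o fst) (@headr R m \o snd)).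
  exact: (ccomp (@cfst _ _) (@headr_continuous m)).
exact: (ccomp (@csnd _ _) (@headr_continuous m)).
Qed.

Let ctailB m : continuous (fun p : 'rV[R]_m.+1 * 'rV[R]_m.+1 => tailr p.1 - tailr p.2)%R.
Proof.
move=> x; apply: (@continuousB _ _ _ (@tailr R m \o fst) (@tailr R m \o snd)).
  exact: (ccomp (@cfst _ _) (@tailr_continuous m)).
exact: (ccomp (@csnd _ _) (@tailr_continuous m)).
Qed.

Lemma compact_steiner m (A : set 'rV[R]_m.+1) : compact A -> compact (steiner A).
Proof.
move=> cA; apply: continuous_compact.
  apply: continuous_subspaceT; apply: continuous_consr; last first.
    exact: (ccomp (@cfst _ _) (@tailr_continuous m)).
  move=> x; apply: (@continuousM _ _ (fun p => headr p.1 - headr p.2)%R (cst 2^-1%R)).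
    exact: cheadB.
  exact: cst_continuous.
apply: compact_closedI; first exact: compact_setX.
apply: (@preimage_closed _ _ (fun p : 'rV[R]_m.+1 * 'rV[R]_m.+1 => tailr p.1 - tailr p.2)%R [set 0%R]).
  by move=> x _; exact: ctailB.
by apply: rV_closed_of_compact; exact: compact_set1.
Qed.

Lemma compact_costeiner m (B : set 'rV[R]_m.+1) : compact B -> compact (costeiner B).
Proof.
move=> cB; apply: continuous_compact.
  apply: continuous_subspaceT; apply: continuous_consr.
    exact: (ccomp (@cfst _ _) (@headr_continuous m)).
  by move=> x; apply: cvgZl_tmp; exact: ctailB.
apply: compact_closedI; first exact: compact_setX.
apply: (@preimage_closed _ _ (fun p : 'rV[R]_m.+1 * 'rV[R]_m.+1 => headr p.1 - headr p.2)%R [set 0%R]).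
  by move=> x _; exact: cheadB.
exact: closed_eq.
Qed.

Lemma compact_tail_section m (A : set 'rV[R]_m.+1) x : compact A ->
  compact ([set s | A (consr s x)] : set R).
Proof.
move=> cA; have [c c0 Ac] := compact_sqn_bounded cA.
apply: (@subclosed_compact _ _ (`[- (1 + c), 1 + c]%classic%R : set R)).
- apply: (@preimage_closed _ _ (fun s => consr s x) A); last exact: rV_closed_of_compact.
  move=> s _; apply: continuous_consr => y; first exact: cvg_id.
  exact: cst_continuous.
- exact: segment_compact.
- move=> s /Ac /=; rewrite sqn_consr in_itv/= => sx.
  by have := sqn_ge0 x => x0; apply/andP; split; nra.
Qed.

(** The half-differences of a fibre S include the translate of S / 2 that starts at
min S, and this lies in the positive half-line up to a point. *)
Lemma integral_le_steiner m (A : set 'rV[R]_m.+1) : compact A ->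
  lam A <= 2%:E * \int[mu1]_(s in `]0%R, +oo[) lam [set x | steiner A (consr s x)].
Proof.
move=> cA; have mA := compact_rV_measurable cA.
have mS := compact_rV_measurable (compact_steiner cA).
pose P : set 'rV[R]_m.+1 := steiner A `&` [set z | 0 < headr z]%R.
have mP : measurable P.
  apply: measurableI => //; apply: measurable_ltr_set; first exact: measurable_cst.
  exact: measurable_coord.
have <- : lam P = \int[mu1]_(s in `]0%R, +oo[) lam [set x | steiner A (consr s x)].
  rewrite lebesgue_rV_sections// [RHS]integral_mkcond; apply: eq_integral => s _.
  rewrite patchE mem_setE in_itv/= andbT; case: ifPn => s0.
    congr (lam _); apply/seteqP; split=> x /=; first by case.
    by split=> //=; rewrite headr_consr.
  rewrite (_ : [set x | _] = set0) ?measure0//; apply/seteqP; split=> x //=.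
  by case=> _ /=; rewrite headr_consr (negbTE s0).
rewrite !lebesgue_rV_sections_tail//.
have mF (Q : set 'rV[R]_m.+1) : measurable Q ->
    measurable_fun setT (fun x => mu1 [set s | Q (consr s x)]).
  move=> mQ.
  rewrite (_ : (fun _ => _) = fun x => \int[mu1]_s (\1_Q (consr s x))%:E).
    apply: (measurable_fun_fubini_tonelli_G (fun p : T * 'rV[R]_m => (\1_Q (consr p.1 p.2))%:E)).
      apply/measurable_EFinP; apply: measurableT_comp; first exact: measurable_indic.
      exact: measurable_consr.
    by move=> p; rewrite lee_fin.
  apply/funext => x; rewrite -(integral_indicT mu1)//.
  rewrite -[X in measurable X]setTI.
  exact: (measurableT_comp (@measurable_consr R m) (pair2_measurable x)).
rewrite -ge0_integralZl//; last exact: mF.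
have msec (Q : set 'rV[R]_m.+1) x : measurable Q -> measurable ([set s | Q (consr s x)] : set T).
  move=> mQ; rewrite -[X in measurable X]setTI.
  exact: (measurableT_comp (@measurable_consr R m) (pair2_measurable x)).
apply: ge0_le_integral => //; [exact: mF|by apply: emeasurable_funM => //; exact: mF|].
move=> x _.
set S := [set s | A (consr s x)].
have cS : compact (S : set R) by exact: compact_tail_section.
have [->|/set0P S0] := eqVneq S set0; first by rewrite measure0 mule_ge0.
have idc : {within S, continuous (id : R -> R)}.
  by apply: continuous_subspaceT => y; exact: cvg_id.
have [p] := compact_EVT_min S0 cS idc; rewrite inE => Sp pmin.
have mSx : measurable (S : set T) by exact: msec.
rewrite (lebesgue_affine p (ltr0Sn R 1) mSx) lee_pmul2l//.
set S2 := [set s : R | S (2 * s + p)%R]; set PS := [set s | P (consr s x)].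
have mPS : measurable (PS : set T) by exact: msec.
have m0 : measurable ([set 0%R] : set T) by exact: measurable_set1.
apply: (@le_trans _ _ (mu1 (PS `|` [set 0%R]))).
  apply: le_measure; rewrite ?inE.
  - by rewrite -[X in measurable X]setTI; exact: affine_measurable.
  - exact: (measurableU PS).
  move=> s S2s; have [->|s0] := eqVneq s 0%R; [by right|left; split].
    by apply/steinerP; exists (2 * s + p)%R, p; split=> //; rewrite addrK.
  rewrite /= headr_consr lt_neqAle eq_sym s0/=.
  by have := pmin _ (mem_set S2s); lra.
apply: (le_trans (measureU2 mu1 mPS m0)).
by rewrite /= lebesgue_measure_set1 adde0.
Qed.

(** Brunn-Minkowski shows that passing to the half-difference body does not decrease
the volume of a slice. *)
Lemma integral_le_costeiner m (B : set 'rV[R]_m.+1) : compact B ->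
  (forall x, B x -> B (- x)%R) ->
  lam B <= 2%:E * \int[mu1]_(s in `]0%R, +oo[) lam [set x | costeiner B (consr s x)].
Proof.
move=> cB BN; have mB := compact_rV_measurable cB.
have mS := compact_rV_measurable (compact_costeiner cB).
have cBs s := compact_section (s := s) cB.
have fin (P : set 'rV[R]_m) : compact P -> lam P \is a fin_num.
  by move=> cP; rewrite ge0_fin_numE//; exact: lebesgue_rV_compact_lty.
have neg s : lam [set x | B (consr (- s) x)] = lam [set x | B (consr s x)].
  rewrite -[RHS]lebesgue_rV_opp; last by apply: compact_rV_measurable.
  congr (lam _); apply/seteqP; split=> x /= /BN; rewrite -scaleN1r consrZ mulN1r scaleN1r.
    by rewrite opprK.
  by rewrite opprK.
rewrite lebesgue_rV_sections// integral_even//; last exact: measurable_lebesgue_rV_section.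
rewrite lee_pmul2l//; apply: ge0_le_integral => //.
- by apply: measurable_funTS; exact: measurable_lebesgue_rV_section.
- by apply: measurable_funTS; exact: measurable_lebesgue_rV_section.
move=> s _.
have cC : compact [set x | costeiner B (consr s x)].
  by apply: compact_section; exact: compact_costeiner.
set P := [set x | B (consr s x)]; set C := [set x | costeiner B (consr s x)].
have cP : compact P by exact: cBs.
have cN : compact [set x | P (- x)%R].
  rewrite (_ : [set x | P (- x)%R] = (fun x => - x)%R @` P).
    by apply: continuous_compact => //; apply: continuous_subspaceT; exact: oppr_continuous.
  apply/seteqP; split=> [x Px|_ [x Px <-]] /=; last by rewrite opprK.
  by exists (- x)%R; rewrite ?opprK.
have := brunn_minkowski cP cN cC; rewrite lebesgue_rV_opp; last exact: compact_rV_measurable.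
rewrite -(fineK (fin _ cP)) -(fineK (fin _ cC)) -!EFinM !lee_fin => bm.
have : (fine (lam P) ^+ 2 <= fine (lam C) ^+ 2)%R.
  rewrite !expr2; apply: bm => x y Px /= Py; apply/costeinerP.
  by exists x, (- y)%R; split=> //; rewrite opprK.
by rewrite ler_pXn2r// nnegrE fine_ge0.
Qed.

(** Induction on the dimension by symmetrization.  If <x, y> <= c on A x B, then
s t + <x, y> <= c for (s, x) in [steiner A] and (t, y) in [costeiner B], because s is a
half-difference a - b and y a half-difference u - w of points for which the bound
holds.  So the slices of the symmetrals at heights s and t are in the situation of the
theorem with c - s t in place of c, where the extremal ball is the slice of the larger
ball at height sqrt (s t).  The multiplicative Prekopa-Leindler inequality integrates
these bounds over s and t. *)
Theorem santalo m (c : R) (A B : set 'rV[R]_m) : compact A -> compact B ->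
  (forall x, A x -> A (- x)%R) -> (forall x, B x -> B (- x)%R) ->
  (forall x y, A x -> B y -> dotr x y <= c)%R ->
  lam A * lam B <= lam [set x : 'rV[R]_m | sqn x <= c]%R * lam [set x : 'rV[R]_m | sqn x <= c]%R.
Proof.
elim: m c A B => [|m IH] c A B cA cB AN BN ABc.
  have [->|/set0P[x Ax]] := eqVneq A set0; first by rewrite measure0 mul0e mule_ge0.
  have [->|/set0P[y By]] := eqVneq B set0; first by rewrite measure0 mule0 mule_ge0.
  have full (P : set 'rV[R]_0) z : P z -> lam P = 1.
    move=> Pz; rewrite -(@lebesgue_rV_dim0 R); congr (lam _); apply/seteqP; split=> // t _.
    by rewrite (_ : t = z)//; apply/rowP => -[].
  rewrite (full _ _ Ax) (full _ _ By) (full _ 0%R)//=.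
  by have := ABc _ _ Ax By; rewrite /sqn /dotr !big_ord0.
set E := [set x : 'rV[R]_m.+1 | sqn x <= c]%R.
have cE : compact E by exact: compact_sqn_le.
have cSA := compact_steiner cA; have cSB := compact_costeiner cB.
have EE : lam E = 2%:E * \int[mu1]_(s in `]0%R, +oo[) lam [set x | E (consr s x)].
  rewrite lebesgue_rV_sections; last exact: compact_rV_measurable.
  apply: integral_even => //; first by apply: measurable_lebesgue_rV_section; exact: compact_rV_measurable.
  by move=> s; congr (lam _); apply/seteqP; split=> x; rewrite /E/= !sqn_consr sqrrN.
apply: (le_trans (lee_pmul _ _ (integral_le_steiner cA) (integral_le_costeiner cB BN))) => //.
rewrite EE muleACA [leRHS]muleACA lee_pmul2l//.
have [a fa] := lebesgue_rV_section_bounded cSA.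
have [b gb] := lebesgue_rV_section_bounded cSB.
have [e he] := lebesgue_rV_section_bounded cE.
have fin P (u : R) : compact P -> lam [set x : 'rV[R]_m | P (consr u x)] \is a fin_num.
  by move=> cP; rewrite ge0_fin_numE//; apply: lebesgue_rV_compact_lty; exact: compact_section.
have toR (P : set 'rV[R]_m.+1) : compact P ->
    \int[mu1]_(s in `]0%R, +oo[) lam [set x | P (consr s x)] =
    \int[mu1]_(s in `]0%R, +oo[) (fine (lam [set x | P (consr s x)]))%:E.
  by move=> cP; apply: eq_integral => s _; rewrite fineK//; exact: fin.
have far (P : set 'rV[R]_m.+1) : compact P ->
    exists M, forall s, (M < s)%R -> fine (lam [set x | P (consr s x)]) = 0%R.
  move=> cP; have [d d0 Pd] := compact_sqn_bounded cP.
  exists (1 + d)%R => s ds; rewrite (_ : [set x | _] = set0) ?measure0//.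
  apply/seteqP; split=> x //= /Pd /=; rewrite sqn_consr => h.
  by have := sqn_ge0 x; nra.
have [M1 M1P] := far _ cSA; have [M2 M2P] := far _ cSB.
rewrite !toR//.
apply: (@prekopa_leindler_mul _ (Num.max a b) (Num.max M1 M2)).
- exact: measurable_fine_section.
- exact: measurable_fine_section.
- exact: measurable_fine_section.
- by move=> s; have /andP[-> h] := fa s; rewrite le_max h.
- by move=> s; have /andP[-> h] := gb s; rewrite le_max h orbT.
- by move=> s; have /andP[] := he s.
- by move=> s; rewrite gt_max => /andP[+ _]; exact: M1P.
- by move=> s; rewrite gt_max => /andP[_ +]; exact: M2P.
move=> s t s0 t0; rewrite -lee_fin expr2 !EFinM !fineK; [|exact: fin..].
have -> : [set x : 'rV[R]_m | E (consr (Num.sqrt (s * t)) x)] =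
    [set x | sqn x <= c - s * t]%R.
  have st0 : (0 <= s * t)%R by rewrite mulr_ge0 ?ltW.
  by apply/seteqP; split=> x; rewrite /E/= sqn_consr sqr_sqrtr//; lra.
apply: IH; [exact: compact_section|exact: compact_section| | |].
- move=> x /= /steinerP[p [q [Ap Aq pq]]]; apply/steinerP; exists (- q)%R, (- p)%R.
  split; last by rewrite opprK addrC.
  + by have := AN _ Aq; rewrite -scaleN1r consrZ mulN1r scaleN1r.
  + by have := AN _ Ap; rewrite -scaleN1r consrZ mulN1r scaleN1r.
- move=> x /= /costeinerP[u [w [Bu Bw ->]]]; apply/costeinerP; exists w, u; split=> //.
  by rewrite -scalerN opprB.
move=> x y /= /steinerP[p [q [Ap Aq pq]]] /costeinerP[u [w [Bu Bw ->]]].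
have := ABc _ _ Ap Bu; have := ABc _ _ Aq (BN _ Bw).
rewrite -scaleN1r consrZ !dotr_consr.
have dZr k z : (dotr x (k *: z) = k * dotr x z)%R.
  by rewrite /dotr mulr_sumr; apply: eq_bigr => i _; rewrite mxE; ring.
have dBr z z' : (dotr x (z - z') = dotr x z - dotr x z')%R.
  by rewrite /dotr -sumrB; apply: eq_bigr => i _; rewrite !mxE; ring.
by rewrite !dZr dBr; have -> : s = ((p - q) / 2)%R by [rewrite pq; field|]; nra.
Qed.

End Santalo.

(** * The weight on the space of hyperplanes *)

Section Averaging.
Variable R : realType.
Local Notation T := (measurableTypeR R).
Local Notation mu1 := (@lebesgue_measure R).
Local Notation lam := (@lebesgue_rV R _).
Local Open Scope ereal_scope.

Definition enorm m (x : 'rV[R]_m) : R := Num.sqrt (sqn x).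

Lemma enorm_ge0 m (x : 'rV[R]_m) : (0 <= enorm x)%R.
Proof. exact: sqrtr_ge0. Qed.

Lemma sqn_measurable m : measurable_fun setT (@sqn R m : _ -> T).
Proof. by apply: continuous_rV_measurable; exact: sqn_continuous. Qed.

Lemma sqrt_measurable : measurable_fun (setT : set T) (@Num.sqrt R : T -> T).
Proof. by apply: continuous_measurable_fun; exact: sqrt_continuous. Qed.

Lemma enorm_measurable m : measurable_fun setT (@enorm m : _ -> T).
Proof. exact: (measurableT_comp sqrt_measurable (@sqn_measurable m)). Qed.

(** The first-moment method. *)
Lemma ge0_le_integral_exists d (X : measurableType d) (mu : {measure set X -> \bar R})
    (f g : X -> \bar R) :
  measurable_fun setT f -> measurable_fun setT g ->
  (forall x, 0 <= f x) -> (forall x, 0 <= g x) ->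
  mu setT != 0 -> \int[mu]_x g x < +oo -> \int[mu]_x f x <= \int[mu]_x g x ->
  exists x, f x <= g x.
Proof.
move=> mf mg f0 g0 muT gfin fg; apply: contrapT => /forallNP nfg.
have gf x : g x < f x by rewrite ltNge; apply/negP/nfg.
have gfinx x : g x \is a fin_num.
  by rewrite ge0_fin_numE//; apply: lt_le_trans (gf x) (leey _).
have h0 x : 0 <= f x - g x by rewrite sube_ge0 ?gfinx// ltW.
have mh : measurable_fun setT (fun x => f x - g x) by exact: emeasurable_funB.
have E : \int[mu]_x f x = \int[mu]_x g x + \int[mu]_x (f x - g x).
  by rewrite -ge0_integralD//; apply: eq_integral => x _; rewrite addeC subeK.
have gI : \int[mu]_x g x \is a fin_num by rewrite ge0_fin_numE// integral_ge0.
have hI : \int[mu]_x (f x - g x) = 0.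
  apply/eqP; rewrite eq_le integral_ge0// andbT.
  by have := fg; rewrite E -[leRHS]adde0 leeD2lE.
have : ae_eq mu setT (fun x => f x - g x) (cst 0).
  apply/(ae_eq_integral_abs mu measurableT mh).
  by rewrite -[RHS]hI; apply: eq_integral => x _; rewrite gee0_abs.
move=> [N [mN N0 subN]]; move/eqP : muT; apply.
apply: (subset_measure0 _ mN) => // x _; apply: subN => /= /(_ I) fgx.
have := gf x; have := congr1 (fun z => z + g x) fgx.
by rewrite /= subeK// add0e => ->; rewrite ltxx.
Qed.

(** The Japanese bracket of x.  Here [bracket a] is the area density of the graph of the
form [a] over its base, and for a in R^(m+1) the power -(m+2) of it is the density, in the
chart [graph_mx], of the rotation-invariant measure on the hyperplanes of R^(m+2). *)
Definition bracket m (x : 'rV[R]_m) : R := Num.sqrt (1 + sqn x).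

Lemma bracket_gt0 m (x : 'rV[R]_m) : (0 < bracket x)%R.
Proof. by rewrite sqrtr_gt0; have := sqn_ge0 x; lra. Qed.

Lemma inv_bracket_ge0 m (x : 'rV[R]_m) p : (0 <= bracket x ^- p)%R.
Proof. by rewrite invr_ge0 exprn_ge0// ltW// bracket_gt0. Qed.

Lemma shifted_continuous m (c : R) : continuous (fun x : 'rV[R]_m => Num.sqrt (c + sqn x)).
Proof.
move=> x; apply: (@continuous_comp _ _ _ (fun x : 'rV[R]_m => c + sqn x)%R (@Num.sqrt R)).
  by apply: (@continuousD _ _ _ (cst c) (@sqn R m)); [exact: cst_continuous|exact: sqn_continuous].
exact: sqrt_continuous.
Qed.

Lemma shifted_measurable m (c : R) p : (0 < c)%R ->
  measurable_fun setT (fun x : 'rV[R]_m => Num.sqrt (c + sqn x) ^- p : T)%R.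
Proof.
move=> c0; apply: continuous_rV_measurable => x.
apply: (@continuousV _ _ (fun x : 'rV[R]_m => Num.sqrt (c + sqn x) ^+ p)%R).
  by rewrite expf_neq0// gt_eqF// sqrtr_gt0; have := sqn_ge0 x; lra.
apply: (@continuous_comp _ _ _ (fun x : 'rV[R]_m => Num.sqrt (c + sqn x))%R (fun y => y ^+ p)%R).
  exact: shifted_continuous.
exact: exprn_continuous.
Qed.

Definition bracket_mass m : \bar R := \int[@lebesgue_rV R m]_x (bracket x ^- m.+1)%:E.

Lemma bracket_mass_ge0 m : 0 <= bracket_mass m.
Proof. by apply: integral_ge0 => x _; rewrite lee_fin inv_bracket_ge0. Qed.

Lemma integral_shifted m (c : R) : (0 < c)%R ->
  \int[@lebesgue_rV R m]_x (Num.sqrt (c ^+ 2 + sqn x) ^- m.+1)%:E = (c^-1)%:E * bracket_mass m.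
Proof.
move=> c0; rewrite (ge0_integral_lebesgue_rV_affine 0%R c0)/=; last 2 first.
- by apply/measurable_EFinP; apply: shifted_measurable; rewrite exprn_gt0.
- by move=> x; rewrite lee_fin invr_ge0 exprn_ge0// sqrtr_ge0.
transitivity ((c ^+ m)%:E * \int[@lebesgue_rV R m]_x (c ^- m.+1 * bracket x ^- m.+1)%:E).
  congr (_ * _); apply: eq_integral => x _; rewrite addr0 sqnZ -{1}[(c ^+ 2)%R]mulr1 -mulrDr.
  by rewrite sqrtrM ?exprn_ge0 ?ltW// sqrtr_sqr gtr0_norm// exprMn invfM.
under eq_integral do rewrite EFinM.
rewrite ge0_integralZl_EFin//; last 3 first.
- by move=> x _; rewrite lee_fin inv_bracket_ge0.
- by apply/measurable_EFinP; apply: shifted_measurable.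
- by rewrite invr_ge0 exprn_ge0// ltW.
rewrite muleA -EFinM -/(bracket_mass m); congr (_%:E * _).
by rewrite exprS invfM mulrC -mulrA mulVf ?mulr1// expf_neq0// gt_eqF.
Qed.

Lemma bracket_consr m t (x : 'rV[R]_m) :
  bracket (consr t x) = Num.sqrt (Num.sqrt (1 + t ^+ 2) ^+ 2 + sqn x).
Proof.
by rewrite sqr_sqrtr; [rewrite /bracket sqn_consr addrA|have := sqr_ge0 t; lra].
Qed.

(** Integrating out all coordinates but the first multiplies by the mass in one
dimension less and leaves the density (1 + t^2)^-1, which is integrable. *)
Lemma bracket_mass_fin m : bracket_mass m \is a fin_num.
Proof.
rewrite ge0_fin_numE ?bracket_mass_ge0//; elim: m => [|m IH].
  rewrite /bracket_mass (eq_integral (cst 1))=> [|x _].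
    by rewrite integral_cst// mul1e [X in X < _]lebesgue_rV_dim0 ltry.
  by rewrite /bracket /sqn /dotr big_ord0 addr0 sqrtr1 expr1n invr1.
rewrite /bracket_mass lebesgue_rV_head; last 2 first.
- by apply/measurable_EFinP; apply: shifted_measurable.
- by move=> x; rewrite lee_fin inv_bracket_ge0.
have Imeas : measurable_fun (setT : set T) (fun t : T => (oneDsqr t)^-1 : T)%R.
  by apply: continuous_measurable_fun; exact: continuous_oneDsqrV.
apply: (@le_lt_trans _ _ (\int[mu1]_t (bracket_mass m * ((oneDsqr t)^-1)%:E))).
  apply: ge0_le_integral => //.
  - by move=> t _; apply: integral_ge0 => x _; rewrite lee_fin inv_bracket_ge0.
  - apply: (measurable_fun_fubini_tonelli_F (fun p => (bracket (consr p.1 p.2) ^- m.+2)%:E)).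
      apply/measurable_EFinP; apply: (measurableT_comp (@shifted_measurable m.+1 1 m.+2 ltr01)).
      exact: measurable_consr.
    by move=> p; rewrite lee_fin inv_bracket_ge0.
  - by apply: emeasurable_funM => //; exact/measurable_EFinP.
  move=> t _; set d := Num.sqrt (1 + t ^+ 2).
  have d0 : (0 < d)%R by rewrite sqrtr_gt0; have := sqr_ge0 t; lra.
  have dd : (oneDsqr t = d * d)%R.
    by rewrite -expr2 /d sqr_sqrtr//; have := sqr_ge0 t; lra.
  rewrite dd invfM EFinM muleCA [X in _ <= _ * X]muleC -integral_shifted// -ge0_integralZl_EFin//; last 2 first.
  - by apply/measurable_EFinP; apply: shifted_measurable; rewrite exprn_gt0.
  - by rewrite invr_ge0 ltW.
  apply: ge0_le_integral => //.
  - by move=> x _; rewrite lee_fin inv_bracket_ge0.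
  - apply/measurable_EFinP; apply: (measurableT_comp (@shifted_measurable m.+1 1 m.+2 ltr01)).
    exact: (measurableT_comp (@measurable_consr R m) (pair1_measurable t)).
  - apply/measurable_EFinP; apply: measurable_funM => //.
    by apply: shifted_measurable; rewrite exprn_gt0.
  move=> x _; rewrite -EFinM lee_fin bracket_consr -/d exprS invfM ler_wpM2r//.
  rewrite lef_pV2 ?posrE//; last by rewrite sqrtr_gt0 ltr_wpDr ?sqn_ge0// exprn_gt0.
  by rewrite -{1}(gtr0_norm d0) -sqrtr_sqr ler_sqrt ?lerDl ?sqn_ge0// addr_ge0 ?sqn_ge0// exprn_ge0// ltW.
rewrite ge0_integralZl//; last 2 first.
- exact/measurable_EFinP.
- exact: bracket_mass_ge0.
rewrite lte_mul_pinfty ?bracket_mass_ge0 ?ge0_fin_numE ?bracket_mass_ge0//.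
rewrite integral_even//; [|exact/measurable_EFinP|by move=> t; rewrite /oneDsqr sqrrN].
rewrite integral_itv_obnd_cbnd; last by apply: measurable_funTS; exact/measurable_EFinP.
by rewrite integral0y_oneDsqr -EFinM ltry.
Qed.

End Averaging.

(** * Averaging over hyperplanes *)

Section Slicing.
Variable R : realType.
Local Notation T := (measurableTypeR R).
Local Notation mu1 := (@lebesgue_measure R).
Local Notation lam := (@lebesgue_rV R _).
Local Open Scope ereal_scope.

Lemma graph_measurable m :
  measurable_fun setT (fun p : 'rV[R]_m * 'rV[R]_m => consr (dotr p.1 p.2) p.2).
Proof.
have dm : measurable_fun setT (fun p : 'rV[R]_m * 'rV[R]_m => dotr p.1 p.2 : T).
  apply: (measurable_sum (index_enum 'I_m) (h := fun i (p : 'rV[R]_m * 'rV[R]_m) => p.1 0%R i * p.2 0%R i)%R) => i.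
  apply: measurable_funM; apply: (@measurableT_comp _ _ _ _ _ _ (fun x : 'rV[R]_m => x 0%R i : T)) => //;
  exact: measurable_coord.
have hp : measurable_fun setT (fun p : 'rV[R]_m * 'rV[R]_m => (dotr p.1 p.2 : T, p.2)).
  by apply: measurable_fun_pair.
exact: (measurableT_comp (@measurable_consr R m) hp).
Qed.

Lemma enorm_consr m y (x : 'rV[R]_m) : enorm (consr y x) = Num.sqrt (y ^+ 2 + sqn x).
Proof. by rewrite /enorm sqn_consr. Qed.

(** Dilation by 2 fixes the origin and multiplies volume by 2^(m+1). *)
Lemma lebesgue_rV_set0 m : lam [set 0%R : 'rV[R]_m.+1] = 0.
Proof.
have c0 : compact [set 0%R : 'rV[R]_m.+1] by exact: compact_set1.
have m0 := compact_rV_measurable c0.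
have fin : lam [set 0%R : 'rV[R]_m.+1] \is a fin_num.
  by rewrite ge0_fin_numE//; exact: lebesgue_rV_compact_lty.
have := lebesgue_rV_affine (0%R : 'rV[R]_m.+1) (ltr0Sn R 1) m0.
rewrite (_ : [set x : 'rV[R]_m.+1 | _] = [set 0%R]); last first.
  apply/seteqP; split=> x /=; rewrite addr0; last by move=> ->; rewrite scaler0.
  by move=> /eqP; rewrite scaler_eq0 => /orP[|/eqP//]; rewrite pnatr_eq0.
rewrite -(fineK fin) -EFinM => -[E].
have : (1 < 2 ^+ m.+1 :> R)%R by rewrite exprn_egt1// ltr1n.
move=> h; congr EFin; move: E h; set u := fine _; set v := (2 ^+ m.+1)%R; nra.
Qed.

(** The integral of F(z)|z| over the graph of [a], up to the density of the graph over
its base: this factor cancels when two functions are compared on the same graph. *)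
Definition slice_mass m (F : 'rV[R]_m.+1 -> R) (a : 'rV[R]_m) : \bar R :=
  \int[lam]_x (F (consr (dotr a x) x) * enorm (consr (dotr a x) x))%:E.

Section SliceAverage.
Variables (m : nat) (F : 'rV[R]_m.+2 -> R).
Hypotheses (mF : measurable_fun setT (F : _ -> T)) (F0 : forall x, (0 <= F x)%R).

Let mFe : measurable_fun setT (fun x => F x * enorm x : T)%R.
Proof. by apply: measurable_funM => //; exact: enorm_measurable. Qed.

Let mgraph : measurable_fun setT (fun p : 'rV[R]_m.+1 * 'rV[R]_m.+1 =>
  F (consr (dotr p.1 p.2) p.2) * enorm (consr (dotr p.1 p.2) p.2) : T)%R.
Proof. exact: (measurableT_comp mFe (@graph_measurable m.+1)). Qed.

Lemma slice_mass_measurable : measurable_fun setT (slice_mass F).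
Proof.
apply: (measurable_fun_fubini_tonelli_F (fun p => (F (consr (dotr p.1 p.2) p.2) * enorm (consr (dotr p.1 p.2) p.2))%:E)).
  exact/measurable_EFinP.
by move=> p; rewrite lee_fin mulr_ge0// enorm_ge0.
Qed.

Lemma slice_mass_ge0 a : 0 <= slice_mass F a.
Proof. by apply: integral_ge0 => x _; rewrite lee_fin mulr_ge0// enorm_ge0. Qed.

(** Rotate a so that x becomes r times the first basis vector; then <a, x> = r t, where t is
the first coordinate of a.  Integrating out the other coordinates of a produces
(1 + t^2)^(-1/2), which cancels against |(r t, x)| = r (1 + t^2)^(1/2), and the remaining
integral in t becomes the one in y = r t. *)
Let inner (x : 'rV[R]_m.+1) : x != 0%R ->
  \int[lam]_a (bracket a ^- m.+1 * (F (consr (dotr a x) x) * enorm (consr (dotr a x) x)))%:E =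
  bracket_mass R m * \int[mu1]_y (F (consr y x))%:E.
Proof.
move=> x0; have [U UU xU] := householder x.
set r := Num.sqrt (sqn x) in xU; have r0 : (0 < r)%R by rewrite sqrtr_gt0 sqn_gt0.
have r2 : (r ^+ 2 = sqn x)%R by rewrite sqr_sqrtr// sqn_ge0.
pose g y : R := (F (consr y x) * enorm (consr y x))%R.
have mg : measurable_fun (setT : set T) (g : T -> T).
  exact: (measurableT_comp mFe (measurableT_comp (@measurable_consr R m.+1) (pair2_measurable x))).
have g0 y : (0 <= g y)%R by rewrite mulr_ge0// enorm_ge0.
pose k (a : 'rV[R]_m.+1) : \bar R := (bracket a ^- m.+1 * g (r * headr a))%:E.
have mk : measurable_fun setT k.
  apply/measurable_EFinP; apply: measurable_funM.
    exact: (@shifted_measurable _ _ 1 m.+1 ltr01).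
  have mh : measurable_fun setT (fun a : 'rV[R]_m.+1 => r * headr a : T)%R.
    by apply: measurable_funM => //; exact: measurable_coord.
  exact: (measurableT_comp mg mh).
have k0 a : 0 <= k a by rewrite lee_fin mulr_ge0// inv_bracket_ge0.
have hd (a : 'rV[R]_m.+1) : (dotr a x = r * headr (a *m U))%R.
  have -> : dotr a x = dotr (a *m U) (x *m U).
    by rewrite dotr_mulmx -mulmxA UU mulmx1.
  by rewrite xU dotrZr dotr_delta.
transitivity (\int[@lebesgue_rV R m.+1]_a k (a *m U)%R).
  by apply: eq_integral => a _; rewrite /k /bracket sqn_orth// hd.
rewrite ge0_integral_orth// lebesgue_rV_head//.
have inn t : \int[lam]_b k (consr t b) = bracket_mass R m * (r * F (consr (r * t + 0) x))%:E.
  set d := Num.sqrt (1 + t ^+ 2).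
  have d0 : (0 < d)%R by rewrite sqrtr_gt0; have := sqr_ge0 t; lra.
  transitivity (\int[@lebesgue_rV R m]_b ((g (r * t)%R)%:E * (Num.sqrt (d ^+ 2 + sqn b) ^- m.+1)%:E)).
    by apply: eq_integral => b _; rewrite /k headr_consr bracket_consr -EFinM mulrC.
  rewrite ge0_integralZl_EFin//; last first.
    by apply/measurable_EFinP; apply: shifted_measurable; rewrite exprn_gt0.
  rewrite integral_shifted// muleCA muleA muleC; congr (_ * _).
  rewrite -EFinM; congr EFin; rewrite /g enorm_consr addr0.
  have -> : ((r * t) ^+ 2 + sqn x = r ^+ 2 * (1 + t ^+ 2))%R by rewrite -r2; ring.
  rewrite sqrtrM ?sqr_ge0// sqrtr_sqr gtr0_norm// -/d.
  by field; rewrite gt_eqF.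
under eq_integral do rewrite inn.
have mFx : measurable_fun (setT : set T) (fun y => F (consr y x) : T).
  exact: (measurableT_comp mF (measurableT_comp (@measurable_consr R m.+1) (pair2_measurable x))).
have mFa : measurable_fun (setT : set T) (fun t => F (consr (r * t + 0) x) : T)%R.
  exact: (measurableT_comp mFx (affine_measurable r 0%R)).
rewrite ge0_integralZl ?bracket_mass_ge0//; last 2 first.
- by apply/measurable_EFinP; exact: measurable_funM.
- by move=> t _; rewrite lee_fin mulr_ge0// ltW.
congr (_ * _); rewrite [RHS](ge0_integral_affine 0%R r0); last 2 first.
- exact/measurable_EFinP.
- by move=> s; rewrite lee_fin.
under eq_integral do rewrite EFinM.
rewrite ge0_integralZl_EFin//; [by move=> t _; rewrite lee_fin|exact/measurable_EFinP|exact: ltW].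
Qed.

(** A formula of Blaschke-Petkantschin type: the mass of F is the average of its
masses on hyperplanes, weighted by |z|.  Exchange the integrals and apply the
computation for fixed x. *)
Lemma slice_average :
  \int[lam]_a ((bracket a ^- m.+1)%:E * slice_mass F a) = bracket_mass R m * \int[lam]_x (F x)%:E.
Proof.
pose h (p : 'rV[R]_m.+1 * 'rV[R]_m.+1) : \bar R :=
  (bracket p.1 ^- m.+1 * (F (consr (dotr p.1 p.2) p.2) * enorm (consr (dotr p.1 p.2) p.2)))%:E.
have mh : measurable_fun setT h.
  apply/measurable_EFinP; apply: measurable_funM => //.
  exact: (measurableT_comp (@shifted_measurable R m.+1 1 m.+1 ltr01) measurable_fst).
have h0 p : 0 <= h p by rewrite lee_fin !mulr_ge0// ?enorm_ge0// inv_bracket_ge0.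
transitivity (\int[lam]_a \int[lam]_x h (a, x)).
  apply: eq_integral => a _; rewrite /slice_mass -ge0_integralZl_EFin//.
  - by move=> x _; rewrite lee_fin mulr_ge0// enorm_ge0.
  - by apply/measurable_EFinP; exact: (measurableT_comp mgraph (pair1_measurable a)).
  - exact: inv_bracket_ge0.
rewrite (fubini_tonelli h mh h0) lebesgue_rV_tail//; [|exact/measurable_EFinP].
have mtail : measurable_fun setT (fun x => \int[mu1]_s (F (consr s x))%:E).
  apply: (measurable_fun_fubini_tonelli_G (m1 := mu1) (fun p : T * 'rV[R]_m.+1 => (F (consr p.1 p.2))%:E)).
    by apply/measurable_EFinP; exact: (measurableT_comp mF (@measurable_consr R m.+1)).
  by move=> p; rewrite lee_fin.
rewrite -ge0_integralZl ?bracket_mass_ge0//; last first.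
  by move=> x _; apply: integral_ge0 => y _; rewrite lee_fin.
apply: ge0_ae_eq_integral => //.
- exact: (measurable_fun_fubini_tonelli_G h).
- by apply: emeasurable_funM.
- by move=> x _; exact: integral_ge0.
- move=> x _; rewrite mule_ge0 ?bracket_mass_ge0//.
  by apply: integral_ge0 => y _; rewrite lee_fin.
exists [set 0%R]; split.
- by apply: compact_rV_measurable; exact: compact_set1.
- exact: lebesgue_rV_set0.
- move=> x /=; apply: contra_notP => /eqP x0 _.
  exact: inner.
Qed.

End SliceAverage.
End Slicing.

(** * A subspace of small mass *)

Section Hyperplane.
Variable R : realType.
Local Notation T := (measurableTypeR R).
Local Notation lam := (@lebesgue_rV R _).
Local Open Scope ereal_scope.

Definition ball_power k m (x : 'rV[R]_m) : R := (\1_(@eball R m) x * enorm x ^+ k)%R.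
(** The reference against which masses on slices are measured: |z| to the power k
integrated over the unit ball. *)
Definition ball_moment m k : \bar R := \int[@lebesgue_rV R m]_x (ball_power k x)%:E.

Lemma ball_power_ge0 k m (x : 'rV[R]_m) : (0 <= ball_power k x)%R.
Proof. by rewrite mulr_ge0// exprn_ge0// enorm_ge0. Qed.

Lemma enorm_exp_measurable k m : measurable_fun setT (fun x : 'rV[R]_m => enorm x ^+ k : T)%R.
Proof. by apply: measurable_funX; exact: enorm_measurable. Qed.

Lemma ball_power_measurable k m : measurable_fun setT (@ball_power k m : _ -> T).
Proof.
apply: measurable_funM; last exact: enorm_exp_measurable.
by apply: measurable_indic; exact: measurable_eball.
Qed.

Lemma ball_moment_ge0 m k : 0 <= ball_moment m k.
Proof. by apply: integral_ge0 => x _; rewrite lee_fin ball_power_ge0. Qed.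

Lemma enorm_le1 m (x : 'rV[R]_m) : (enorm x <= 1)%R = (sqn x <= 1)%R.
Proof. by rewrite -{1}sqrtr1 ler_sqrt. Qed.

Lemma ball_moment_fin m k : ball_moment m k \is a fin_num.
Proof.
rewrite ge0_fin_numE ?ball_moment_ge0//.
apply: (@le_lt_trans _ _ (lam (@eball R m))); last first.
  by apply: lebesgue_rV_compact_lty; exact: compact_eball.
rewrite -(integral_indicT _ (@measurable_eball R m)); apply: ge0_le_integral => //.
- by move=> x _; rewrite lee_fin ball_power_ge0.
- by apply/measurable_EFinP; exact: ball_power_measurable.
- by apply/measurable_EFinP; apply: measurable_indic; exact: measurable_eball.
move=> x _; rewrite lee_fin /ball_power indicE; case: (boolP (x \in _)) => [|_]; last by rewrite mul0r.
by rewrite inE /eball/= -enorm_le1 mul1r => x1; rewrite exprn_ile1// enorm_ge0.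
Qed.

Lemma enorm_orth m n (Q : 'M[R]_(m, n)) (x : 'rV[R]_m) :
  (Q *m Q^T = 1%:M -> enorm (x *m Q) = enorm x)%R.
Proof. by move=> QQ; rewrite /enorm sqn_orth. Qed.

Lemma ball_power_orth k m n (Q : 'M[R]_(m, n)) (x : 'rV[R]_m) :
  (Q *m Q^T = 1%:M -> ball_power k (x *m Q) = ball_power k x)%R.
Proof.
move=> QQ; rewrite /ball_power enorm_orth//; congr (_ * _)%R; rewrite !indicE; congr (_%:R)%R.
by congr nat_of_bool; apply/idP/idP; rewrite !inE /eball/= sqn_orth.
Qed.

(** In orthonormal coordinates on the graph of [a], [slice_mass] is the integral of
F(z)|z| up to a factor that depends on the graph only. *)
Lemma slice_massE m (F : 'rV[R]_m.+1 -> R) (a : 'rV[R]_m) (W : 'M[R]_m) (c : R) :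
  measurable_fun setT (F : _ -> T) -> (forall x, (0 <= F x)%R) ->
  ((W *m graph_mx a) *m (W *m graph_mx a)^T = 1%:M)%R ->
  (forall f : 'rV[R]_m -> \bar R, measurable_fun setT f -> (forall x, 0 <= f x) ->
    \int[lam]_x f (x *m W)%R = c%:E * \int[lam]_x f x) ->
  \int[lam]_z (F (z *m (W *m graph_mx a)) * enorm z)%:E = c%:E * slice_mass F a.
Proof.
move=> mF F0 QQ cE; rewrite -cE.
- apply: eq_integral => z _.
  by rewrite -mul_graph_mx -mulmxA enorm_orth.
- apply/measurable_EFinP.
  have mFe : measurable_fun setT (fun x => F x * enorm x : T)%R.
    by apply: measurable_funM => //; exact: enorm_measurable.
  exact: (measurableT_comp mFe (measurableT_comp (@graph_measurable R m) (pair1_measurable a))).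
- by move=> x; rewrite lee_fin mulr_ge0// enorm_ge0.
Qed.

(** [slice_average] for F and for the weighted indicator of the ball: some hyperplane does
at least as well as the average.  On that hyperplane the weighted ball is again a
weighted ball, by rotation invariance. *)
Lemma average_hyperplane m k (F : 'rV[R]_m.+2 -> R) (rho : R) : (0 <= rho)%R ->
  measurable_fun setT (F : _ -> T) -> (forall x, (0 <= F x)%R) ->
  \int[lam]_x (F x)%:E <= rho%:E * ball_moment m.+2 k ->
  exists2 Q : 'M[R]_(m.+1, m.+2), (Q *m Q^T = 1%:M)%R &
    \int[lam]_z (F (z *m Q) * enorm z)%:E <= rho%:E * ball_moment m.+1 k.+1.
Proof.
move=> rho0 mF F0 Frho.
pose G := @ball_power k m.+2; have mG := @ball_power_measurable k m.+2.
have G0 := @ball_power_ge0 k m.+2.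
have mphi : measurable_fun setT (fun a : 'rV[R]_m.+1 => (bracket a ^- m.+1)%:E).
  by apply/measurable_EFinP; exact: (@shifted_measurable R m.+1 1 m.+1 ltr01).
have IF := slice_average mF F0; have IG := slice_average mG G0.
have IrG : \int[lam]_a (rho%:E * ((bracket a ^- m.+1)%:E * slice_mass G a)) =
    bracket_mass R m * (rho%:E * ball_moment m.+2 k).
  rewrite ge0_integralZl_EFin//; first by rewrite IG muleCA.
  - by move=> a _; rewrite mule_ge0 ?slice_mass_ge0// lee_fin inv_bracket_ge0.
  - by apply: emeasurable_funM => //; exact: slice_mass_measurable.
have [|||||||a ha] := @ge0_le_integral_exists _ _ _ (@lebesgue_rV R m.+1)
    (fun a => (bracket a ^- m.+1)%:E * slice_mass F a)
    (fun a => rho%:E * ((bracket a ^- m.+1)%:E * slice_mass G a)).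
- by apply: emeasurable_funM => //; exact: slice_mass_measurable.
- by apply: emeasurable_funM => //; apply: emeasurable_funM => //; exact: slice_mass_measurable.
- by move=> a; rewrite mule_ge0 ?slice_mass_ge0// lee_fin inv_bracket_ge0.
- by move=> a; rewrite mule_ge0// mule_ge0 ?slice_mass_ge0// lee_fin inv_bracket_ge0.
- rewrite gt_eqF//; apply: (lt_le_trans (@lebesgue_rV_eball_gt0 R m.+1)).
  by apply: le_measure; rewrite ?inE//; exact: measurable_eball.
- rewrite IrG -ge0_fin_numE; last by rewrite !mule_ge0 ?bracket_mass_ge0 ?ball_moment_ge0.
  by rewrite !fin_numM ?bracket_mass_fin// ball_moment_fin.
- by rewrite IF IrG lee_pmul ?bracket_mass_ge0// integral_ge0// => x _; rewrite lee_fin.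
have {}ha : slice_mass F a <= rho%:E * slice_mass G a.
  by move: ha; rewrite muleCA lee_pmul2l// lte_fin invr_gt0 exprn_gt0// bracket_gt0.
have [W uW WW] := graph_orthonormal a.
have [c c0 cE] := ge0_integral_linear uW.
exists (W *m graph_mx a)%R => //; rewrite (slice_massE mF F0 WW cE).
have -> : ball_moment m.+1 k.+1 = c%:E * slice_mass G a.
  rewrite -(slice_massE mG G0 WW cE); apply: eq_integral => z _.
  by rewrite /G ball_power_orth// /ball_power exprSr mulrA.
by rewrite muleCA lee_pmul2l.
Qed.

(** Each passage to a hyperplane contributes one factor |z|, also in the reference moment
of the ball. *)
Lemma average_subspace n j k (F : 'rV[R]_(j + n.+1) -> R) (rho : R) : (0 <= rho)%R ->
  measurable_fun setT (F : _ -> T) -> (forall x, (0 <= F x)%R) ->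
  \int[lam]_x (F x)%:E <= rho%:E * ball_moment (j + n.+1) k ->
  exists2 Q : 'M[R]_(n.+1, j + n.+1), (Q *m Q^T = 1%:M)%R &
    \int[lam]_z (F (z *m Q) * enorm z ^+ j)%:E <= rho%:E * ball_moment n.+1 (j + k).
Proof.
move=> rho0; elim: j k F => [|j IH] k F mF F0 Frho.
  exists 1%:M%R; first by rewrite trmx1 mulmx1.
  by under eq_integral do rewrite mulmx1 expr0 mulr1.
(* The next step needs the dimension in the form of a successor. *)
have [M MM] : exists M, (j + n.+1 = M.+1)%N by exists (j + n)%N; rewrite addnS.
have [Q1 Q11 Q1F] : exists2 Q : 'M[R]_(j + n.+1, j.+1 + n.+1), (Q *m Q^T = 1%:M)%R &
    \int[lam]_z (F (z *m Q) * enorm z)%:E <= rho%:E * ball_moment (j + n.+1) k.+1.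
  rewrite /= addSn in F mF F0 Frho *.
  move: F mF F0 Frho; rewrite MM => F mF F0 Frho.
  exact: average_hyperplane.
have mF1 : measurable_fun setT (fun z => F (z *m Q1) * enorm z : T)%R.
  apply: measurable_funM; last exact: enorm_measurable.
  exact: (measurableT_comp mF (@mulmx_measurable R _ _ Q1)).
have F10 z : (0 <= F (z *m Q1) * enorm z)%R by rewrite mulr_ge0// enorm_ge0.
have [Q2 Q22 Q2F] := IH k.+1 _ mF1 F10 Q1F.
exists (Q2 *m Q1)%R; first by rewrite trmx_mul mulmxA -(mulmxA Q2) Q11 mulmx1.
apply: le_trans (_ : _ <= rho%:E * ball_moment n.+1 (j + k.+1)) _; last by rewrite addnS.
apply: le_trans Q2F; apply: ge0_le_integral => //.
- by move=> z _; rewrite lee_fin mulr_ge0// exprn_ge0// enorm_ge0.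
- apply/measurable_EFinP; apply: measurable_funM; last exact: enorm_exp_measurable.
  exact: (measurableT_comp mF (@mulmx_measurable R _ _ (Q2 *m Q1)%R)).
- apply/measurable_EFinP; apply: measurable_funM; last exact: enorm_exp_measurable.
  exact: (measurableT_comp mF1 (@mulmx_measurable R _ _ Q2)).
by move=> z _; rewrite enorm_orth// mulmxA exprS mulrA.
Qed.

End Hyperplane.

(** * Polarity and round subquotients *)

Section Duality.
Variable R : realType.

Definition convexr m (K : set 'rV[R]_m) : Prop :=
  forall (t : R) x y, 0 <= t <= 1 -> K x -> K y -> K (t *: x + (1 - t) *: y).

Lemma dotr0l m (x : 'rV[R]_m) : dotr 0 x = 0.
Proof. by rewrite -[X in dotr X _](scale0r 0) dotrZl mul0r. Qed.

Lemma dotr_sqr_le m (x y : 'rV[R]_m) : dotr x y ^+ 2 <= sqn x * sqn y.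
Proof.
have [->|y0] := eqVneq y 0; first by rewrite dotrC dotr0l expr0n mulr_ge0 ?sqn_ge0.
have yy := sqn_gt0 y0.
have := sqn_ge0 (sqn y *: x - dotr x y *: y).
rewrite sqnD -scaleNr !sqnZ dotrZl dotrZr.
set a := sqn x; set b := sqn y in yy *; set c := dotr x y => h.
have : 0 <= b * (a * b - c ^+ 2) by move: h; congr (_ <= _); ring.
by rewrite pmulr_rge0// subr_ge0.
Qed.

Lemma dotr_le m (x y : 'rV[R]_m) (c : R) : 0 <= c -> sqn x <= c ^+ 2 -> sqn y <= 1 ->
  dotr x y <= c.
Proof.
move=> c0 xc y1; have := dotr_sqr_le x y; have := sqn_ge0 x; have := sqn_ge0 y.
move=> y0 x0 h; rewrite leNgt; apply/negP => cxy.
have : c ^+ 2 < dotr x y ^+ 2 by rewrite ltr_pXn2r// nnegrE// ltW// (le_lt_trans c0).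
by rewrite ltNge (le_trans h)// (le_trans _ xc)// ler_piMr.
Qed.

Lemma sqn_le_of_dotr m (x : 'rV[R]_m) (c : R) :
  (forall y, sqn y <= 1 -> dotr x y <= c) -> sqn x <= c ^+ 2.
Proof.
move=> h; have [->|x0] := eqVneq x 0.
  by rewrite (_ : sqn 0 = 0) ?sqr_ge0//; exact: dotr0l.
have xx := sqn_gt0 x0; set r := Num.sqrt (sqn x).
have r0 : 0 < r by rewrite sqrtr_gt0.
have r2 : r ^+ 2 = sqn x by rewrite sqr_sqrtr// ltW.
have := h (r^-1 *: x); rewrite sqnZ -r2 exprVn mulVf ?lexx ?expf_neq0 ?gt_eqF// => /(_ isT).
rewrite dotrZr -/(sqn x) -r2 expr2 mulKf ?gt_eqF// => rc.
by rewrite -?expr2 ler_pXn2r// nnegrE ltW// (lt_le_trans r0).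
Qed.

(** The nearest point p of C to v gives the separating functional v - p. *)
Lemma separation d (C : set 'rV[R]_d) v : C !=set0 -> compact C -> convexr C -> ~ C v ->
  exists w h, [/\ forall x, C x -> dotr w x <= h & h < dotr w v].
Proof.
move=> C0 cC convC nCv.
have cont : continuous (fun x : 'rV[R]_d => sqn (x - v)).
  move=> x; apply: (@continuous_comp _ _ _ (fun x : 'rV[R]_d => x - v) (@sqn R d)).
    by apply: (@continuousB _ _ _ id (cst v)); [exact: cvg_id|exact: cst_continuous].
  exact: sqn_continuous.
have [|p + pmin] := @EVT_min_rV R d _ C C0 cC (_ : {within C, continuous (fun x => sqn (x - v))}).
  exact: continuous_subspaceT.
rewrite inE => Cp.
pose w := v - p; have w0 : w != 0.
  by apply: contra_notN nCv; rewrite subr_eq0 => /eqP ->.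
exists w, (dotr w p); split; last first.
  by rewrite -subr_gt0 -dotrNr -dotrDr; exact: sqn_gt0.
move=> x Cx; rewrite leNgt; apply/negP => px.
have key t : 0 <= t <= 1 -> 2 * dotr w (x - p) <= t * sqn (x - p) \/ t = 0.
  move=> t01; have [->|t0] := eqVneq t 0; [by right|left].
  have := pmin _ (mem_set (convC t x p t01 Cx Cp)).
  rewrite (_ : t *: x + (1 - t) *: p - v = t *: (x - p) - w); last first.
    by rewrite /w scalerBr scalerBl scale1r; apply/rowP => i; rewrite !mxE; ring.
  rewrite (_ : p - v = - w); last by rewrite opprB.
  rewrite (sqnD (t *: (x - p))) -[- w]scaleN1r !sqnZ dotrZl dotrZr (dotrC _ w) => h.
  have tt : 0 < t by rewrite lt_neqAle eq_sym t0; have /andP[] := t01.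
  by rewrite -(ler_pM2l tt); move: h; set a := dotr w _; set b := sqn _; set e := sqn w; nra.
have s0 : 0 < dotr w (x - p) by rewrite dotrDr dotrNr subr_gt0.
set a := dotr w (x - p) in key s0; set b := sqn (x - p) in key.
have b0 : 0 <= b := sqn_ge0 _.
have ab : 0 < a + b by lra.
(* At this t the point of the segment from p to x is closer to v than p. *)
have [||t0] := key (a / (a + b)).
- by apply/andP; split; [apply: divr_ge0; exact: ltW|rewrite ler_pdivrMr// mul1r lerDl].
- by rewrite mulrAC ler_pdivlMr//; nra.
- by move: t0 => /eqP; rewrite mulf_eq0 invr_eq0 (gt_eqF s0) (gt_eqF ab).
Qed.

(** A coordinate version of: K has a subquotient of dimension n lying between the
unit ball and its dilate by rho.  J parametrizes a subspace of R^N, possibly with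
redundancy, and p is the projection of that subspace onto R^n.  Allowing arbitrary
matrices J and p makes the notion stable under composition and polarity. *)
Definition has_round N n (K : set 'rV[R]_N) (rho : R) : Prop :=
  exists d (J : 'M[R]_(d, N)) (p : 'M[R]_(d, n)),
    (forall y, sqn y <= 1 -> exists2 s, K (s *m J) & s *m p = y) /\
    (forall s, K (s *m J) -> sqn (s *m p) <= rho ^+ 2).

(** The polar of K dilated by c. *)
Definition polar_body N (c : R) (K : set 'rV[R]_N) : set 'rV[R]_N :=
  [set y | forall x, K x -> dotr x y <= c].

(** Polarity exchanges slices and projections.  If a subquotient of the polar is
given by (J, p), the dual one is the pullback of the transposes: pairs (x, y) with
x J^T proportional to y p^T, projected to y.  Its outer bound dualises the inner bound of
the given one directly; its inner bound dualises the outer bound through the separation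
theorem in the space of J. *)
Lemma has_round_polar N n (K : set 'rV[R]_N) (c rho : R) : 0 < c -> 0 < rho ->
  compact K -> convexr K -> K 0 ->
  has_round n (polar_body c K) rho -> has_round n K rho.
Proof.
move=> c0 rho0 cK convK K0 [d [J [p [Jp1 Jp2]]]].
pose A := col_mx J^T (- (c / rho) *: p^T).
pose J' := lsubmx (kermx A); pose p' := rsubmx (kermx A).
have kerE (s : 'rV[R]_(N + n)) : (s *m J') *m J^T = (c / rho) *: ((s *m p') *m p^T).
  have : s *m kermx A *m A = 0 by rewrite -mulmxA mulmx_ker mulmx0.
  rewrite -[s *m kermx A]hsubmxK mul_row_col -mulmx_lsub -mulmx_rsub -/J' -/p'.
  by rewrite -scalemxAr scaleNr => /eqP; rewrite subr_eq0 => /eqP.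
have kerI (x : 'rV[R]_N) (y : 'rV[R]_n) : x *m J^T = (c / rho) *: (y *m p^T) -> exists2 s, s *m J' = x & s *m p' = y.
  move=> E; have /submxP[s sE] : (row_mx x y <= kermx A)%MS.
    by apply/sub_kermxP; rewrite mul_row_col E -scalemxAr scaleNr subrr.
  exists s; first by rewrite /J' mulmx_lsub -sE row_mxKl.
  by rewrite /p' mulmx_rsub -sE row_mxKr.
exists _, J', p'; split=> [y y1|s Ks]; last first.
  apply: sqn_le_of_dotr => z z1; have [u Mu uz] := Jp1 z z1.
  have := Mu _ Ks; rewrite dotrC dotr_mulmx kerE dotrZr -dotr_mulmx uz (dotrC z) => h.
  by rewrite -(ler_pM2l (divr_gt0 c0 rho0)) (le_trans h)// mulfVK ?gt_eqF.
pose v := (c / rho) *: (y *m p^T).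
suff : ((fun x => x *m J^T) @` K) v.
  by move=> [x Kx xv]; have [s sx sy] := kerI x y xv; exists s => //; rewrite sx.
apply: contrapT => nv.
have [||||w [h [wh hv]]] := @separation d ((fun x => x *m J^T) @` K) v.
- by exists (0 *m J^T), 0.
- apply: continuous_compact => //; apply: continuous_subspaceT; exact: mulmx_continuous.
- move=> t _ _ t01 [x Kx <-] [x' Kx' <-]; exists (t *: x + (1 - t) *: x'); first exact: convK.
  by rewrite mulmxDl !scalemxAl.
- by [].
have h0 : 0 <= h by have := wh 0 (ex_intro2 _ _ 0 K0 (mul0mx _ _)); rewrite dotrC dotr0l.
set u := dotr w v in hv; have u0 : 0 < u := le_lt_trans h0 hv.
(* This t satisfies t h <= c < t u, and it makes sense for h = 0 as well. *)
pose t := 2 * c / (h + u); have hu : 0 < h + u by lra.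
have t0 : 0 < t by rewrite divr_gt0// mulr_gt0.
have Mt : polar_body c K ((t *: w) *m J).
  move=> x Kx; rewrite dotrC dotr_mulmx dotrZl.
  apply: (@le_trans _ _ (t * h)); first by rewrite ler_pM2l//; apply: wh; exists x.
  by rewrite /t mulrAC ler_pdivrMr//; nra.
have := dotr_le (ltW rho0) (Jp2 _ Mt) y1.
rewrite dotr_mulmx dotrZl => tu.
have : t * u <= c.
  rewrite /u /v dotrZr mulrCA; move: tu; set q := dotr w _ => tq.
  by rewrite mulrAC ler_pdivrMr// ler_pM2l.
by rewrite /t mulrAC ler_pdivrMr// leNgt => /negP; apply; nra.
Qed.

End Duality.

(** * Moments of the ball *)

Lemma le_measure_subset d (X : measurableType d) (R : realType) (mu : {measure set X -> \bar R})
    (A B : set X) : measurable A -> measurable B -> A `<=` B -> (mu A <= mu B)%E.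
Proof. by move=> mA mB AB; apply: le_measure; rewrite ?inE. Qed.

Section Moments.
Variable R : realType.
Local Notation T := (measurableTypeR R).
Local Notation lam := (@lebesgue_rV R _).
Local Open Scope ereal_scope.

Lemma lebesgue_rV_sqn_le m (c : R) : (0 < c)%R ->
  lam [set x : 'rV[R]_m | sqn x <= c ^+ 2]%R = (c ^+ m)%:E * lam (@eball R m).
Proof.
move=> c0.
have mE : measurable [set x : 'rV[R]_m | sqn x <= c ^+ 2]%R.
  by apply: compact_rV_measurable; exact: compact_sqn_le.
rewrite (lebesgue_rV_affine 0%R c0 mE); congr (_ * lam _); apply/seteqP; split=> x;
by rewrite /eball/= addr0 sqnZ -ler_pdivlMl ?exprn_gt0// mulVf// expf_neq0// gt_eqF.
Qed.

(** Bernoulli gives an explicit t close to 1 when a > b. *)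
Lemma le_of_pow_lt1 m (a b : R) : (0 <= b)%R ->
  (forall t, 0 < t < 1 -> t ^+ m * a <= b)%R -> (a <= b)%R.
Proof.
move=> b0 h; rewrite leNgt; apply/negP => ba; have a0 : (0 < a)%R by exact: le_lt_trans ba.
have bern (e : R) : (0 <= e <= 1 -> 1 - m%:R * e <= (1 - e) ^+ m)%R.
  move=> e01; elim: m {h} => [|k IH]; first by rewrite expr0 mul0r subr0.
  rewrite exprS; have k0 : (0 <= k%:R :> R)%R by [].
  apply: (@le_trans _ _ ((1 - e) * (1 - k%:R * e))%R); last by rewrite ler_wpM2l//; lra.
  rewrite -natr1; nra.
(* Small enough for m e a <= (a - b) / 2. *)
pose e := ((a - b) / (2 * (m%:R + 1) * a))%R.
have m0 : (0 <= m%:R :> R)%R by [].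
have den : (0 < 2 * (m%:R + 1) * a)%R by rewrite !mulr_gt0// ltr_wpDl.
have e0 : (0 < e)%R by rewrite divr_gt0// subr_gt0.
have e1 : (e < 1)%R by rewrite ltr_pdivrMr// mul1r; nra.
have := h (1 - e)%R; rewrite gtrBl e0 subr_gt0 e1 => /(_ isT).
have ea : (m%:R * e * a <= (a - b) / 2)%R.
  rewrite /e; have -> : (m%:R * ((a - b) / (2 * (m%:R + 1) * a)) * a =
    (a - b) / 2 * (m%:R / (m%:R + 1)))%R by field; rewrite !gt_eqF// ltr_wpDl.
  rewrite ler_piMr//; first by rewrite divr_ge0// subr_ge0 ltW.
  by rewrite ler_pdivrMr ?mul1r ?lerDl// ltr_wpDl.
have e01 : (0 <= e <= 1)%R by rewrite !ltW.
have := ler_wpM2r (ltW a0) (bern e e01); rewrite mulrBl mul1r.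
by set q := ((1 - e) ^+ m * a)%R; lra.
Qed.

Lemma enorm0 m : enorm (0 : 'rV[R]_m) = 0%R.
Proof. by rewrite /enorm (_ : sqn 0 = 0%R) ?sqrtr0//; exact: dotr0l. Qed.

Lemma sqn_scaled_lt m (t : R) (x y : 'rV[R]_m) : (0 < t -> t < 1 -> x != 0 ->
  sqn y <= (t * enorm x) ^+ 2 -> sqn y < sqn x)%R.
Proof.
move=> t0 t1 /sqn_gt0 x0; rewrite exprMn sqr_sqrtr ?sqn_ge0// => yx.
by apply: le_lt_trans yx _; rewrite gtr_pMl// expr_lt1// ltW.
Qed.

(** For two independent points x, y of the ball, either of |y| < |x| and |x| < |y| has at
most half of the mass, by symmetry.  Given x, the points y with |y| < |x| contain the ball of
radius t |x| for t < 1, of volume t^m |x|^m vol B; let t tend to 1. *)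
Lemma ball_moment_half m : (0 < m)%N -> 2%:E * ball_moment R m m <= lam (@eball R m).
Proof.
move=> m0; set B := @eball R m; have mB : measurable B := @measurable_eball R m.
have Bfin : lam B \is a fin_num := @lebesgue_rV_eball_fin R m.
have B0 : 0 < lam B := @lebesgue_rV_eball_gt0 R m.
pose D : set ('rV[R]_m * 'rV[R]_m) := (B `*` B) `&` [set p | sqn p.2 < sqn p.1]%R.
have mD : measurable D.
  apply: measurableI; first exact: measurableX.
  apply: measurable_ltr_set; apply: (measurableT_comp (@sqn_measurable R m)) => //.
pose D' : set ('rV[R]_m * 'rV[R]_m) := (B `*` B) `&` [set p | sqn p.1 < sqn p.2]%R.
have mD' : measurable D'.
  apply: measurableI; first exact: measurableX.
  apply: measurable_ltr_set; apply: (measurableT_comp (@sqn_measurable R m)) => //.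
pose f (A : set ('rV[R]_m * 'rV[R]_m)) p : \bar R := (\1_A p)%:E.
have mf A : measurable A -> measurable_fun setT (f A).
  by move=> mA; apply/measurable_EFinP; exact: measurable_indic.
have f0 A p : 0 <= f A p by rewrite lee_fin.
(* Exchanging the two points maps D onto D'. *)
have DD' : \int[lam]_x \int[lam]_y f D (x, y) = \int[lam]_x \int[lam]_y f D' (x, y).
  rewrite (fubini_tonelli (f D) (mf _ mD) (f0 D)).
  apply: eq_integral => y _; apply: eq_integral => x _; rewrite /f !indicE.
  by congr ((nat_of_bool _)%:R%:E); apply/idP/idP; rewrite !inE /D /D'/= => -[[]].
have sec A (x : 'rV[R]_m) : measurable A -> \int[lam]_y f A (x, y) = lam [set y | A (x, y)].
  move=> mA; have mAx : measurable [set y | A (x, y)].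
    by rewrite -[X in measurable X]setTI; exact: (pair1_measurable x).
  by rewrite -(integral_indicT _ mAx).
have mI A : measurable A -> measurable_fun setT (fun x : 'rV[R]_m => \int[lam]_y f A (x, y)).
  by move=> mA; exact: (measurable_fun_fubini_tonelli_F (f A) (mf _ mA) (f0 A)).
have S2 : 2%:E * \int[lam]_x \int[lam]_y f D (x, y) <= lam B * lam B.
  have dbl (z : \bar R) : 2%:E * z = z + z by rewrite mule_natl mule2n.
  have I0 A (x : 'rV[R]_m) : setT x -> 0 <= \int[lam]_y f A (x, y).
    by move=> _; apply: integral_ge0.
  rewrite dbl [X in _ + X <= _]DD'.
  rewrite -(ge0_integralD _ measurableT (I0 D) (mI D mD) (I0 D') (mI D' mD')).
  have mB1 : measurable_fun setT (fun x : 'rV[R]_m => (\1_B x : R)%:E).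
    exact/measurable_EFinP/measurable_indic.
  have B10 (x : 'rV[R]_m) : setT x -> 0 <= (\1_B x : R)%:E by rewrite lee_fin.
  apply: (@le_trans _ _ (\int[lam]_x (lam B * (\1_B x)%:E))); last first.
    rewrite (ge0_integralZl _ measurableT mB1 B10 (measure_ge0 _ _)).
    by rewrite (integral_indicT _ mB).
  apply: (ge0_le_integral _ measurableT).
  - by move=> x _; apply: adde_ge0; exact: I0.
  - by apply: emeasurable_funD; exact: mI.
  - by apply: emeasurable_funM => //; exact: measurable_cst.
  move=> x _; rewrite (sec D x mD) (sec D' x mD') indicE.
  case: (boolP (x \in B)) => [xB|xB]; last first.
    have empty A : A `<=` B `*` B -> [set y : 'rV[R]_m | A (x, y)] = set0.
      move=> AB; rewrite -subset0 => y /AB[xB' _].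
      by move/negP : xB; apply; apply: mem_set.
    have -> : [set y | D (x, y)] = set0 by apply: empty => p [].
    have -> : [set y | D' (x, y)] = set0 by apply: empty => p [].
    by rewrite measure0 adde0 mule0.
  have msec (A : set ('rV[R]_m * 'rV[R]_m)) : measurable A -> measurable [set y | A (x, y)].
    by move=> mA; rewrite -[X in measurable X]setTI; exact: (pair1_measurable x).
  rewrite mule1 -measureU; [|exact: msec|exact: msec|].
    apply: (le_measure_subset _ (measurableU _ _ (msec _ mD) (msec _ mD')) mB).
    by move=> y [[[]]|[[]]].
  rewrite -subset0 => y [[_ yx] [_ xy]].
  by have := lt_trans (yx : (sqn y < sqn x)%R) (xy : (sqn x < sqn y)%R); rewrite ltxx.
pose b := fine (lam B); have bE : lam B = b%:E by rewrite fineK.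
have b0 : (0 < b)%R by rewrite -lte_fin -bE.
have Jfin := ball_moment_fin R m m.
pose j := fine (ball_moment R m m); have jE : ball_moment R m m = j%:E by rewrite fineK.
rewrite jE bE -EFinM lee_fin.
apply: (@le_of_pow_lt1 m) => [|t /andP[t0 t1]]; first exact: ltW.
have k0 : (0 <= t ^+ m * b)%R by exact: mulr_ge0 (exprn_ge0 m (ltW t0)) (ltW b0).
have mp : measurable_fun setT (fun x : 'rV[R]_m => (ball_power m x)%:E : \bar R).
  by apply/measurable_EFinP; exact: ball_power_measurable.
have p0 (x : 'rV[R]_m) : setT x -> 0 <= (ball_power m x)%:E :> \bar R.
  by move=> _; rewrite lee_fin ball_power_ge0.
have I0 (x : 'rV[R]_m) : setT x -> 0 <= \int[lam]_y f D (x, y).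
  by move=> _; apply: integral_ge0.
have main : (t ^+ m * b)%:E * ball_moment R m m <= \int[lam]_x \int[lam]_y f D (x, y).
  rewrite /ball_moment -(ge0_integralZl_EFin _ measurableT p0 mp k0).
  apply: (ge0_le_integral _ measurableT).
  - by move=> x Tx; apply: mule_ge0; [rewrite lee_fin|exact: p0].
  - by apply: emeasurable_funM mp; exact: measurable_cst.
  - exact: mI mD.
  move=> x _; rewrite (sec D x mD) /ball_power indicE.
  case: (boolP (x \in B)) => [/set_mem xB|xB]; last by rewrite mul0r mule0.
  have [->|x0] := eqVneq x 0%R.
    by rewrite enorm0 expr0n (gtn_eqF m0) mulr0 mule0; exact: measure_ge0.
  have n0 : (0 < enorm x)%R by rewrite sqrtr_gt0 sqn_gt0.
  have mxD : measurable [set y | D (x, y)].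
    by rewrite -[X in measurable X]setTI; exact: (pair1_measurable x).
  have -> : (t ^+ m * b)%:E * (1%:R * enorm x ^+ m)%:E = lam [set y : 'rV[R]_m | sqn y <= (t * enorm x) ^+ 2]%R.
    by rewrite (lebesgue_rV_sqn_le m (mulr_gt0 t0 n0)) -/B bE -!EFinM; congr EFin; rewrite exprMn mul1r; ring.
  apply: (le_measure_subset _ _ mxD).
    by apply: compact_rV_measurable; exact: compact_sqn_le.
  move=> y yx; have yx' := sqn_scaled_lt t0 t1 x0 yx.
  split; last exact: yx'.
  by split; [exact: xB|exact: (le_trans (ltW yx') xB)].
have S2' : 2%:E * ((t ^+ m * b)%:E * ball_moment R m m) <= lam B * lam B.
  by apply: le_trans S2; apply: lee_wpmul2l => //; rewrite lee_fin.
move: S2'; rewrite jE bE -!EFinM lee_fin => h.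
by rewrite -(ler_pM2r b0); apply: le_trans h; rewrite le_eqVlt; apply/orP; left; apply/eqP; ring.
Qed.

End Moments.

(** * A far point forces mass *)

Section FarPoint.
Variable R : realType.
Local Notation T := (measurableTypeR R).
Local Notation lam := (@lebesgue_rV R _).
Local Open Scope ereal_scope.

(** The interior is not part of the record: the bodies of interest contain the unit
ball, and slices of the unit ball are unit balls. *)
Record sym_body m (K : set 'rV[R]_m) : Prop := SymBody {
  sym_body_compact : compact K;
  sym_body_convex : convexr K;
  sym_body_opp : forall x, K x -> K (- x)%R }.

Lemma sym_body_measurable m (K : set 'rV[R]_m) : sym_body K -> measurable K.
Proof. by case=> cK _ _; exact: compact_rV_measurable. Qed.

Lemma closed_halfspace m (p : 'rV[R]_m) : closed [set x : 'rV[R]_m | (0 <= dotr x p)%R].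
Proof.
have -> : [set x : 'rV[R]_m | 0 <= dotr x p]%R = (fun x => dotr x p) @^-1` [set y | 0 <= y]%R by [].
apply: (@preimage_closed _ _ (fun x => dotr x p) [set y | (0 <= y)%R]); last exact: closed_ge.
move=> x; have -> : (fun x => dotr x p) = (fun y : 'rV[R]_1 => y 0%R 0%R) \o (fun x => x *m p^T)%R.
  by apply/funext => y; rewrite dotrE.
move=> _.

apply: (@continuous_comp _ _ _ (fun x : 'rV[R]_m => x *m p^T)%R (fun y : 'rV[R]_1 => y 0%R 0%R)).
  exact: mulmx_continuous.
exact: coord_continuous.
Qed.

Lemma enorm_half_le m (p y : 'rV[R]_m) : (0 <= dotr (2 *: y - p) p)%R ->
  (enorm p / 2 <= enorm y)%R.
Proof.
rewrite dotrDl dotrZl dotrNl => h.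
have [->|p0] := eqVneq p 0%R; first by rewrite enorm0 mul0r enorm_ge0.
have pp := sqn_gt0 p0; have cs := dotr_sqr_le y p.
rewrite -(@ler_pXn2r _ 2)// ?nnegrE ?enorm_ge0 ?divr_ge0 ?enorm_ge0//.
rewrite exprMn !sqr_sqrtr ?sqn_ge0// exprVn.
have h' : (sqn p <= 2 * dotr y p)%R by rewrite -subr_ge0.
rewrite -(ler_pM2r pp); apply: le_trans cs.
have -> : (sqn p * 2%:R ^- 2 * sqn p = (sqn p / 2) ^+ 2)%R by field.
by rewrite ler_pXn2r// ?nnegrE; lra.
Qed.

(** Half of L lies on the side of p.  The homothety x -> (x + p) / 2 sends this half into
L by convexity, divides its volume by 2^m, and moves it to distance at least |p| / 2 from
the origin. *)
Lemma far_point_moment m (L : set 'rV[R]_m) p : sym_body L -> L p ->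
  ((enorm p / 4) ^+ m)%:E * lam L <= 2%:E * \int[lam]_x (\1_L x * enorm x ^+ m)%R%:E.
Proof.
move=> symL Lp; have [cL vL oL] := symL; have mL := sym_body_measurable symL.
pose K := L `&` [set x : 'rV[R]_m | (0 <= dotr x p)%R].
have mK : measurable K.
  apply: measurableI => //.
  exact: closed_rV_measurable (@closed_halfspace m p).
have mK' (c : R) a : measurable [set x | K (c *: x + a)%R].
  by rewrite -[X in measurable X]setTI; exact: measurable_affine_rV.
have mKN : measurable [set x | K (- x)%R].
  have -> : [set x | K (- x)%R] = [set x | K (-1 *: x + 0)%R].
    by apply/seteqP; split=> x /=; rewrite scaleN1r addr0.
  exact: mK'.
have LK : lam L <= 2%:E * lam K.
  rewrite mule_natl mule2n -{2}(lebesgue_rV_opp mK).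
  apply: (@le_trans _ _ (lam (K `|` [set x | K (- x)%R]))); last exact: measureU2.
  apply: (le_measure_subset _ mL (measurableU _ _ mK mKN)) => x Lx.
  have [h|h] := leP 0%R (dotr x p); first by left.
  by right; split; [exact: oL|rewrite /= dotrNl oppr_ge0 ltW].
have t0 : (0 < 2 :> R)%R by [].
rewrite (lebesgue_rV_affine (- p)%R t0 mK) in LK.
pose X := [set x : 'rV[R]_m | K (2 *: x - p)%R]; rewrite -/X in LK.
have mX : measurable X := mK' 2%R (- p)%R.
have h0 : (0 <= (enorm p / 2) ^+ m)%R by rewrite exprn_ge0// divr_ge0// enorm_ge0.
have e0 (x : 'rV[R]_m) : (0 <= enorm x ^+ m)%R by rewrite exprn_ge0// enorm_ge0.
have XL : ((enorm p / 2) ^+ m)%:E * lam X <= \int[lam]_x (\1_L x * enorm x ^+ m)%R%:E.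
  rewrite -(integral_indicT _ mX) -(ge0_integralZl_EFin _ measurableT).
  - apply: (ge0_le_integral _ measurableT).
    + by move=> x _; rewrite -EFinM lee_fin; apply: mulr_ge0.
    + apply: emeasurable_funM; first exact: measurable_cst.
      exact/measurable_EFinP/measurable_indic.
    + apply/measurable_EFinP; apply: measurable_funM; first exact: measurable_indic.
      exact: enorm_exp_measurable.
    move=> x _; rewrite -EFinM lee_fin !indicE.
    case: (boolP (x \in X)) => [/set_mem [Lx px]|_]; last by rewrite mulr0; apply: mulr_ge0.
    have xL : L x.
      have -> : (x = 2^-1 *: (2 *: x - p) + (1 - 2^-1) *: p)%R.
        by rewrite scalerBr scalerA mulVf// scale1r scalerBl scale1r; apply/rowP => i; rewrite !mxE; field.
      by apply: vL => //; lra.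
    rewrite mem_set// mulr1 mul1r lerXn2r ?nnegrE ?enorm_ge0 ?divr_ge0 ?enorm_ge0//.
    exact: enorm_half_le.
  - by [].
  - exact/measurable_EFinP/measurable_indic.
  - exact: h0.
apply: (@le_trans _ _ (2%:E * (((enorm p / 2) ^+ m)%:E * lam X))); last first.
  by apply: lee_wpmul2l => //; rewrite lee_fin.
have q0 : (0 <= (enorm p / 4) ^+ m)%R by rewrite exprn_ge0// divr_ge0// enorm_ge0.
apply: (@le_trans _ _ (((enorm p / 4) ^+ m)%:E * (2%:E * ((2 ^+ m)%:E * lam X)))).
  by apply: lee_wpmul2l LK; rewrite lee_fin.
rewrite !muleA -!EFinM le_eqVlt; apply/orP; left; apply/eqP; congr (_%:E * _).
have -> : (enorm p / 2 = enorm p / 4 * 2)%R by field.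
by move: (enorm p / 4)%R => e; rewrite exprMn mulrA [(2 * _)%R]mulrC.
Qed.

End FarPoint.

(** * Slices and polars of symmetric bodies *)

Section Slice.
Variable R : realType.
Local Notation T := (measurableTypeR R).
Local Notation lam := (@lebesgue_rV R _).
Local Open Scope ereal_scope.

Lemma sym_body_slice m N (K : set 'rV[R]_N) (Q : 'M[R]_(m, N)) (Q' : 'M[R]_(N, m)) :
  (Q *m Q' = 1%:M)%R -> sym_body K -> sym_body [set z | K (z *m Q)%R].
Proof.
move=> QQ [cK vK oK]; split.
- apply: (@subclosed_compact _ _ ((fun x : 'rV[R]_N => x *m Q')%R @` K)).
  + apply: (@preimage_closed _ _ (fun z : 'rV[R]_m => z *m Q)%R K); last exact: rV_closed_of_compact.
    by move=> z _; exact: mulmx_continuous.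
  + apply: continuous_compact cK; apply: continuous_subspaceT.
    exact: mulmx_continuous.
  + by move=> z Kz; exists (z *m Q)%R => //; rewrite -mulmxA QQ mulmx1.
- by move=> t x y t01 Kx Ky /=; rewrite mulmxDl -!scalemxAl; exact: vK.
- by move=> x Kx /=; rewrite mulNmx; exact: oK.
Qed.

(** Compactness comes from the ball inside K, which bounds the polar. *)
Lemma sym_body_polar m (c : R) (K : set 'rV[R]_m) : (forall x, K x -> K (- x)%R) ->
  @eball R m `<=` K -> sym_body (polar_body c K).
Proof.
move=> oK BK; split.
- apply: (@subclosed_compact _ _ [set y : 'rV[R]_m | sqn y <= c ^+ 2]%R).
  + have -> : polar_body c K = \bigcap_(x in K) [set y : 'rV[R]_m | dotr x y <= c]%R.
      by apply/seteqP; split=> y h x; exact: h.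
    apply: closed_bigI => x _.
    apply: (@preimage_closed _ _ (fun y : 'rV[R]_m => dotr x y) [set t | (t <= c)%R]).
      move=> y _; have -> : (fun y => dotr x y) = (fun y : 'rV[R]_1 => y 0%R 0%R) \o (fun y => y *m x^T)%R.
        by apply/funext => z; rewrite dotrC dotrE.
      apply: (@continuous_comp _ _ _ (fun y : 'rV[R]_m => y *m x^T)%R (fun y : 'rV[R]_1 => y 0%R 0%R)).
        exact: mulmx_continuous.
      exact: coord_continuous.
    exact: closed_le.
  + exact: compact_sqn_le.
  + move=> y h; apply: sqn_le_of_dotr => x x1; rewrite dotrC; apply: h.
    exact: BK.
- move=> t y z /andP[t0 t1] hy hz x Kx; rewrite dotrDr !dotrZr.
  have := hy x Kx; have := hz x Kx; nra.
- by move=> y hy x Kx; rewrite dotrNr -dotrNl; apply: hy; exact: oK.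
Qed.

Lemma has_round_slice m N n (K : set 'rV[R]_N) (Q : 'M[R]_(m, N)) rho :
  has_round n [set z | K (z *m Q)%R] rho -> has_round n K rho.
Proof.
move=> [d [J [p [h1 h2]]]]; exists d, (J *m Q)%R, p; split.
- by move=> y /h1[s Ks <-]; exists s => //; rewrite mulmxA.
- by move=> s; rewrite mulmxA; exact: h2.
Qed.

(** A slice of small weighted mass from [average_subspace], in which a far point would force
large mass by [far_point_moment]. *)
Lemma slice_tradeoff m (K : set 'rV[R]_(m.+1 + m.+1)) (r : R) : (0 <= r)%R -> sym_body K ->
  lam K <= (r ^+ (m.+1 + m.+1))%:E * lam (@eball R (m.+1 + m.+1)) ->
  exists2 Q : 'M[R]_(m.+1, m.+1 + m.+1), (Q *m Q^T = 1%:M)%R &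
    forall p, K (p *m Q)%R -> (enorm p ^+ m.+1)%:E * lam [set z | K (z *m Q)%R] <=
      ((4 * r ^+ 2) ^+ m.+1)%:E * lam (@eball R m.+1).
Proof.
move=> r0 symK volK; have mK := sym_body_measurable symK.
have r0' : (0 <= r ^+ (m.+1 + m.+1))%R by rewrite exprn_ge0.
have := @average_subspace R m m.+1 0 (fun x => \1_K x)%R (r ^+ (m.+1 + m.+1)) r0'.
case=> [|||Q QQ hQ].
- exact: measurable_indic.
- by move=> x; rewrite indicE ler0n.
- rewrite (integral_indicT _ mK); apply: (le_trans volK).
  rewrite le_eqVlt; apply/orP; left; apply/eqP; congr (_ * _).
  rewrite /ball_moment -(integral_indicT _ (@measurable_eball R _)).
  by apply: eq_integral => x _; rewrite /ball_power expr0 mulr1.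
exists Q => // p Kp; set L := [set z | _].
have symL : sym_body L := sym_body_slice QQ symK.
have := far_point_moment symL Kp.
rewrite (_ : (fun x => _) = (fun z => (\1_K (z *m Q) * enorm z ^+ m.+1)%R%:E)); last first.
  by apply/funext => z; rewrite !indicE.
move=> hp; have {hp hQ} : ((enorm p / 4) ^+ m.+1)%:E * lam L <=
    (r ^+ (m.+1 + m.+1))%:E * lam (@eball R m.+1).
  apply: (le_trans hp); rewrite addn0 in hQ.
  have h2 : 0 <= 2%:E :> \bar R by rewrite lee_fin.
  apply: (le_trans (lee_wpmul2l h2 hQ)).
  rewrite muleCA; apply: lee_wpmul2l; first by rewrite lee_fin.
  exact: ball_moment_half.
move=> hp; have f0 : 0 <= (4 ^+ m.+1)%:E :> \bar R by rewrite lee_fin exprn_ge0.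
move/(lee_wpmul2l f0): hp; rewrite !muleA -!EFinM -exprMn mulrC divfK// => h.
apply: (le_trans h); rewrite le_eqVlt; apply/orP; left; apply/eqP.
by rewrite exprD -!exprMn -expr2.
Qed.

End Slice.

(** * Halving the dimension *)

Section Induction.
Variable R : realType.
Local Notation T := (measurableTypeR R).
Local Notation lam := (@lebesgue_rV R _).
Local Open Scope ereal_scope.

Definition radius k : R := (2 `^ ((3 / 2) ^+ k) * 4)%R.

Lemma radius_gt0 k : (0 < radius k)%R.
Proof. by rewrite mulr_gt0// powR_gt0. Qed.

Lemma radius0 : radius 0 = 8%R.
Proof. by rewrite /radius expr0 powRr1//; ring. Qed.

(** The exponents (3/2)^k are made for this: (2^a 4)^3 = 4 (2^(3a/2) 4)^2. *)
Lemma radiusS k : (4 * radius k.+1 ^+ 2 = radius k ^+ 3)%R.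
Proof.
rewrite /radius [((3 / 2) ^+ k.+1)%R]exprS; move: ((3 / 2) ^+ k)%R => a.
have e : (3 / 2 * a * 2 = a * 3)%R by field.
have h : ((2 `^ (3 / 2 * a)) ^+ 2 = (2 `^ a) ^+ 3 :> R)%R.
  rewrite -(powR_mulrn 2 (powR_ge0 _ _)) -(powR_mulrn 3 (powR_ge0 _ _)).
  by rewrite -!powRrM e.
move: (2 `^ (3 / 2 * a))%R (2 `^ a)%R h => x y h.
have -> : (4 * (x * 4) ^+ 2 = 64 * x ^+ 2)%R by ring.
by rewrite h; ring.
Qed.

(** A lower bound on the volume turns the trade-off into an outer radius. *)
Lemma enorm_le_pow m (L : set 'rV[R]_m.+1) (v c : R) p : (0 < v)%R -> (0 <= c)%R ->
  (v ^+ m.+1)%:E * lam (@eball R m.+1) <= lam L ->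
  (enorm p ^+ m.+1)%:E * lam L <= ((c * v) ^+ m.+1)%:E * lam (@eball R m.+1) ->
  (enorm (p : 'rV[R]_m.+1) <= c)%R.
Proof.
move=> v0 c0 hL hp.
have Bfin := lebesgue_rV_eball_fin R m.+1; have B0 := lebesgue_rV_eball_gt0 R m.+1.
move: hL hp; rewrite -(fineK Bfin); set b' := fine _ => hL hp.
have b0 : (0 < b')%R by rewrite -lte_fin fineK.
have e0 : (0 <= enorm p ^+ m.+1)%R by rewrite exprn_ge0// enorm_ge0.
have := le_trans (lee_wpmul2l (e0 : 0 <= (enorm p ^+ m.+1)%:E) hL) hp.
rewrite -!EFinM lee_fin mulrA ler_pM2r// exprMn ler_pM2r ?exprn_gt0//.
by rewrite ler_pXn2r// nnegrE enorm_ge0.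
Qed.

Lemma sqn_le_enorm m (p : 'rV[R]_m) c : (enorm p <= c -> sqn p <= c ^+ 2)%R.
Proof.
move=> pc; rewrite -[sqn p]sqr_sqrtr ?sqn_ge0// lerXn2r// nnegrE ?enorm_ge0//.
exact: le_trans (enorm_ge0 p) pc.
Qed.

(** Each step passes to a slice L of half the dimension; either L or its dilated polar
satisfies the hypothesis for the next smaller k.  For k = 0 the slice itself is round. *)
Theorem has_round_of_lebesgue_rV k n N (K : set 'rV[R]_N) : (0 < n)%N -> N = (2 ^ k.+1 * n)%N ->
  sym_body K -> @eball R N `<=` K ->
  lam K <= (radius k ^+ N)%:E * lam (@eball R N) -> has_round n K 256.
Proof.
move=> n0; elim: k N K => [|k IH] N K.
  rewrite expn1 mul2n -addnn; case: n n0 => // n _ NE; subst N.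
  move=> symK BK volK; have [Q QQ hQ] := slice_tradeoff (ltW (radius_gt0 0)) symK volK.
  apply: (@has_round_slice _ n.+1 _ _ _ Q).
  exists n.+1, 1%:M, 1%:M; split.
    move=> y y1; exists y; last exact: mulmx1.
    by rewrite /= mulmx1; apply: BK; rewrite /eball/= sqn_orth.
  move=> s; rewrite /= mulmx1 => Ks.
  have := hQ s Ks; rewrite radius0 (_ : (4 * 8 ^+ 2 = 256 * 1 :> R)%R); last by ring.
  have BL : @eball R n.+1 `<=` [set z | K (z *m Q)%R].
    by move=> y y1; apply: BK; rewrite /eball/= sqn_orth.
  have hL : (1 ^+ n.+1)%:E * lam (@eball R n.+1) <= lam [set z | K (z *m Q)%R].
    rewrite expr1n mul1e.
    apply: le_measure_subset BL; first exact: measurable_eball.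
    exact: sym_body_measurable (sym_body_slice QQ symK).
  move/(enorm_le_pow ltr01 (ler0n R 256) hL) => h.
  exact: sqn_le_enorm.
rewrite expnS -mulnA mul2n -addnn.
have : (0 < 2 ^ k.+1 * n)%N by rewrite muln_gt0 n0 expn_gt0.
case E : (2 ^ k.+1 * n)%N => [//|m] _ NE; subst N.
move=> symK BK volK; have [Q QQ hQ] := slice_tradeoff (ltW (radius_gt0 k.+1)) symK volK.
apply: (has_round_slice (Q := Q)); set L := [set z | K (z *m Q)%R] in hQ *.
have symL : sym_body L := sym_body_slice QQ symK.
have BL : @eball R m.+1 `<=` L by move=> y y1; apply: BK; rewrite /eball/= sqn_orth.
set s := radius k; have s0 : (0 < s)%R := radius_gt0 k.
(* Either L is small in volume, or its trade-off confines it to the ball of radius s ^+ 2. *)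
have [hL|/ltW hL] := leP (lam L) ((s ^+ m.+1)%:E * lam (@eball R m.+1)).
  exact: IH.
have s20 : (0 < s ^+ 2)%R by rewrite exprn_gt0.
have Ls p : L p -> (sqn p <= (s ^+ 2) ^+ 2)%R.
  move=> Lp; have := hQ p Lp; rewrite radiusS -/s [(s ^+ 3)%R]exprSr => /(enorm_le_pow s0 (ltW s20) hL).
  exact: sqn_le_enorm.
have [cL vL oL] := symL; have L0 : L 0%R by apply: BL; rewrite /eball/= (_ : sqn _ = 0%R)//; exact: dotr0l.
apply: (@has_round_polar R _ n L (s ^+ 2)%R) => //.
have symM := sym_body_polar (s ^+ 2)%R oL BL.
apply: (IH _ _ (esym E) symM).
  by move=> y y1 x Lx; apply: dotr_le => //; [exact: ltW|exact: Ls].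
have [cM _ oM] := symM; set M := polar_body _ _ in cM oM *.
have := santalo (c := (s ^+ 2)%R) cL cM oL oM (fun x y Lx My => My x Lx).
rewrite (lebesgue_rV_sqn_le _ s0) -/s => h.
have Bfin := lebesgue_rV_eball_fin R m.+1; have B0 := lebesgue_rV_eball_gt0 R m.+1.
set b := _ * lam (@eball R m.+1) in h hL *.
have bfin : b \is a fin_num by rewrite fin_numM.
have b0 : 0 < b by rewrite mule_gt0// lte_fin exprn_gt0.
have : b * lam M <= b * b by apply: le_trans h; apply: lee_wpmul2r.
by rewrite lee_pmul2l.
Qed.

End Induction.

(** * Linear charts and ellipsoids *)

Import passmx.

Section Charts.
Variable R : realType.
Local Notation lam := (@lebesgue_rV R _).

Lemma mulmx_id_eq1 n (M : 'M[R]_n) : (forall x : 'rV[R]_n, x *m M = x) -> M = 1%:M.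
Proof. by move=> h; apply/row_matrixP => i; rewrite rowE h row1. Qed.

Lemma of_coordsE (V : vectType R) : @of_coords R V = passmx.vecof (vbasis {:V}).
Proof. by []. Qed.

(** Being a ball is independent of the linear coordinates used to test compactness and
interior: those of the basis of V differ from g by an invertible matrix. *)
Lemma ball_body_chart (V : vectType R) n (g : {linear V -> 'rV[R]_n})
    (f : {linear 'rV[R]_n -> V}) (L : set 'rV[R]_n) :
  cancel f g -> cancel g f -> sym_body L -> @eball R n `<=` L ->
  ball_body [set v | L (g v)].
Proof.
move=> fK gK symL BL.
pose b := vbasis {:V}; have bb : basis_of {:V} b := vbasisP {:V}.
pose h : {linear 'rV[R]_(\dim {:V}) -> 'rV[R]_n} := g \o passmx.vecof b.
pose h' : {linear 'rV[R]_n -> 'rV[R]_(\dim {:V})} := passmx.rVof b \o f.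
pose M := lin1_mx h; pose M' := lin1_mx h'.
have ME (x : 'rV[R]_(\dim {:V})) : x *m M = g (of_coords x) by rewrite (mul_rV_lin1 h).
have M'E (x : 'rV[R]_n) : x *m M' = passmx.rVof b (f x) by rewrite (mul_rV_lin1 h').
have MM' : M *m M' = 1%:M.
  by apply: mulmx_id_eq1 => x; rewrite mulmxA ME M'E gK of_coordsE passmx.vecofK.
have preE (A : set 'rV[R]_n) : @of_coords R V @^-1` [set v | A (g v)] = [set x | A (x *m M)].
  by apply/seteqP; split=> x /=; rewrite ME.
have [cL vL oL] := symL.
split.
- by rewrite preE; have [] := sym_body_slice MM' symL.
- exists 0; rewrite preE /interior; apply: (@filterS _ _ _ [set x : 'rV[R]_(\dim {:V}) | sqn (x *m M) < 1]).
    by move=> x /= x1; apply: BL; exact: ltW.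
  apply: open_nbhs_nbhs; split; last by rewrite /= mul0mx [sqn _]dotr0l.
  apply: (@open_comp _ _ (fun x : 'rV[R]_(\dim {:V}) => sqn (x *m M)) [set t | t < 1]); last exact: open_lt.
  move=> x _; apply: (@continuous_comp _ _ _ (fun x : 'rV[R]_(\dim {:V}) => x *m M) (@sqn R n)).
    exact: mulmx_continuous.
  exact: sqn_continuous.
- move=> x y t /set_mem Lx /set_mem Ly; apply/mem_set => /=.
  rewrite -[conv _ _ _]/(t%:num *: (x : V) + (1 - t%:num) *: (y : V)).
  by rewrite linearP linearZ; apply: vL => //; rewrite ge0 le1.
- by move=> x /=; rewrite linearN; exact: oL.
Qed.

Lemma ball_body_sym_body (V : vectType R) (K : set V) : ball_body K ->
  sym_body (@of_coords R V @^-1` K).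
Proof.
move=> [cK _ vK oK]; split => //.
  move=> t x y /andP[t0 t1] Kx Ky.
  have := vK _ _ (Itv01 t0 t1) (mem_set Kx) (mem_set Ky) => /set_mem.
  by rewrite /= of_coordsE linearP linearZ.
by move=> x Kx; rewrite /= of_coordsE linearN; exact: oK.
Qed.

(** The infimum is attained at t = |g v|. *)
Lemma gauge_chart (V : vectType R) n (g : {linear V -> 'rV[R]_n})
    (f : {linear 'rV[R]_n -> V}) v : cancel f g -> cancel g f ->
  gauge [set v | sqn (g v) <= 1] v = enorm (g v).
Proof.
move=> fK gK; rewrite /gauge; set S := mkset _.
have lbS : lbound S (enorm (g v)).
  move=> t [t0 [x x1 ->]]; rewrite linearZ /enorm sqnZ.
  rewrite -[leRHS](ger0_norm t0) -sqrtr_sqr ler_wsqrtr//.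
  by rewrite ler_piMr// sqr_ge0.
have vS : S (enorm (g v)).
  split; first exact: enorm_ge0.
  have [g0|g0] := eqVneq (g v) 0.
    have v0 : v = 0 by rewrite -[v]gK g0 linear0.
    by exists 0; rewrite /= ?linear0 ?[sqn _]dotr0l// v0 scaler0.
  have e0 : 0 < enorm (g v) by rewrite sqrtr_gt0 sqn_gt0.
  exists ((enorm (g v))^-1 *: v).
    rewrite /= linearZ sqnZ exprVn sqr_sqrtr ?sqn_ge0// mulVf//.
    by rewrite gt_eqF ?sqn_gt0.
  by rewrite scalerA mulfV ?scale1r// gt_eqF.
apply/eqP; rewrite eq_le; apply/andP; split.
  by apply: ge_inf => //; exists (enorm (g v)).
by apply: lb_le_inf => //; exists (enorm (g v)).
Qed.

Lemma sym_body_eball n : sym_body (@eball R n).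
Proof.
split; first exact: compact_eball.
- move=> t x y /andP[t0 t1] x1 y1; rewrite /eball/= -(expr1n R 2).
  apply: sqn_le_of_dotr => z z1; rewrite dotrDl !dotrZl.
  have h u : sqn u <= 1 -> dotr u z <= 1 by move=> u1; apply: dotr_le => //; rewrite expr1n.
  have := h x x1; have := h y y1; nra.
- by move=> x; rewrite /eball /= /sqn dotrNl dotrNr opprK.
Qed.

Lemma ellipsoid_chart (V : vectType R) n (g : {linear V -> 'rV[R]_n})
    (f : {linear 'rV[R]_n -> V}) : cancel f g -> cancel g f ->
  ellipsoid [set v | sqn (g v) <= 1].
Proof.
move=> fK gK; split.
  exact: (ball_body_chart fK gK (@sym_body_eball n)).
pose op (u v : V) : R := dotr (g u) (g v).
have h1 : bilinear_for *%R (idfun \; *%R) op.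
  split=> u a x y.
    by rewrite /op linearP dotrDl dotrZl.
  by rewrite /op linearP dotrDr dotrZr.
have h2 : forall x y : V, op x y = (-1) ^+ false * idfun (op y x).
  by move=> x y; rewrite expr0 mul1r /op dotrC.
have h3 : forall u : V, u != 0 -> 0 < op u u.
  move=> u u0; apply: sqn_gt0; apply: contra_neq u0 => gu0.
  by rewrite -[u]gK gu0 linear0.
pose D : {dot V for idfun} := HB.pack op
  (bilinear_isBilinear.Build _ _ _ _ _ _ op h1)
  (isHermitianSesquilinear.Build _ _ _ _ op h2)
  (isDotProduct.Build _ _ op h3).
by exists D => v; rewrite (gauge_chart v fK gK).
Qed.

(** Used to let a scaling factor tend to 1. *)
Lemma closed_contains1 (S : set R) : closed S -> (forall s, 0 <= s < 1 -> S s) -> S 1.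
Proof.
move=> cS hS; apply: contrapT => S1.
have : nbhs (1 : R) (~` S) by apply: open_nbhs_nbhs; split => //; exact: closed_openC.
move=> /nbhs_ballP[e /= e0 he].
have [e1|e1] := leP e 1; last first.
  by apply: (he 0); [rewrite /ball/= subr0 normr1|apply: hS; rewrite lexx ltr01].
apply: (he (1 - e / 2)); last by apply: hS; lra.
by rewrite /ball/= opprB addrC subrK gtr0_norm; lra.
Qed.

Lemma dot_sym (V : vectType R) (D : {dot V for idfun}) u v : D u v = D v u.
Proof. by rewrite (hermC D) expr0 mul1r. Qed.

(** If dot v v <= 1 then s v lies in E for all s < 1 by the definition of the gauge, and E
is closed.  An empty set in the infimum gives gauge 0, which happens for v = 0 only. *)
Lemma ellipsoidE (V : vectType R) (E : set V) : ellipsoid E ->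
  exists D : {dot V for idfun}, E = [set v | D v v <= 1].
Proof.
move=> [bE [D gE]]; exists D; have [cA vA oA] := ball_body_sym_body bE.
have [_ [c0 c0E] _ _] := bE; move/interior_subset in c0E.
have E0 : E (of_coords 0).
  have := vA 2^-1 c0 (- c0) _ c0E (oA _ c0E); rewrite scalerN.
  have -> : (2^-1 *: c0 - (1 - 2^-1) *: c0 = 0 :> 'rV[R]__).
    by rewrite -scalerBl (_ : 2^-1 - _ = 0) ?scale0r//; lra.
  by apply; lra.
have D0 v : 0 <= D v v.
  by have [->|/neq0_dnorm_gt0/ltW//] := eqVneq v 0; rewrite linear0r.
have oc0 : of_coords (0 : 'rV[R]_(\dim {:V})) = 0 by rewrite of_coordsE linear0.
rewrite oc0 in E0.
pose S v := [set t : R | 0 <= t /\ exists2 x, E x & v = t *: x].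
apply/seteqP; split=> v /=.
  move=> Ev; have : gauge E v <= 1.
    by apply: ge_inf; [exists 0 => t []|split => //; exists v; rewrite ?scale1r].
  by rewrite gE -{1}sqrtr1 ler_sqrt.
move=> Dv; pose c := rVof (vbasis {:V}) v.
have cK : of_coords c = v by exact: (rVofK (vbasisP {:V})).
rewrite -cK -[c]scale1r.
have oZ t (x : 'rV[R]_(\dim {:V})) : of_coords (t *: x) = t *: of_coords x.
  by rewrite of_coordsE linearZ.
apply: (@closed_contains1 [set t | E (of_coords (t *: c))]).
  apply: (@preimage_closed _ _ (fun t : R => t *: c) (@of_coords R V @^-1` E)).
    by move=> t _; exact: scalel_continuous.
  exact: rV_closed_of_compact.
move=> s /andP[s0 s1] /=; rewrite oZ cK.
have [->|sn0] := eqVneq s 0; first by rewrite scale0r.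
have {}s0 : 0 < s by rewrite lt_neqAle eq_sym sn0.
have [Sv0|Sv0] := eqVneq (S v) set0.
  have : gauge E v = 0 by rewrite /gauge -/(S v) Sv0 inf0.
  rewrite gE => /eqP; rewrite sqrtr_eq0 => Dv0.
  have [->|/neq0_dnorm_gt0] := eqVneq v 0; first by rewrite scaler0.
  by move=> /(_ idfun D); rewrite ltNge Dv0.
have : gauge E v < s^-1.
  apply: (@le_lt_trans _ _ 1); last by rewrite invf_gt1.
  by rewrite gE -{1}sqrtr1 ler_sqrt.
move=> /(inf_lt (proj1 (set0P _) Sv0))[t [t0 [x Ex ->]] ts].
rewrite scalerA; pose y := rVof (vbasis {:V}) x.
have yK : of_coords y = x by exact: (rVofK (vbasisP {:V})).
have st : s * t < 1 by rewrite -(ltr_pdivlMl _ _ s0) mulr1.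
have st01 : 0 <= s * t <= 1 by rewrite (mulr_ge0 (ltW s0) t0) (ltW st).
have Ay : (@of_coords R V @^-1` E) y by rewrite /= yK.
have A0 : (@of_coords R V @^-1` E) 0 by rewrite /= oc0.
by have := vA (s * t) y 0 st01 Ay A0; rewrite /= scaler0 addr0 oZ yK.
Qed.

(** Coordinates orthonormal for the scalar product of E. *)
Lemma ellipsoid_normal_form (V : vectType R) (E : set V) : ellipsoid E ->
  exists2 T : 'M[R]_(\dim {:V}), T \in unitmx &
    [set x | E (of_coords (x *m T))] = @eball R (\dim {:V}).
Proof.
move=> /ellipsoidE[D ->]; set N := \dim {:V}.
pose G := \matrix_(i < N, j < N) D (vbasis {:V})`_i (vbasis {:V})`_j.
have GE (x y : 'rV[R]_N) : (x *m G *m y^T) 0 0 = D (of_coords x) (of_coords y).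
  rewrite mxE /of_coords /vecof [RHS]linear_sum /=; apply: eq_bigr => j _.
  rewrite linearZ /= [D _ (vbasis _)`_j]dot_sym linear_sum /= !mxE mulrC; congr (_ * _).
  by apply: eq_bigr => i _; rewrite linearZ /= mxE dot_sym.
have Gs : G^T = G by apply/matrixP => i j; rewrite !mxE dot_sym.
have Gp (x : 'rV[R]_N) : x != 0 -> 0 < (x *m G *m x^T) 0 0.
  move=> x0; rewrite GE; apply: neq0_dnorm_gt0.
  by rewrite of_coordsE vecof_eq0// vbasisP.
have [T uT TG] := posdef_orthonormal Gs Gp; exists T => //.
apply/seteqP; split=> x; rewrite /eball /= -GE trmx_mul !mulmxA -(mulmxA x T G) -(mulmxA x _ T^T) TG mulmx1;
by rewrite -dotrE.
Qed.

End Charts.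

(** * From matrices to a subquotient *)

Section Subquotient.
Variable R : realType.

(** The subquotient encoded by (J, p) in [has_round]. *)
Definition marginal N d n (K : set 'rV[R]_N) (J : 'M[R]_(d, N)) (p : 'M[R]_(d, n)) :
  set 'rV[R]_n := [set y | exists2 s, K (s *m J) & s *m p = y].

(** A bounded line is a point. *)
Lemma sqn_unbounded n (y : 'rV[R]_n) c : (forall t, sqn (t *: y) <= c) -> y = 0.
Proof.
move=> h; apply/eqP; apply: contraT => y0; have a0 := sqn_gt0 y0.
have := h (Num.sqrt (c + 1) / Num.sqrt (sqn y)).
have c0 : 0 <= c by have := h 0; apply: le_trans; exact: sqn_ge0.
rewrite sqnZ expr_div_n !sqr_sqrtr ?addr_ge0// ?(ltW a0)// divfK ?gt_eqF//.
by move=> hc; exfalso; lra.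
Qed.

Section Marginal.
Variables (N d n : nat) (K : set 'rV[R]_N) (J : 'M[R]_(d, N)) (p : 'M[R]_(d, n)) (c : R).
Hypotheses (symK : sym_body K) (K0 : K 0).
Hypothesis (Kc : forall s, K (s *m J) -> sqn (s *m p) <= c).

(** A vector killed by J but not by p would make the subquotient unbounded. *)
Lemma marginal_ker (s : 'rV[R]_d) : s *m J = 0 -> s *m p = 0.
Proof.
move=> sJ; apply: (@sqn_unbounded _ _ c) => t.
by rewrite scalemxAl; apply: Kc; rewrite -scalemxAl sJ scaler0.
Qed.

(** By [marginal_ker] the map p factors through the range of J, so the marginal is a
linear image of a slice of K: this is why it is compact although J need not be injective. *)
Lemma marginal_factor : J *m (pinvmx J *m p) = p.
Proof.
apply/row_matrixP => i; apply/eqP; rewrite -subr_eq0; apply/eqP.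
have -> : row i (J *m (pinvmx J *m p)) - row i p = row i (J *m pinvmx J - 1%:M) *m p.
  by rewrite -row_mul mulmxBl mul1mx mulmxA linearB.
by apply: marginal_ker; rewrite -row_mul mulmxBl mul1mx mulmxKpV// subrr row0.
Qed.

Lemma sym_body_marginal : sym_body (marginal K J p).
Proof.
have [cK vK oK] := symK; split.
- have -> : marginal K J p =
      (fun x => x *m (pinvmx J *m p)) @` (K `&` [set x | x *m cokermx J = 0]).
    apply/seteqP; split=> y.
      move=> [s Ks <-]; exists (s *m J); last by rewrite -mulmxA marginal_factor.
      by split => //=; rewrite -mulmxA mulmx_coker mulmx0.
    move=> [x [Kx /= xJ] <-]; have /submxP[s xE] : (x <= J)%MS by rewrite submxE xJ.
    by exists s; rewrite -?xE// [in RHS]xE -[RHS]mulmxA marginal_factor.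
  apply: continuous_compact; first by apply: continuous_subspaceT; exact: mulmx_continuous.
  apply: compact_closedI => //.
  apply: (@preimage_closed _ _ (fun x : 'rV[R]_N => x *m cokermx J) [set 0]).
    by move=> x _; exact: mulmx_continuous.
  by apply: rV_closed_of_compact; exact: compact_set1.
- move=> t _ _ t01 [s Ks <-] [s' Ks' <-]; exists (t *: s + (1 - t) *: s').
    by rewrite mulmxDl -!scalemxAl; exact: vK.
  by rewrite mulmxDl -!scalemxAl.
- by move=> _ [s Ks <-]; exists (- s); rewrite mulNmx//; exact: oK.
Qed.

End Marginal.

Lemma round_chart (V : vectType R) n (g : {linear V -> 'rV[R]_n})
    (f : {linear 'rV[R]_n -> V}) (L : set 'rV[R]_n) (rho : R) :
  cancel f g -> cancel g f -> 0 < rho -> @eball R n `<=` L ->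
  (forall y, L y -> sqn y <= rho ^+ 2) -> round rho [set v | L (g v)].
Proof.
move=> fK gK rho0 BL Lrho; exists [set v | sqn (g v) <= 1]; split.
- exact: ellipsoid_chart fK gK.
- by move=> v; exact: BL.
- move=> v /Lrho gv; exists (rho^-1 *: v); last by rewrite scalerA mulfV ?scale1r// gt_eqF.
  by rewrite /= linearZ sqnZ exprVn ler_pdivrMl ?mulr1// exprn_gt0.
Qed.

(** W is the image under J of the kernel of p, and U the image of R^n in V / W under any
right inverse P of p.  In the chart of U so obtained, the subquotient is the marginal of K
along (J, p). *)
Lemma has_round_subquotient (V : vectType R) N n (phi : {linear 'rV[R]_N -> V})
    (psi : V -> 'rV[R]_N) (K : set V) (rho : R) :
  cancel phi psi -> cancel psi phi -> 0 < rho ->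
  sym_body (phi @^-1` K) -> K (phi 0) -> has_round n (phi @^-1` K) rho ->
  exists (W : {vspace V}) (U : {vspace quotv W}),
    [/\ \dim U = n, ball_body (subquotient K W U) & round rho (subquotient K W U)].
Proof.
move=> phiK psiK rho0 symK K0 [d [J [p [h1 h2]]]].
have symL := sym_body_marginal symK K0 h2.
set L := marginal _ _ _ in symL.
have BL : @eball R n `<=` L by [].
have Lrho y : L y -> sqn y <= rho ^+ 2 by move=> [s Ks <-]; exact: h2.
have [P Pp] : exists P : 'M[R]_(n, d), P *m p = 1%:M.
  have /submxP[P PE] : (1%:M <= p)%MS; last by exists P.
  apply/row_subP => i; have := h1 (row i 1%:M); rewrite row1.
  have -> : sqn (delta_mx 0 i : 'rV[R]_n) = 1 by rewrite /sqn dotr_delta mxE !eqxx.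
  by move=> /(_ (lexx _))[s _ <-]; exact: submxMl.
pose W := (linfun (phi \o mulmxr J) @: lker (linfun (mulmxr p : _ -> 'rV[R]_n)))%VS.
have memW x : x \in W <-> exists2 s : 'rV[R]_d, s *m p = 0 & x = phi (s *m J).
  split=> [/memv_imgP[s]|[s sp ->]].
    by rewrite memv_ker !lfunE/= => /eqP sp ->; exists s.
  apply/memv_imgP; exists s; first by rewrite memv_ker lfunE/= sp.
  by rewrite lfunE.
pose th : {linear 'rV[R]_n -> quotv W} := quotv_pi W \o (phi \o mulmxr (P *m J)).
have thE y : th y = quotv_pi W (phi (y *m P *m J)) by rewrite /= mulmxA.
have kth : lker (linfun th) == 0%VS.
  apply/lker0P => y z; rewrite !lfunE !thE => /quotv_piP/memW[s sp].
  rewrite -linearB -!mulmxBl => /(can_inj phiK) e.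
  apply/eqP; rewrite -subr_eq0 -[y - z]mulmx1 -Pp mulmxA; apply/eqP.
  have sJ : ((y - z) *m P - s) *m J = 0 by rewrite mulmxBl e subrr.
  by have := marginal_ker K0 h2 sJ; rewrite mulmxBl sp subr0.
pose U := limg (linfun th); exists W, U.
pose g : {linear subvs_of U -> 'rV[R]_n} := (linfun th)^-1%VF \o vsval.
pose f : {linear 'rV[R]_n -> subvs_of U} := vsproj U \o linfun th.
have fK : cancel f g.
  by move=> y; rewrite /= vsprojK ?memv_img ?memvf// lker0_lfunK.
have gK : cancel g f.
  move=> u; apply/val_inj; rewrite /= limg_lfunVK ?subvsP// vsprojK ?subvsP//.
have valE u : vsval u = quotv_pi W (phi (g u *m P *m J)).
  by rewrite -thE -[LHS](limg_lfunVK (subvsP u)) lfunE.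
have -> : subquotient K W U = [set u | L (g u)].
  apply/seteqP; split=> u.
    move=> [x Kx]; rewrite valE => /quotv_piP/memW[s sp xE].
    exists (g u *m P + s); last by rewrite mulmxDl sp addr0 -mulmxA Pp mulmx1.
    by rewrite /preimage /= mulmxDl linearD -xE addrC subrK.
  move=> [s Ks sp]; exists (phi (s *m J)); first exact: Ks.
  rewrite valE; apply/quotv_piP/memW.
  exists (s - g u *m P); last by rewrite mulmxBl linearB.
  by rewrite mulmxBl sp -mulmxA Pp mulmx1 subrr.
split.
- rewrite limg_dim_eq; first by rewrite dimvf dim_matrix mul1r.
  by rewrite (eqP kth) capv0.
- exact: (ball_body_chart fK gK symL BL).
- exact: (round_chart fK gK rho0 BL Lrho).
Qed.

End Subquotient.

(** * Volume ratios in normalized coordinates *)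

(** Both volumes are multiplied by the same constant under T, and T takes the ball to E. *)
Lemma lebesgue_rV_normal_form (R : realType) (V : vectType R) (K E : set V) (r : R)
    (T : 'M[R]_(\dim {:V})) : T \in unitmx -> ball_body K ->
  [set x | E (of_coords (x *m T))] = @eball R (\dim {:V}) ->
  measurable (@of_coords R V @^-1` E) ->
  (vol K / vol E <= (r ^+ \dim {:V})%:E)%E ->
  (@lebesgue_rV R _ [set x | K (of_coords (x *m T))%R] <= (r ^+ \dim {:V})%:E * @lebesgue_rV R _ (@eball R (\dim {:V})))%E.
Proof.
move=> uT bK ET mE.
have [c c0 cE] := lebesgue_rV_linear uT.
have mK := sym_body_measurable (ball_body_sym_body bK).
rewrite -[vol K]/(@lebesgue_rV R _ (@of_coords R V @^-1` K)) -[vol E]/(@lebesgue_rV R _ (@of_coords R V @^-1` E)).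
have Bfin := lebesgue_rV_eball_fin R (\dim {:V}); have B0 := lebesgue_rV_eball_gt0 R (\dim {:V}).
have cEE : @lebesgue_rV R _ [set x | E (of_coords (x *m T))] = (c%:E * @lebesgue_rV R _ (@of_coords R V @^-1` E))%E := cE _ mE.
have cKE : @lebesgue_rV R _ [set x | K (of_coords (x *m T))] = (c%:E * @lebesgue_rV R _ (@of_coords R V @^-1` K))%E := cE _ mK.
rewrite -ET cEE in Bfin B0 *; rewrite cKE.
set a := @lebesgue_rV R _ (@of_coords R V @^-1` E) in Bfin B0 *.
have a0 : (0 < a)%E by move: B0; rewrite pmule_rgt0.
have : a \is a fin_num.
  move: Bfin; rewrite !ge0_fin_numE ?(ltW a0) ?(ltW B0)//.
  by apply: contraTT; rewrite -!leNgt !leye_eq => /eqP ->; rewrite gt0_muley.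
move: a0; case: a {Bfin B0} => // a; rewrite lte_fin => a0 _.
rewrite inver gt_eqF// lee_pdivrMr// muleCA => h.
by apply: lee_wpmul2l h; rewrite lee_fin ltW.
Qed.

Theorem theorem1 (R : realType) (k n : nat) (V : vectType R) (K : set V) :
  (1 <= n)%N ->
  \dim {:V} = (2 ^ k.+1 * n)%N ->
  ball_body K ->
  semiround (2 `^ ((3 / 2) ^+ k) * 4) K ->
  exists (W : {vspace V}) (U : {vspace quotv W}),
    [/\ \dim U = n, ball_body (subquotient K W U) & round 256 (subquotient K W U)].
Proof.
move=> n0 dimV bK [E [ellE EK volK]].
have [T uT ET] := ellipsoid_normal_form ellE.
have symE := ball_body_sym_body (proj1 ellE).
have volK' := lebesgue_rV_normal_form uT bK ET (sym_body_measurable symE) volK.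
pose phi : {linear 'rV[R]_(\dim {:V}) -> V} := vecof (vbasis {:V}) \o mulmxr T.
pose psi (v : V) : 'rV[R]_(\dim {:V}) := rVof (vbasis {:V}) v *m invmx T.
have phiK : cancel phi psi.
  by move=> x; rewrite /psi /= (vecofK (vbasisP {:V})) mulmxK.
have psiK : cancel psi phi.
  by move=> v; rewrite /psi /= mulmxKV// (rVofK (vbasisP {:V})).
have symK : sym_body (phi @^-1` K).
  exact: (sym_body_slice (mulmxV uT) (ball_body_sym_body bK)).
have BK : @eball R (\dim {:V}) `<=` phi @^-1` K by rewrite -ET => x; exact: EK.
have K0 : K (phi 0) by apply: BK; rewrite /eball/= [sqn _]dotr0l.
apply: (has_round_subquotient phiK psiK _ symK K0) => //.
exact: (has_round_of_lebesgue_rV n0 dimV symK BK volK').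
Qed.
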